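(* Let $n\ge2$, let $\Omega\subset\mathbb{R}^n$ be a domain and let $A\in\mathscr{A}_{\rm wusc}(\Omega)$. Then for every function $u:\Omega\to\mathbb{R}$ that is Lipschitz with respect to the Euclidean metric, $$(\mathrm{Lip}_{d_A}u(x))^2=\langle A(x)\nabla u(x),\nabla u(x)\rangle\qquad\text{for almost every }x\in\Omega.$$
   Context: A domain is a connected open set. $\mathscr{A}(\Omega)$ is the set of all measurable maps $A=(a_{ij}):\Omega\to\mathbb{R}^{n\times n}$ for which there is a continuous function $\lambda:\Omega\to[1,\infty)$ with $\frac{1}{\lambda(x)}|\xi|^2\le\langle A(x)\xi,\xi\rangle\le\lambda(x)|\xi|^2$ for almost every $x\in\Omega$ and all $\xi\in\mathbb{R}^n$, where $\langle A(x)\xi,\xi\rangle=\sum_{i,j}\xi_ia_{ij}(x)\xi_j$. The intrinsic distance is $d_A(x,y)=\sup\{u(x)-u(y)\}$, the supremum being over all $u\in C(\Omega)\cap W^{1,2}_{\mathrm{loc}}(\Omega)$ with $\langle A(z)\nabla u(z),\nabla u(z)\rangle\le1$ for almost every $z\in\Omega$. The pointwise Lipschitz constant is $\mathrm{Lip}_{d_A}u(x)=\limsup_{y\to x}\frac{|u(y)-u(x)|}{d_A(x,y)}$. A function $f:\Omega\to\mathbb{R}$ is weak upper semicontinuous at $x\in\Omega$ if there is a set $E$ of Lebesgue measure zero with $f(x)\ge\limsup_{(\Omega\setminus E)\ni y\to x}f(y)$; it is weak upper semicontinuous on $\Omega$ if it is weak upper semicontinuous at almost every $x\in\Omega$. $\mathscr{A}_{\rm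 wusc}(\Omega)$ is the set of all $A\in\mathscr{A}(\Omega)$ that are weak upper semicontinuous on $\Omega$, i.e. such that for every $\xi\in S^{n-1}$ the function $\langle A(\cdot)\xi,\xi\rangle$ is weak upper semicontinuous at almost every $x\in\Omega$. *)

(* Defs.v *)
From HB Require Import structures.
From mathcomp Require Import all_boot all_order all_algebra.
From mathcomp Require Import all_classical all_reals all_analysis.

Set Implicit Arguments.
Unset Strict Implicit.
Unset Printing Implicit Defensive.

Import Order.TTheory GRing.Theory Num.Theory.
Import numFieldNormedType.Exports.

Local Open Scope classical_set_scope.
Local Open Scope ring_scope.

(* Lebesgue measure on R^n.  The iterated product of [lebesgue_measure] lives
   on the product sigma-algebra of [n.-tuple R]; the induced outer measure,
   transported to row vectors, yields by Caratheodory's theorem the complete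
   Lebesgue measure on the sigma-algebra of Lebesgue measurable sets. *)
Section iterated_product.
Variables (R : realType) (n : nat).
Variable m : {sigma_finite_measure set (n.-tuple (measurableTypeR R)) -> \bar R}.

Definition tuple_cons (p : measurableTypeR R * n.-tuple (measurableTypeR R)) :
  n.+1.-tuple (measurableTypeR R) := [the n.+1.-tuple _ of p.1 :: p.2].

Lemma measurable_tuple_cons : measurable_fun setT tuple_cons.
Proof. by apply: measurable_cons. Qed.

Definition prod_step := pushforward (@lebesgue_measure R \x m)%E tuple_cons.

Let prod_step0 : prod_step set0 = 0%E.
Proof. by rewrite /prod_step /pushforward preimage_set0 measure0. Qed.

Let prod_step_ge0 X : (0 <= prod_step X)%E.
Proof. exact: (measure_ge0 (@lebesgue_measure R \x m)%E). Qed.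

Let measurable_preimage_tuple_cons X :
  measurable X -> measurable (tuple_cons @^-1` X).
Proof.
by move=> mX; rewrite -[_ @^-1` _]setTI; exact: measurable_tuple_cons.
Qed.

Let prod_step_sigma_additive : semi_sigma_additive prod_step.
Proof.
move=> F mF tF mUF; rewrite /prod_step /pushforward preimage_bigcup.
apply: measure_semi_sigma_additive.
- by move=> k; exact: measurable_preimage_tuple_cons.
- apply/trivIsetP => i j _ _ ij; rewrite -preimage_setI.
  by move/trivIsetP : tF => /(_ _ _ _ _ ij) ->//; rewrite preimage_set0.
- by rewrite -preimage_bigcup; exact: measurable_preimage_tuple_cons.
Qed.

HB.instance Definition _ := isMeasure.Build _ _ _ prod_step
  prod_step0 prod_step_ge0 prod_step_sigma_additive.

Let prod_step_sigma_finite : sigma_finite setT prod_step.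
Proof.
have /sigma_finiteP[F [FT ndF Foo]] := sigma_finiteT (@lebesgue_measure R).
have /sigma_finiteP[G [GT ndG Goo]] := sigma_finiteT m.
pose g (t : n.+1.-tuple (measurableTypeR R)) := (thead t, [tuple of behead t]).
have mg : measurable_fun setT g.
  by apply/measurable_fun_pair; [exact: measurable_tnth|exact: measurable_behead].
exists (fun k => g @^-1` (F k `*` G k)).
  apply/seteqP; split => // t _.
  have [i _ Fi] : (\bigcup_i F i) (thead t) by rewrite -FT.
  have [j _ Gj] : (\bigcup_i G i) [tuple of behead t] by rewrite -GT.
  exists (maxn i j) => //; split => /=.
  - by move: (thead t) Fi; exact/subsetPset/ndF/leq_maxl.
  - by move: ([tuple of behead t]) Gj; exact/subsetPset/ndG/leq_maxr.
move=> k; have [mF Fk] := Foo k; have [mG Gk] := Goo k; split.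
  by rewrite -[X in measurable X]setTI; apply: mg => //; exact: measurableX.
rewrite /prod_step /pushforward (_ : tuple_cons @^-1` _ = F k `*` G k).
  by rewrite product_measure1E// lte_mul_pinfty// ge0_fin_numE.
have gK p : g (tuple_cons p) = p.
  by case: p => x t; rewrite /g /tuple_cons theadE; congr pair; exact/val_inj.
by rewrite -comp_preimage (_ : g \o tuple_cons = id)//; exact/funext.
Qed.

HB.instance Definition _ :=
  Measure_isSigmaFinite.Build _ _ _ prod_step prod_step_sigma_finite.

End iterated_product.

Fixpoint tuple_lebesgue (R : realType) (n : nat) :
    {sigma_finite_measure set (n.-tuple (measurableTypeR R)) -> \bar R} :=
  match n with
  | 0 => [the {sigma_finite_measure set _ -> \bar R} of dirac [tuple]]
  | n'.+1 => [the {sigma_finite_measure set _ -> \bar R} of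
               prod_step (tuple_lebesgue R n')]
  end.

Section lebesgue_rV.
Variables (R : realType) (n : nat).

Definition rV_of_tuple (t : n.-tuple (measurableTypeR R)) : 'rV[R]_n :=
  \row_i tnth t i.

Definition lebesgue_outer (X : set 'rV[R]_n) : \bar R :=
  mu_ext (tuple_lebesgue R n) (rV_of_tuple @^-1` X).

Let lebesgue_outer0 : lebesgue_outer set0 = 0%E.
Proof. by rewrite /lebesgue_outer preimage_set0 outer_measure0. Qed.

Let lebesgue_outer_ge0 X : (0 <= lebesgue_outer X)%E.
Proof. exact: outer_measure_ge0. Qed.

Let le_lebesgue_outer : {homo lebesgue_outer : A B / A `<=` B >-> (A <= B)%E}.
Proof. by move=> A B AB; apply: le_outer_measure => t; exact: AB. Qed.

Let lebesgue_outer_sigma_subadditive : sigma_subadditive lebesgue_outer.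
Proof.
move=> F; rewrite /lebesgue_outer preimage_bigcup.
exact: outer_measure_sigma_subadditive.
Qed.

HB.instance Definition _ := isOuterMeasure.Build R _ lebesgue_outer
  lebesgue_outer0 lebesgue_outer_ge0 le_lebesgue_outer
  lebesgue_outer_sigma_subadditive.

Definition lebesgue_rV_type := caratheodory_type lebesgue_outer.
HB.instance Definition _ := Measurable.on lebesgue_rV_type.

Definition lebesgue_rV : set lebesgue_rV_type -> \bar R := lebesgue_outer.

Let lebesgue_rV0 : lebesgue_rV set0 = 0%E.
Proof. exact: lebesgue_outer0. Qed.

Let lebesgue_rV_ge0 X : (0 <= lebesgue_rV X)%E.
Proof. exact: lebesgue_outer_ge0. Qed.

Let lebesgue_rV_sigma_additive : semi_sigma_additive lebesgue_rV.
Proof. exact: caratheodory_measure_sigma_additive. Qed.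

HB.instance Definition _ := isMeasure.Build _ _ _ lebesgue_rV
  lebesgue_rV0 lebesgue_rV_ge0 lebesgue_rV_sigma_additive.

End lebesgue_rV.

(* Functions on a subset [Omega] of R^n are represented by total functions on
   ['rV[R]_n]; only their values on [Omega] matter below. *)
Section definitions.
Variables (R : realType) (n : nat).
Local Notation V := 'rV[R]_n.
Local Notation mu := (@lebesgue_rV R n).
Implicit Types (Omega : set V) (A : V -> 'M[R]_n) (u f g : V -> R).

Definition domain Omega := open Omega /\ connected Omega.

(* The library norm on ['rV[R]_n] is the sup norm. *)
Definition enorm (v : V) : R := Num.sqrt (\sum_i v ord0 i ^+ 2).

Definition qform (M : 'M[R]_n) (xi : V) : R :=
  \sum_i \sum_j xi ord0 i * M i j * xi ord0 j.

Definition euclidean_lipschitz Omega u :=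
  exists L : R, forall x y, Omega x -> Omega y ->
    `|u x - u y| <= L * enorm (x - y).

Definition partial (i : 'I_n) f : V -> R := fun x => 'D_(delta_mx ord0 i) f x.

Definition grad f (x : V) : V := \row_i partial i f x.

(* Infinitely differentiable: all iterated partial derivatives exist and are
   continuous; [foldr partial f s] differentiates [f] along the indices [s]. *)
Definition smooth f := forall s : seq 'I_n,
  let h := foldr partial f s in
  continuous h /\ forall i x, derivable h x (delta_mx ord0 i).

Definition test_function Omega (phi : V -> R) :=
  [/\ smooth phi, compact (closure [set x | phi x != 0]) &
      closure [set x | phi x != 0] `<=` Omega].

Definition L2loc Omega f :=
  measurable_fun (Omega : set (lebesgue_rV_type R n)) f /\
  forall K : set V, compact K -> K `<=` Omega ->
    mu.-integrable K (fun x => (f x ^+ 2)%:E).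

Definition weak_partial Omega (i : 'I_n) f g :=
  forall phi, test_function Omega phi ->
    (\int[mu]_(x in Omega) (f x * partial i phi x)%:E =
     - \int[mu]_(x in Omega) (g x * phi x)%:E)%E.

(* [f] is in W^{1,2}_loc(Omega) and [G] represents its weak gradient *)
Definition W12loc_grad Omega f (G : V -> V) :=
  L2loc Omega f /\
  forall i, L2loc Omega (fun x => G x ord0 i) /\
            weak_partial Omega i f (fun x => G x ord0 i).

Definition elliptic_class Omega A :=
  (forall i j,
     measurable_fun (Omega : set (lebesgue_rV_type R n)) (fun x => A x i j)) /\
  exists lam : V -> R,
    [/\ {within Omega, continuous lam},
        forall x, Omega x -> 1 <= lam x &
        {ae mu, forall x, Omega x -> forall xi : V,
           (lam x)^-1 * enorm xi ^+ 2 <= qform (A x) xi <=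
           lam x * enorm xi ^+ 2}].

Definition weak_usc_at Omega f (x : V) :=
  exists E : set V, mu.-negligible E /\
    (limf_esup (fun y => (f y)%:E) (within (Omega `\` E) x^') <= (f x)%:E)%E.

Definition weak_usc Omega f :=
  {ae mu, forall x, Omega x -> weak_usc_at Omega f x}.

Definition elliptic_class_wusc Omega A :=
  elliptic_class Omega A /\
  forall xi : V, enorm xi = 1 -> weak_usc Omega (fun x => qform (A x) xi).

Definition intrinsic_admissible Omega A u :=
  {within Omega, continuous u} /\
  exists G : V -> V, W12loc_grad Omega u G /\
    {ae mu, forall z, Omega z -> qform (A z) (G z) <= 1}.

Definition intrinsic_dist Omega A (x y : V) : \bar R :=
  ereal_sup [set (u x - u y)%:E | u in intrinsic_admissible Omega A].

(* The punctured neighborhood filter excludes [y = x]. *)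
Definition Lip Omega A u (x : V) : \bar R :=
  limf_esup (fun y => `|u y - u x|%:E / intrinsic_dist Omega A x y)%E
    (within Omega x^').

End definitions.

(* Main.v *)
Require Import Defs.
From HB Require Import structures.
From mathcomp Require Import all_boot all_order all_algebra.
From mathcomp Require Import all_classical all_reals all_analysis.
From mathcomp Require Import measurable_realfun ring lra.
Set Implicit Arguments.
Unset Strict Implicit.
Unset Printing Implicit Defensive.

Import Order.TTheory GRing.Theory Num.Theory.
Import numFieldNormedType.Exports.

Local Open Scope classical_set_scope.
Local Open Scope ring_scope.

(** Write [H x] for the quadratic form of [A x]. Almost every point [x] of the
    domain is a point where [u] is differentiable, where the entries of [A] are
    approximately continuous, and where [H _ q] is weakly upper semicontinuous
    for all the countably many rational directions [q]. At such a point put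
    [g = grad u x] and [h = sqrt (H x g)]; the claim is that the pointwise
    Lipschitz constant equals [h], and it is proved by two bounds on the
    intrinsic distance [d].

    Upper bound on the constant ([Lip_le]). If [q] is rational and [H x q < 1],
    then weak upper semicontinuity gives [H y q <= 1] for almost every [y] near
    [x]. So the pyramid [max (0, r - max (|<q, z - x>|, c |z - x|))], where [c]
    depends only on the local ellipticity bound, is admissible: its gradient is
    almost everywhere zero or one of the covectors [+-q], [+-c e_i]. Testing the
    definition of [d] with it gives [d x y >= |<q, y - x>|] and
    [d x y >= c |y - x|] for [y] near [x] ([intrinsic_dist_ge]). Taking [q]
    close to [g / s] with [s] slightly larger than [h] yields
    [|u y - u x| <= (h + e) d x y].

    Lower bound on the constant ([Lip_ge]). Move away from [x] along [b = B g],
    with [B] the symmetric part of [A x]. The function [u] changes by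
    [t <g, b> + o(t) = t h^2 + o(t)]. The distance grows by at most [t (h + e)]
    ([intrinsic_dist_le]): the gradient [G] of a competitor satisfies
    [H y G <= 1], hence [H x G <= 1 + e] where [A y] is close to [A x], and then
    [<G, b> <= h (1 + e)] by the Cauchy-Schwarz inequality; the remaining [y]
    have density zero at [x], and there [G] is bounded by ellipticity.
    Competitors are only weakly differentiable, so the passage from this bound
    on [G] to their increments uses mollification: the increment of the average
    of a function over a travelling smooth bump is an average of [<G, v>]
    ([mollified_mvt]), and a bump of radius a small multiple of [t] barely sees
    a set of small density ([increment_asymptotic]).

    Underneath lie three classical theorems. Lebesgue's density theorem, from
    Vitali's covering argument, gives approximate continuity almost everywhere
    ([ae_approx_continuous]). One-dimensional Lipschitz functions are
    differentiable almost everywhere by the Radon-Nikodym theorem, whence by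
    Tonelli the partial difference quotients of a Lipschitz function converge
    almost everywhere, and their limits are its weak partial derivatives
    ([weak_partial_lipschitz]). At the points where these are approximately
    continuous the increment estimate above gives differentiability, which is
    Rademacher's theorem ([rademacher]); it applies to [u], after Lipschitz
    extension to the whole space, and to the pyramids. *)

(** * Lebesgue measure on row vectors *)

Section borel_sets.
Variables (R : realType) (n : nat).
Local Notation V := 'rV[R]_n.
Local Notation L := (lebesgue_rV_type R n).
Local Notation T := (n.-tuple (measurableTypeR R)).
Local Notation mu := (@lebesgue_rV R n).

Definition tuple_of_rV (v : V) : T := [tuple v ord0 i | i < n].

Lemma tuple_of_rVK : cancel tuple_of_rV (@rV_of_tuple R n).
Proof. by move=> v; apply/rowP => i; rewrite mxE tnth_mktuple. Qed.

Lemma rV_of_tupleK : cancel (@rV_of_tuple R n) tuple_of_rV.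
Proof. by move=> t; apply/eq_from_tnth => i; rewrite tnth_mktuple mxE. Qed.

Lemma preimage_tuple_of_rV (S : set T) :
  @rV_of_tuple R n @^-1` (tuple_of_rV @^-1` S) = S.
Proof. by rewrite -comp_preimage; apply/seteqP; split => t /=; rewrite rV_of_tupleK. Qed.

(** The measure on row vectors is built by Caratheodory's theorem from the
    outer measure on tuples, so product-measurable sets of tuples are
    Caratheodory measurable; this is how Borel sets of vectors get their
    measurability and their measure. *)
Lemma measurable_tuple_of_rV :
  measurable_fun setT (tuple_of_rV : L -> T).
Proof.
move=> _ S mS; rewrite setTI.
change (caratheodory_measurable (@lebesgue_outer R n) (tuple_of_rV @^-1` S)) => X.
have := @caratheodory_measurable_mu_ext _ _ _ (tuple_lebesgue R n) _ mS.
by move=> /(_ (@rV_of_tuple R n @^-1` X)); rewrite /lebesgue_outer /= !preimage_setI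
  -preimage_setC !preimage_tuple_of_rV.
Qed.

Lemma lebesgue_rV_tuple (S : set T) : measurable S ->
  mu (tuple_of_rV @^-1` S) = tuple_lebesgue R n S.
Proof.
by move=> mS; rewrite /lebesgue_rV /lebesgue_outer preimage_tuple_of_rV measurable_mu_extE.
Qed.

End borel_sets.

Section tuple_measure.
Variable R : realType.
Local Notation lam := (@lebesgue_measure R).
Local Notation T := (fun n => n.-tuple (measurableTypeR R)).

(** A translate of Lebesgue measure agrees with it on half-open intervals, and
    this characterises it. *)
Lemma lebesgue_measure_shift (h : R) (A : set (measurableTypeR R)) : measurable A ->
  lam ((fun x => x + h) @^-1` A) = lam A.
Proof.
move=> mA; have mh : measurable_fun setT ((fun x : measurableTypeR R => x + h) :
   measurableTypeR R -> measurableTypeR R) by exact: measurable_funD.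
pose hm := isMeasurableFun.Build _ _ _ _ _ mh.
pose hM : {mfun measurableTypeR R >-> measurableTypeR R} :=
  MeasurableFun.Pack (MeasurableFun.Class hm).
rewrite [RHS](@lebesgue_measure_unique R
  [the measure _ _ of pushforward lam hM])// => X [[a b]] /= _ <-.
rewrite /pushforward (_ : hM @^-1` _ = `]a - h, b - h]%classic); last first.
  by apply/seteqP; split => x /=; rewrite !in_itv/= ltrBlDr lerBrDr.
rewrite !lebesgue_measure_itv/= !lte_fin ltrD2r.
by case: ifP => //; rewrite -!EFinB => _; congr EFin; lra.
Qed.

Definition tuple_box n (B : 'I_n -> set R) : set (T n) :=
  [set t | forall i, B i (tnth t i)].

Lemma measurable_tuple_box n (B : 'I_n -> set R) :
  (forall i, measurable (B i : set (measurableTypeR R))) -> measurable (tuple_box B).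
Proof.
move=> mB.
rewrite (_ : tuple_box B = \bigcap_(i : 'I_n) ((fun t : T n => tnth t i) @^-1` B i)).
  apply: fin_bigcap_measurable => // i _.
  by rewrite -[X in measurable X]setTI; exact: (measurable_tnth i).
by apply/seteqP; split => t h i; [move=> _; exact: h | exact: h].
Qed.

Lemma tuple_lebesgue_box n (B : 'I_n -> set R) :
  (forall i, measurable (B i : set (measurableTypeR R))) ->
  tuple_lebesgue R n (tuple_box B) = (\prod_i lam (B i))%E.
Proof.
elim: n B => [|n IH] B mB.
  rewrite big_ord0 /= diracE (_ : _ \in _ = true)//.
  by apply/mem_set => -[].
rewrite big_ord_recl -IH//= /prod_step /pushforward.
rewrite -product_measure1E//; last exact: measurable_tuple_box.
congr (product_measure1 _ _ _); apply/seteqP; split => [[a t] h|[a t] [h0 h] i].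
- split => /=; first by have := h ord0.
  by move=> i; have := h (lift ord0 i); rewrite tnthS.
- by case: (unliftP ord0 i) => [j ->|->]; [rewrite tnthS|]; [exact: h|].
Qed.

Definition tuple_shift n (h : 'I_n -> R) (t : T n) : T n :=
  [tuple tnth t i + h i | i < n].

Lemma measurable_tuple_shift n (h : 'I_n -> R) : measurable_fun setT (tuple_shift h).
Proof.
apply/measurable_fun_tnthP => i.
rewrite (_ : _ \o _ = fun t : T n => tnth t i + h i); last first.
  by apply/funext => t /=; rewrite tnth_mktuple.
by apply: measurable_funD => //; exact: measurable_tnth.
Qed.

(** By induction on the dimension and uniqueness of product measures: the
    translated measure has the same values on rectangles. *)
Lemma tuple_lebesgue_shift n (h : 'I_n -> R) (S : set (T n)) : measurable S ->
  tuple_lebesgue R n (tuple_shift h @^-1` S) = tuple_lebesgue R n S.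
Proof.
elim: n h S => [|n IH] h S mS.
  congr (tuple_lebesgue R 0 _); apply/seteqP.
  by split => t /=; rewrite (_ : tuple_shift h t = t)// [LHS]tuple0 [RHS]tuple0.
rewrite /= /prod_step /pushforward.
pose g (p : measurableTypeR R * T n) : measurableTypeR R * T n :=
  (p.1 + h ord0, tuple_shift (h \o lift ord0) p.2).
have mg : measurable_fun setT g.
  apply/measurable_fun_pair => /=; first exact: measurable_funD.
  by apply: measurableT_comp => //; exact: measurable_tuple_shift.
pose gm := isMeasurableFun.Build _ _ _ _ _ mg.
pose gM : {mfun _ >-> _} := MeasurableFun.Pack (MeasurableFun.Class gm).
rewrite [RHS](@product_measure_unique _ _ _ _ _ lam (tuple_lebesgue R n)
  [the measure _ _ of pushforward (lam \x tuple_lebesgue R n)%E gM]).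
- have gE p : tuple_cons (g p) = tuple_shift h (tuple_cons p).
    apply/eq_from_tnth => i; rewrite tnth_mktuple; case: p => a t /=.
    by case: (unliftP ord0 i) => [j ->|->]; rewrite ?tnthS ?tnth_mktuple ?tnth0.
  congr (product_measure1 _ _ _).
  by apply/seteqP; split => p /=; rewrite /preimage/= gE.
- move=> A B mA mB; rewrite /= /pushforward.
  rewrite (_ : gM @^-1` _ = (fun x => x + h ord0) @^-1` A `*`
     (tuple_shift (h \o lift ord0) @^-1` B)); last by apply/seteqP; split.
  rewrite product_measure1E; last 2 first.
  + by rewrite -[X in measurable X]setTI; apply: measurable_funD.
  + by rewrite -[X in measurable X]setTI; apply: measurable_tuple_shift.
  by congr (_ * _)%E; [exact: lebesgue_measure_shift|exact: IH].
- by rewrite -[X in measurable X]setTI; exact: measurable_tuple_cons.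
Qed.

End tuple_measure.

Section lebesgue_rV_theory.
Variables (R : realType) (n : nat).
Local Notation V := 'rV[R]_n.
Local Notation L := (lebesgue_rV_type R n).
Local Notation mu := (@lebesgue_rV R n).

Lemma rV_ballP (x y : V) (r : R) : 0 < r ->
  ball x r y <-> forall i, `|x ord0 i - y ord0 i| < r.
Proof.
move=> r0; split => [[_ h] i|h]; first exact: h.
by split => // i j; rewrite ord1; exact: h.
Qed.

Lemma tuple_of_rV_box (B : 'I_n -> set R) :
  @tuple_of_rV R n @^-1` (tuple_box B) = [set v : V | forall i, B i (v ord0 i)].
Proof.
by apply/seteqP; split => v /= h i; have := h i; rewrite tnth_mktuple.
Qed.

Lemma rV_ballE (x : V) (r : R) : 0 < r ->
  ball x r = @tuple_of_rV R n @^-1`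
    (tuple_box (fun i => `]x ord0 i - r, x ord0 i + r[%classic)).
Proof.
move=> r0; rewrite tuple_of_rV_box; apply/seteqP; split => y.
  by move=> /(rV_ballP _ _ r0) h i /=; rewrite in_itv/= -ltr_distlC.
by move=> h; apply/rV_ballP => // i; have := h i; rewrite /= in_itv/= -ltr_distlC.
Qed.

Lemma measurable_rV_ball (x : V) (r : R) : measurable (ball x r : set L).
Proof.
have [r0|r0] := ltP 0 r; last first.
  by rewrite (_ : ball x r = set0)// -subset0 => y [/(le_lt_trans r0)]; rewrite ltxx.
rewrite rV_ballE// -[X in measurable X]setTI; apply: measurable_tuple_of_rV => //.
by apply: measurable_tuple_box => i; exact: measurable_itv.
Qed.

(** Balls are those of the sup norm, hence cubes. *)
Lemma lebesgue_rV_ball (x : V) (r : R) : 0 < r -> mu (ball x r) = ((2 * r) ^+ n)%:E.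
Proof.
move=> r0; rewrite rV_ballE// lebesgue_rV_tuple; last first.
  by apply: measurable_tuple_box => i; exact: measurable_itv.
rewrite tuple_lebesgue_box; last by move=> i; exact: measurable_itv.
rewrite (eq_bigr (fun=> (2 * r)%:E)); last first.
  move=> i _; rewrite lebesgue_measure_itv/= lte_fin ifT; last by lra.
  by rewrite -EFinB; congr EFin; lra.
by rewrite prodEFin prodr_const card_ord.
Qed.

(** Balls with rational centre and radius, the countable family behind every
    reduction of uncountably many points to countably many sets. *)
Definition qball (p : 'rV[rat]_n * rat) : set V :=
  ball (map_mx ratr p.1 : V) (ratr p.2 : R).

Lemma qball_between (x : V) (r s : R) : 0 <= r -> r < s ->
  exists p, [/\ 0 < (ratr p.2 : R), ball x r `<=` qball p & qball p `<=` ball x s].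
Proof.
move=> r0 rs; pose d := (s - r) / 4.
have d0 : 0 < d by rewrite /d; lra.
have [q] : exists q : rat, ratr q \in `]r + d, r + 2 * d[.
  by apply: rat_in_itvoo; lra.
rewrite in_itv/= => /andP[q1 q2].
have hc i : exists c : rat, `|x ord0 i - ratr c| < d.
  have [c] : exists c : rat, ratr c \in `]x ord0 i - d, x ord0 i + d[.
    by apply: rat_in_itvoo; lra.
  by rewrite in_itv/= -ltr_distlC => ?; exists c.
pose c := \row_i sval (cid (hc i)).
have cx : ball x d (map_mx ratr c : V).
  by apply/rV_ballP => // i; rewrite !mxE; case: cid.
have rsd : r + 4 * d = s by rewrite /d; field.
exists (c, q); split => /=; first lra.
- move=> y xy; apply: (@le_ball _ _ _ (d + r)); first lra.
  by apply: ball_triangle xy; exact: ball_sym.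
- move=> y xy; apply: (@le_ball _ _ _ (d + ratr q)); first lra.
  by apply: ball_triangle cx xy.
Qed.

Lemma open_qball (O : set V) : open O ->
  O = \bigcup_(p in [set p | qball p `<=` O]) qball p.
Proof.
move=> oO; apply/seteqP; split => [x Ox|x [p /= pO px]]; last exact: pO.
have /nbhs_ballP[e /= e0 he] := open_nbhs_nbhs (conj oO Ox).
have [||p [p0 h1 h2]] := @qball_between x (e / 2) e; [lra|lra|].
exists p => /=; first exact: subset_trans he.
by apply: h1; apply: ballxx; lra.
Qed.

Lemma open_measurable_rV (O : set V) : open O -> measurable (O : set L).
Proof.
move=> oO; rewrite (open_qball oO) bigcup_mkcond.
apply: countable_bigcupT_measurable; first exact: countableP.
by move=> p; case: ifP => // _; exact: measurable_rV_ball.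
Qed.

Lemma closed_measurable_rV (C : set V) : closed C -> measurable (C : set L).
Proof.
by move=> cC; rewrite -[C]setCK; apply: measurableC; apply: open_measurable_rV;
  exact: closed_openC.
Qed.

Lemma compact_measurable_rV (C : set V) : compact C -> measurable (C : set L).
Proof.
by move=> cC; apply: closed_measurable_rV; apply: compact_closed => //; exact: norm_hausdorff.
Qed.

Lemma bounded_lebesgue_rV (K : set V) (x : V) (r : R) : K `<=` ball x r ->
  (mu K < +oo)%E.
Proof.
move=> Kr; have [r0|r0] := ltP 0 r.
  apply: (@le_lt_trans _ _ (mu (ball x r))); first exact: le_outer_measure.
  by rewrite lebesgue_rV_ball// ltry.
rewrite (_ : K = set0) ?measure0// -subset0 => y /Kr[/(le_lt_trans r0)].
by rewrite ltxx.
Qed.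

Lemma compact_lebesgue_rV (K : set V) : compact K -> (mu K < +oo)%E.
Proof.
move=> /compact_bounded[M [Mr hM]].
apply: (@bounded_lebesgue_rV _ 0 (`|M| + 2)) => y Ky.
rewrite -ball_normE /ball_/= sub0r normrN.
have := hM (`|M| + 1) _ y Ky; rewrite (le_lt_trans (ler_norm _)) ?ltrDl// => /(_ isT).
by move=> /le_lt_trans; apply; lra.
Qed.

Lemma continuous_measurable_rV (D : set V) (f : V -> R) : measurable (D : set L) ->
  {within D, continuous f} -> measurable_fun (D : set L) (f : L -> R).
Proof.
move=> mD cf; apply: (measurability _ (RGenOInfty.measurableE R)) => _ [_ [a ->] <-].
have : open (f @^-1` `]a, +oo[ : set (subspace D)).
  have /continuousP := cf; apply; exact: interval_open.
move=> /open_subspaceP [U oU UD].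
rewrite setIC -UD.
by apply: measurableI => //; exact: open_measurable_rV.
Qed.

Lemma continuousT_measurable_rV (D : set V) (f : V -> R) : measurable (D : set L) ->
  continuous f -> measurable_fun (D : set L) (f : L -> R).
Proof.
by move=> mD cf; apply: continuous_measurable_rV => //; exact: continuous_subspaceT.
Qed.

(** Translation maps coverings to coverings of the same total mass, so the
    outer measure itself is invariant. *)
Lemma lebesgue_rV_shift (h : V) (X : set V) :
  mu ((fun x => x + h) @^-1` X) = mu X.
Proof.
suff H (k : V) (Y : set V) : (mu ((fun x => (x + k)%R) @^-1` Y) <= mu Y)%E.
  apply/eqP; rewrite eq_le H /=.
  have := H (- h) ((fun x => x + h) @^-1` X).
  rewrite (_ : (fun x => x + - h) @^-1` ((fun x => x + h) @^-1` X) = X)//.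
  by apply/seteqP; split => x /=; rewrite subrK.
apply: le_ereal_inf_tmp => _ [F [mF YF] <-].
pose s := @tuple_shift R n (fun i => k ord0 i).
apply: ereal_inf_lbound; exists (fun i => s @^-1` F i).
  split=> [i|t Yt].
    by rewrite -[X in measurable X]setTI; exact: measurable_tuple_shift.
  have [|i _ Fi] := YF (s t); last by exists i.
  rewrite /preimage/= (_ : rV_of_tuple (s t) = rV_of_tuple t + k)//.
  by apply/rowP => j; rewrite !mxE tnth_mktuple.
by apply: eq_eseriesr => i _; exact: tuple_lebesgue_shift.
Qed.

Lemma measurable_shift (h : V) :
  measurable_fun setT ((fun x : V => x + h) : L -> L).
Proof.
move=> _ E mE; rewrite setTI.
change (caratheodory_measurable (@lebesgue_outer R n) E) in mE.
change (caratheodory_measurable (@lebesgue_outer R n) ((fun x => x + h) @^-1` E)).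
have inv (Y : set V) : lebesgue_outer ((fun x : V => x + - h) @^-1` Y) = lebesgue_outer Y.
  exact: (lebesgue_rV_shift (- h) Y).
move=> X; have := mE ((fun x : V => x + - h) @^-1` X); rewrite inv => ->.
by congr (_ + _)%E; rewrite -[RHS]inv; congr (lebesgue_outer _);
  apply/seteqP; split => x /=; rewrite subrK.
Qed.

(** Both sides split into positive and negative parts, to which the change of
    variables for measures applies. *)
Lemma integral_shift (h : V) (f : L -> \bar R) : measurable_fun setT f ->
  (\int[mu]_x f (x + h)%R = \int[mu]_x f x)%E.
Proof.
move=> mf.
have [s sE] : exists s : L -> L, s = (fun x : V => x + h) by eexists.
have ms : measurable_fun setT s by rewrite sE; exact: measurable_shift.
have mus A : mu (s @^-1` A) = mu A by rewrite sE; exact: lebesgue_rV_shift.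
suff : (\int[mu]_x f (s x) = \int[mu]_x f x)%E by rewrite sE.
have ge0 (g : L -> \bar R) : measurable_fun setT g -> (forall x, 0 <= g x)%E ->
    (\int[mu]_x g (s x) = \int[mu]_x g x)%E.
  move=> mg g0.
  have e := @ge0_integral_pushforward _ _ L L R _ ms mu setT g
    measurableT mg (fun x _ => g0 x).
  rewrite preimage_setT in e; rewrite -[LHS]e; apply: eq_measure_integral.
  by move=> A mA _; exact: mus.
rewrite [LHS]integralE [RHS]integralE; congr (_ - _)%E.
  by rewrite -(ge0 _ (measurable_funepos mf) (funepos_ge0 f)); apply: eq_integral => x _; rewrite !funeposE.
by rewrite -(ge0 _ (measurable_funeneg mf) (funeneg_ge0 f)); apply: eq_integral => x _; rewrite !funenegE.
Qed.

End lebesgue_rV_theory.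

(** * Outer regularity, density points and approximate continuity *)

Section outer_regularity.
Variables (R : realType) (n : nat).
Local Notation V := 'rV[R]_n.
Local Notation L := (lebesgue_rV_type R n).
Local Notation T := (n.-tuple (measurableTypeR R)).
Local Notation mu := (@lebesgue_rV R n).
Variables (X : set V) (mX : measurable (X : set L)) (fX : (mu X < +oo)%E).

(** Approximation by open and closed sets relative to a fixed set [X] of finite
    measure. In this form the property is stable under complement and countable
    union, so that it can be proved for all Borel sets by minimality of the
    Borel sigma-algebra. *)
Definition approximable (E : set V) := forall eta : R, 0 < eta ->
  exists U C : set V, [/\ open U, closed C, C `<=` E, E `<=` U &
    (mu (X `&` (U `\` C)) < eta%:E)%E].

Let decreasing_small (F : (set V)^nat) (eta : R) : 0 < eta ->
  (forall k, measurable (F k : set L)) -> nonincreasing_seq F ->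
  (mu (X `&` \bigcap_k F k) < eta%:E)%E -> exists k, (mu (X `&` F k) < eta%:E)%E.
Proof.
move=> eta0 mF dF h.
have mXF k : measurable (X `&` F k : set L) by exact: measurableI.
have E : X `&` \bigcap_k F k = \bigcap_k (X `&` F k).
  apply/seteqP; split => [x [Xx hx] k _|x hx]; first by split => //; exact: hx.
  by split=> [|k _]; [have [] := hx 0%N I|have [] := hx k I].
have X0 : (mu (X `&` F 0%N) < +oo)%E.
  by apply: le_lt_trans fX; apply: le_outer_measure => x [].
have cm := @nonincreasing_cvg_mu _ L R mu (fun k => X `&` F k) X0 mXF.
have /= {}cm : (fun k => mu (X `&` F k)) @ \oo --> mu (X `&` \bigcap_k F k).
  rewrite E; apply: cm; first exact: bigcapT_measurable.
  by move=> p q pq; apply/subsetPset; apply: setIS; apply/subsetPset; exact: dF.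
apply: contrapT => /forallNP hN; move: h; apply/negP; rewrite -leNgt.
rewrite -(cvg_lim _ cm)//; apply: lime_ge; first by apply/cvg_ex; eexists; exact: cm.
by apply: nearW => k; rewrite leNgt; apply/negP; exact: hN.
Qed.

Lemma approximable0 : approximable set0.
Proof.
move=> eta eta0; exists set0, set0; split => //; first exact: closed0.
by rewrite setD0 setI0 measure0 lte_fin.
Qed.

Lemma approximableC E : approximable E -> approximable (~` E).
Proof.
move=> aE eta /aE[U [C [oU cC CE EU h]]]; exists (~` C), (~` U); split.
- exact: closed_openC.
- exact: open_closedC.
- exact: subsetC.
- exact: subsetC.
- by rewrite setDE setCK [~` C `&` U]setIC -setDE.
Qed.

(** The open sets are united; for the closed set only finitely many of the
    inner approximations are kept, which costs little by continuity from above
    of the measure on [X]. *)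
Lemma approximable_bigcup (E : (set V)^nat) :
  (forall k, approximable (E k)) -> approximable (\bigcup_k E k).
Proof.
move=> aE eta eta0.
have e0 k : 0 < (eta / 2) / (2 ^ k.+1)%:R :> R by rewrite !divr_gt0.
have /choice[U HU] : forall k, exists U, exists C, [/\ open U, closed C, C `<=` E k, E k `<=` U &
    (mu (X `&` (U `\` C)) < ((eta / 2) / (2 ^ k.+1)%:R)%:E)%E].
  by move=> k; exact: aE (e0 k).
have /choice[C HC] := HU.
pose CN N := \bigcup_(k < N) C k.
have cCN N : closed (CN N).
  by apply: closed_bigcup => // k _; have [] := HC k.
have oU : open (\bigcup_k U k) by apply: bigcup_open => k _; have [] := HC k.
have [|||k hk] := @decreasing_small (fun N => \bigcup_k U k `\` CN N) eta eta0.
- by move=> k; apply: measurableD; [exact: open_measurable_rV|exact: closed_measurable_rV].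
- move=> a b ab; apply/subsetPset => x [Ux nC]; split => // -[i /= ia Ci].
  by apply: nC; exists i => //=; exact: leq_trans ab.
- apply: (@le_lt_trans _ _ (eta / 2)%:E); last by rewrite lte_fin; lra.
  apply: (@le_trans _ _ (mu (\bigcup_k (X `&` (U k `\` C k))))).
    apply: le_outer_measure => x [Xx h].
    have [[k _ Uk] _] := h 0%N I.
    exists k => //; split => //; split => // Ck.
    by have [_] := h k.+1 I; apply; exists k => //=.
  apply: (le_trans (outer_measure_sigma_subadditive _ _)).
  apply: le_trans (epsilon_trick0 xpredT _); last by lra.
  by apply: lee_nneseries => // k _; have [_ _ _ _ /ltW] := HC k.
exists (\bigcup_k U k), (CN k); split => //.
- by move=> x [i _ Ci]; exists i => //; have [_ _ + _ _] := HC i; exact.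
- by move=> x [i _ Ei]; exists i => //; have [_ _ _ + _] := HC i; exact.
Qed.

Lemma approximable_ray (i : 'I_n) (a : R) : approximable [set v : V | a < v ord0 i].
Proof.
move=> eta eta0.
have cc : continuous (fun v : V => v ord0 i) by exact: coord_continuous.
have oU : open [set v : V | a < v ord0 i].
  by apply: (@open_comp _ _ (fun v : V => v ord0 i) [set x | a < x]) => // ; exact: open_gt.
have cC k : closed [set v : V | a + k.+1%:R^-1 <= v ord0 i].
  by apply: (@closed_comp _ _ (fun v : V => v ord0 i) [set x | a + k.+1%:R^-1 <= x]) => //; exact: closed_ge.
have [|||k hk] := @decreasing_small (fun k => [set v : V | a < v ord0 i] `\` [set v : V | a + k.+1%:R^-1 <= v ord0 i]) eta eta0.
- by move=> k; apply: measurableD; [exact: open_measurable_rV|exact: closed_measurable_rV].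
- move=> p q pq; apply/subsetPset => x [/= Ux /negP]; rewrite -ltNge => h; split => //=.
  apply/negP; rewrite -ltNge (lt_le_trans h)// lerD2l lef_pV2 ?posrE//.
  by rewrite ler_nat.
- rewrite (_ : \bigcap_k _ = set0) ?setI0 ?measure0 ?lte_fin// -subset0 => x h.
  have [/= ax _] := h 0%N I.
  have [k kx] : exists k, k.+1%:R^-1 < x ord0 i - a.
    by have [k hk] := ltr_add_invr ax; exists k; rewrite ltrBrDl.
  by have [_ /=] := h k I; apply; apply: ltW; rewrite -ltrBrDl.
exists [set v : V | a < v ord0 i], [set v : V | a + k.+1%:R^-1 <= v ord0 i].
split => // v /=; apply: lt_le_trans; by rewrite ltrDl.
Qed.

Lemma approximable_tuple (S : set T) : measurable S ->
  approximable (@tuple_of_rV R n @^-1` S).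
Proof.
move=> mS.
suff : (measurable : set (set T)) `<=` [set S | approximable (@tuple_of_rV R n @^-1` S)].
  exact.
apply: smallest_sub => [|B] /=.
  split=> /=; first exact: approximable0.
    by move=> A aA; rewrite setTD; exact: approximableC.
  by move=> F aF; rewrite preimage_bigcup; exact: approximable_bigcup.
rewrite -bigcup_seq => -[i _ [D mD <-]]; rewrite setTI.
rewrite (_ : _ @^-1` _ = (fun v : V => v ord0 i) @^-1` D); last first.
  by apply/seteqP; split => v /=; rewrite tnth_mktuple.
suff : (measurable : set (set (measurableTypeR R))) `<=`
    [set D | approximable ((fun v : V => v ord0 i) @^-1` D)] by exact.
rewrite (RGenOInfty.measurableE R); apply: smallest_sub => [|_ [a ->]/=].
  split=> /=; first exact: approximable0.
    by move=> A aA; rewrite setTD; exact: approximableC.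
  by move=> F aF; rewrite preimage_bigcup; exact: approximable_bigcup.
rewrite (_ : _ @^-1` _ = [set v : V | a < v ord0 i]); first exact: approximable_ray.
by apply/seteqP; split => v /=; rewrite in_itv/= andbT.
Qed.

End outer_regularity.

Section density.
Variables (R : realType) (n : nat).
Local Notation V := 'rV[R]_n.
Local Notation L := (lebesgue_rV_type R n).
Local Notation T := (n.-tuple (measurableTypeR R)).
Local Notation mu := (@lebesgue_rV R n).

Lemma outer_null_measurable (S : set V) : mu S = 0%E -> measurable (S : set L).
Proof.
move=> S0.
change (caratheodory_measurable (@lebesgue_outer R n) S).
apply: le_caratheodory_measurable => Y.
rewrite [X in (X + _)%E](_ : _ = 0%E); last first.
  apply/eqP; rewrite eq_le outer_measure_ge0 andbT -S0.
  by apply: le_outer_measure => x [].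
by rewrite add0e; apply: le_outer_measure => x [].
Qed.

Lemma outer_null_negligible (S : set V) : mu S = 0%E -> mu.-negligible S.
Proof. by move=> S0; exists S; split => //; exact: outer_null_measurable. Qed.

(** The coverings defining the outer measure consist of product-measurable
    sets, so a nearly optimal one is a measurable hull. *)
Lemma tuple_hull (E : set V) (eta : R) : (mu E < +oo)%E -> 0 < eta ->
  exists S : set T, [/\ measurable S, E `<=` @tuple_of_rV R n @^-1` S &
    (mu (@tuple_of_rV R n @^-1` S) <= mu E + eta%:E)%E].
Proof.
move=> fE eta0.
have : (mu E < mu E + eta%:E)%E.
  by rewrite lteDl ?lte_fin// ge0_fin_numE ?measure_ge0.
move=> /ereal_inf_lt[_ [F [mF EF] <-] hF].
have mUF : measurable (\bigcup_k F k) by exact: bigcup_measurable.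
exists (\bigcup_k F k); split => //.
  move=> x Ex; have [|k _ Fk] := EF (tuple_of_rV x); last by exists k.
  by rewrite /preimage/= tuple_of_rVK.
rewrite lebesgue_rV_tuple//; apply: le_trans (ltW hF).
exact: measure_sigma_subadditive.
Qed.

(** [E] is first enlarged to a Borel hull of almost the same measure, for which
    approximability is available. *)
Lemma outer_regular (E : set V) (r eta : R) : measurable (E : set L) ->
  E `<=` ball 0 r -> 0 < eta ->
  exists U : set V, [/\ open U, E `<=` U & (mu (U `\` E) < eta%:E)%E].
Proof.
move=> mE Er eta0.
have fE : (mu E < +oo)%E by exact: bounded_lebesgue_rV Er.
have [S [mS ES SE]] := @tuple_hull E (eta / 2) fE ltac:(lra).
set F := _ @^-1` S in ES SE.
have mF : measurable (F : set L).
  by rewrite -[F]setTI; exact: measurable_tuple_of_rV.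
pose B := ball (0 : V) r; have mB : measurable (B : set L) := measurable_rV_ball (0 : V) r.
have fB : (mu B < +oo)%E by exact: bounded_lebesgue_rV (fun x h => h).
have [U [C [oU cC CF FU h]]] := approximable_tuple mB fB mS (ltac:(lra) : 0 < eta / 2).
exists (U `&` B); split.
- by apply: openI => //; exact: ball_open.
- by move=> x Ex; split; [exact/FU/ES|exact: Er].
have FE : (mu (F `\` E) <= (eta / 2)%:E)%E.
  rewrite measureD//; last by apply: le_lt_trans SE _; rewrite lte_add_pinfty// ltry.
  rewrite setIidr// leeBlDl//; last by rewrite ge0_fin_numE ?measure_ge0.
apply: (@le_lt_trans _ _ (mu (B `&` (U `\` C)) + mu (F `\` E))%E).
  apply: (le_trans _ (outer_measureU2 _ _ _)); apply: le_outer_measure.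
  move=> x [[Ux Bx] nE]; have [Fx|nF] := pselect (F x); first by right.
  by left; split => //; split => // Cx; apply/nF/CF.
rewrite [in ltRHS](splitr eta) EFinD lte_leD//.
by rewrite ge0_fin_numE ?measure_ge0//; apply: le_lt_trans FE _; rewrite ltry.
Qed.

Lemma exists_max_radius (s : seq (V * R)) : s != [::] ->
  exists2 p, p \in s & forall q, q \in s -> q.2 <= p.2.
Proof.
elim: s => // p [_ _|q s IH _].
  by exists p; rewrite ?mem_head// => q; rewrite inE => /eqP ->.
have [//|m ms hm] := IH.
have [pm|mp] := leP p.2 m.2.
  by exists m; [rewrite inE ms orbT|move=> x; rewrite inE => /predU1P[->//|/hm]].
exists p; first by rewrite mem_head.
move=> x; rewrite inE => /predU1P[->//|/hm xm]; exact/ltW/(le_lt_trans xm).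
Qed.

(** Vitali's covering argument in measure form: select greedily a ball of
    maximal radius, which after tripling absorbs every ball meeting it. *)
Lemma vitali_measure (s : seq (V * R)) (W : set V) (eps : R) :
  0 < eps -> measurable (W : set L) ->
  (forall p, p \in s -> 0 < p.2 /\
     (eps%:E * mu (ball p.1 p.2) <= mu (ball p.1 p.2 `&` W))%E) ->
  (eps%:E * mu (\bigcup_(p in [set p | p \in s]) ball p.1 p.2) <=
    (3 ^+ n)%:E * mu W)%E.
Proof.
move=> eps0; have [m] := ubnP (size s); elim: m s W => // m IH s W sm mW hs.
have [->|s0] := eqVneq s [::].
  rewrite (_ : \bigcup_(_ in _) _ = set0) ?measure0 ?mule0; last first.
    by rewrite -subset0 => x [].
  by apply: mule_ge0; rewrite ?measure_ge0// lee_fin.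
have [p ps hp] := exists_max_radius s0.
have [p0 pW] := hs p ps.
pose s' := [seq q <- s | `[< ball p.1 p.2 `&` ball q.1 q.2 = set0 >]].
have s's q : q \in s' -> q \in s /\ ball p.1 p.2 `&` ball q.1 q.2 = set0.
  by rewrite mem_filter => /andP[/asboolP].
have ps' : p \notin s'.
  apply/negP => /s's[_]; rewrite setIid => /seteqP[/(_ p.1) + _]; apply.
  exact: ballxx.
have mb q : measurable (ball q.1 q.2 : set L) by exact: measurable_rV_ball.
have {IH} := IH s' (W `\` ball p.1 p.2).
have lt_s' : (size s' < size s)%N.
  rewrite ltn_neqAle size_filter count_size andbT -all_count.
  by apply: contra ps' => /all_filterP; rewrite /s' => ->.
move=> /(_ (leq_trans lt_s' _)) => /(_ ltac:(by [])) => /(_ (measurableD mW (mb p))).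
have h' q : q \in s' -> 0 < q.2 /\
    (eps%:E * mu (ball q.1 q.2) <= mu (ball q.1 q.2 `&` (W `\` ball p.1 p.2)))%E.
  move=> /s's[/hs[q0 qW] pq]; split => //; rewrite (_ : _ `&` _ = ball q.1 q.2 `&` W)//.
  apply/seteqP; split => x [] qx; first by move=> [].
  by move=> Wx; split => //; split => // px; have : set0 x by rewrite -pq.
move=> /(_ h') {}h'.
apply: (@le_trans _ _ (eps%:E * (mu (ball p.1 (3 * p.2)) +
    mu (\bigcup_(q in [set q | q \in s']) ball q.1 q.2)))%E).
  apply: lee_wpmul2l; first by rewrite lee_fin ltW.
  apply: (le_trans _ (outer_measureU2 _ _ _)); apply: le_outer_measure.
  move=> x [q /= qs qx]; have [pq|] := pselect (ball p.1 p.2 `&` ball q.1 q.2 = set0).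
    by right; exists q => //=; rewrite mem_filter qs andbT; exact/asboolP.
  move=> /eqP/set0P[y [py qy]]; left.
  apply: (@le_ball _ _ _ (p.2 + (q.2 + q.2))); first by have := hp q qs; lra.
  apply: ball_triangle py _; apply: ball_triangle qx; exact: ball_sym.
rewrite ge0_muleDr ?measure_ge0//.
have -> : mu W = (mu (W `&` ball p.1 p.2) + mu (W `\` ball p.1 p.2))%E.
  rewrite -measureU//; last 3 first.
  - exact: measurableI.
  - exact: measurableD.
  - by apply/seteqP; split => x // [[_ ?] [_]].
  by rewrite setUIDK.
rewrite ge0_muleDr ?measure_ge0//; apply: leeD.
  rewrite setIC; apply: le_trans (lee_wpmul2l _ pW); last by rewrite lee_fin.
  rewrite !lebesgue_rV_ball//; last lra.
  by rewrite -!EFinM lee_fin [2 * (3 * _)]mulrCA exprMn mulrCA.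
exact: h'.
Qed.

Lemma lebesgue_rV_bigcup_le (F : (set V)^nat) (c : \bar R) :
  (forall k, measurable (F k : set L)) -> nondecreasing_seq F ->
  (forall k, mu (F k) <= c)%E -> (mu (\bigcup_k F k) <= c)%E.
Proof.
move=> mF ndF Fc.
have cm := @nondecreasing_cvg_mu _ L R mu F mF (bigcup_measurable (fun k _ => mF k)) ndF.
rewrite -(cvg_lim _ cm)//; apply: lime_le; first by apply/cvg_ex; eexists; exact: cm.
exact: nearW.
Qed.

(** Lebesgue's density theorem: the balls where the complement of [E] is not
    sparse all lie in an open set [U] hardly larger than [E], so Vitali's
    estimate bounds the measure of their union by that of [U `\` E]. *)
Lemma lebesgue_density (E : set V) (r0 eps : R) : measurable (E : set L) ->
  E `<=` ball 0 r0 -> 0 < eps ->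
  mu.-negligible [set x | E x /\ forall d, 0 < d ->
    exists r, [/\ 0 < r, r < d & ((eps * r ^+ n)%:E < mu (ball x r `\` E))%E]].
Proof.
move=> mE Er eps0; set S := [set x | _]; apply: outer_null_negligible.
apply/eqP; rewrite eq_le measure_ge0 andbT; apply/lee_addgt0Pr => k k0.
rewrite add0e.
(* a rational ball caught between radii [r] and [2 * r] costs a factor [4 ^+ n] *)
pose e' := eps / 4 ^+ n.
have e'0 : 0 < e' by rewrite divr_gt0// exprn_gt0.
have n30 : 0 < 3 ^+ n :> R by rewrite exprn_gt0.
have [U [oU EU UE]] := @outer_regular E r0 (e' * k / 3 ^+ n) mE Er
  ltac:(by rewrite divr_gt0// mulr_gt0).
have mUE : measurable (U `\` E : set L).
  by apply: measurableD => //; exact: open_measurable_rV.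
pose F := [set p : 'rV[rat]_n * rat | [/\ 0 < (ratr p.2 : R), @qball R n p `<=` U &
  (e'%:E * mu (@qball R n p) <= mu (@qball R n p `&` (U `\` E)))%E]].
pose f (p : 'rV[rat]_n * rat) : V * R := (map_mx ratr p.1, ratr p.2).
pose l N := [seq f p | p <- [seq p <- pmap unpickle (iota 0 N) | `[< F p >]]].
pose W N := \bigcup_(p in [set p | p \in l N]) ball p.1 p.2.
have lP N p : p \in l N -> exists2 q, F q & p = f q.
  by move=> /mapP[q]; rewrite mem_filter => /andP[/asboolP Fq _ ->]; exists q.
have mW N : measurable (W N : set L).
  apply: fin_bigcup_measurable => [|p _]; [exact: finite_seq|exact: measurable_rV_ball].
have Wle N : (mu (W N) <= k%:E)%E.
  have := @vitali_measure (l N) (U `\` E) e' e'0 mUE.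
  have hl p : p \in l N -> 0 < p.2 /\
     (e'%:E * mu (ball p.1 p.2) <= mu (ball p.1 p.2 `&` (U `\` E)))%E.
    by move=> /lP[q [q0 _ qE] ->].
  move=> /(_ hl) {}hl.
  rewrite -(@lee_pmul2l _ e'%:E) ?lte_fin//; apply: (le_trans hl).
  apply: (@le_trans _ _ ((3 ^+ n)%:E * (e' * k / 3 ^+ n)%:E)%E).
    by apply: lee_wpmul2l; [rewrite lee_fin ltW|exact: ltW].
  by rewrite -!EFinM lee_fin mulrC divfK ?gt_eqF.
apply: (@le_trans _ _ (mu (\bigcup_N W N))); last first.
  apply: lebesgue_rV_bigcup_le => // a b ab; apply/subsetPset => x [p /= pa px].
  exists p => //=; move: pa => /mapP[q]; rewrite mem_filter => /andP[Fq qa] ->.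
  apply: map_f; rewrite mem_filter Fq/=; move: qa; rewrite !mem_pmap => /mapP[j ja ->].
  by apply: map_f; move: ja; rewrite !mem_iota !add0n/= => /leq_trans; exact.
apply: le_outer_measure => x [Ex hx].
have /nbhs_ballP[d /= d0 hd] := open_nbhs_nbhs (conj oU (EU _ Ex)).
have [r [r_0 rd hr]] := hx (d / 2) ltac:(lra).
have [||q [q0 q1 q2]] := @qball_between R n x r (2 * r); [lra|lra|].
have Fq : F q.
  split => //.
    by apply: subset_trans q2 _; apply: subset_trans hd; apply: le_ball; lra.
  apply: (@le_trans _ _ (eps * r ^+ n)%:E).
    apply: (@le_trans _ _ (e'%:E * mu (ball x (2 * r)))%E).
      by apply: lee_wpmul2l; [rewrite lee_fin ltW|exact: le_outer_measure].
    rewrite lebesgue_rV_ball; last lra.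
    rewrite -EFinM lee_fin (_ : 2 * (2 * r) = 4 * r); last by ring.
    by rewrite exprMn mulrA divfK// gt_eqF// exprn_gt0.
  apply: (le_trans (ltW hr)); apply: le_outer_measure => y [xy nE]; split; first exact: q1.
  split => //; apply: hd; apply: le_ball xy; lra.
exists (pickle q).+1 => //; exists (f q) => /=; last first.
  by apply: q1; exact: ballxx.
apply: map_f; rewrite mem_filter; apply/andP; split; first exact/asboolP.
rewrite mem_pmap; apply/mapP; exists (pickle q); last by rewrite pickleK.
by rewrite mem_iota /= ltnSn.
Qed.

Definition approx_continuous_at (D : set V) (g : V -> R) (x : V) :=
  forall eps eta : R, 0 < eps -> 0 < eta -> exists2 d, 0 < d &
    forall r, 0 < r -> r < d ->
      (mu (ball x r `&` [set y | D y /\ (eps < `|g y - g x|)%R]) <= (eta * r ^+ n)%:E)%E.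

Lemma ae_mono (P Q : V -> Prop) : (forall x, P x -> Q x) ->
  {ae mu, forall x, P x} -> {ae mu, forall x, Q x}.
Proof. by move=> PQ; apply: negligibleS => x /= nQ Px; exact/nQ/PQ. Qed.

Lemma ae_and (P Q : V -> Prop) : {ae mu, forall x, P x} -> {ae mu, forall x, Q x} ->
  {ae mu, forall x, P x /\ Q x}.
Proof.
move=> hP hQ; have := negligibleU hP hQ; apply: negligibleS => x /= /not_andP[]; by [left|right].
Qed.

Lemma ae_countable (I : countType) (P : I -> V -> Prop) :
  (forall i, {ae mu, forall x, P i x}) -> {ae mu, forall x, forall i, P i x}.
Proof.
move=> h.
have : {ae mu, forall x, forall k, if unpickle k is Some i then P i x else True}.
  by apply/ae_foralln => k; case: unpickle => [i|]; [exact: h|exact: aeW].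
by apply: ae_mono => x hx i; have := hx (pickle i); rewrite pickleK.
Qed.

(** Lebesgue-a.e. point is a density point of every sublevel and superlevel set
    with rational level that contains it. *)
Lemma ae_approx_continuous (D : set V) (g : V -> R) : measurable (D : set L) ->
  measurable_fun (D : set L) (g : L -> R) ->
  {ae mu, forall x, D x -> approx_continuous_at D g x}.
Proof.
move=> mD mg.
pose lev (b : bool) (q : rat) := if b then [set y : V | g y < ratr q] else [set y | ratr q < g y].
pose E (i : bool * rat * nat) := (D `&` lev i.1.1 i.1.2) `&` ball (0 : V) i.2%:R.
have mE i : measurable (E i : set L).
  apply: measurableI; last exact: measurable_rV_ball.
  case: i => -[[] q] N /=.
    have := mg mD _ (measurable_itv `]-oo, (ratr q : R)[).
    by congr measurable; apply/seteqP; split => x [Dx] /=; rewrite in_itv.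
  have := mg mD _ (measurable_itv `](ratr q : R), +oo[).
  by congr measurable; apply/seteqP; split => x [Dx] /=; rewrite in_itv/= andbT.
pose P (i : bool * rat * nat * nat) (x : V) := E i.1 x -> exists2 d, 0 < d &
  forall r, 0 < r -> r < d -> (mu (ball x r `\` E i.1) <= (i.2.+1%:R^-1 * r ^+ n)%:E)%E.
have hP i : {ae mu, forall x, P i x}.
  have := @lebesgue_density (E i.1) _ i.2.+1%:R^-1 (mE i.1) (fun x h => h.2) ltac:(by []).
  apply: negligibleS => x /= /not_implyP[Ex h]; split => // d d0.
  apply: contrapT => /forallNP h'; apply: h; exists d => // r r0 rd.
  by rewrite leNgt; apply/negP => hr; apply: (h' r).
have := ae_countable hP; apply: ae_mono => x hx Dx eps eta eps0 eta0.
have [q] : exists q : rat, ratr q \in `]g x, g x + eps[.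
  by apply: rat_in_itvoo; lra.
rewrite in_itv/= => /andP[q1 q2].
have [q'] : exists q : rat, ratr q \in `]g x - eps, g x[.
  by apply: rat_in_itvoo; lra.
rewrite in_itv/= => /andP[q1' q2'].
have [N hN] : exists N, `|x| < N%:R.
  by exists (Num.trunc `|x|).+1; rewrite truncnS_gt.
have [M hM] : exists M, M.+1%:R^-1 < eta / 2.
  have := @ltr_add_invr R 0 (eta / 2) ltac:(lra).
  by move=> [M]; rewrite add0r => ?; exists M.
have xN : ball (0 : V) N%:R x by rewrite -ball_normE /ball_/= sub0r normrN.
have [d1 d10 h1] := hx (true, q, N, M) (conj (conj Dx q1) xN).
have [d2 d20 h2] := hx (false, q', N, M) (conj (conj Dx q2') xN).
have /nbhs_ballP[d3 /= d30 h3] : nbhs x (ball (0 : V) N%:R).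
  by apply: open_nbhs_nbhs; split => //; exact: ball_open.
exists (Num.min d1 (Num.min d2 d3)); first by rewrite !lt_min d10 d20.
move=> r r0; rewrite !lt_min => /and3P[rd1 rd2 rd3].
apply: (@le_trans _ _ (mu (ball x r `\` E (true, q, N)) + mu (ball x r `\` E (false, q', N)))%E).
  apply: (le_trans _ (outer_measureU2 _ _ _)); apply: le_outer_measure.
  move=> y [xy [Dy]]; rewrite ltNge ler_distl => /negP h.
  have [gy|gy] := ltP (g y) (ratr q); [right|left]; split => //= -[[_ h4] _]; apply: h.
    have {}h4 : ratr q' < g y := h4.
    by rewrite (ltW (lt_trans q1' h4)) (ltW (lt_trans gy q2)).
  have {}h4 : g y < ratr q := h4.
  by move: h4; rewrite ltNge gy.
have := leeD (h1 r r0 rd1) (h2 r r0 rd2); move=> /le_trans; apply.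
rewrite -EFinD lee_fin -mulrDl ler_wpM2r ?exprn_ge0 ?(ltW r0)//=.
by rewrite (splitr eta) lerD// ltW.
Qed.

End density.

(** * Lipschitz functions of one variable *)

Lemma lipschitz_continuous (R : realType) (W : normedModType R) (f : W -> R) (K : R) :
  (forall x y, `|f x - f y| <= K * `|x - y|) -> continuous f.
Proof.
move=> fK x; apply/cvgrPdist_le => e e0.
have K0 : 0 < `|K| + 1 by have := normr_ge0 K; lra.
near=> y; apply: (le_trans (fK x y)).
have h : `|x - y| <= e / (`|K| + 1).
  near: y; apply: cvgr_dist_le; [exact: cvg_id|exact: divr_gt0].
apply: (@le_trans _ _ ((`|K| + 1) * (e / (`|K| + 1)))); last first.
  by rewrite mulrC divfK ?gt_eqF.
apply: (@le_trans _ _ ((`|K| + 1) * `|x - y|)).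
  by apply: ler_wpM2r => //; have := ler_norm K; lra.
by apply: ler_wpM2l => //; exact: ltW.
Unshelve. all: by end_near. Qed.

Section lipschitz_1d.
Variable R : realType.
Local Notation lam := (@lebesgue_measure R).

(** On half-open intervals the extension agrees with the length it extends. *)
Lemma lebesgue_stieltjes_ocitv (f : cumulative R R) (a b : R) : a <= b ->
  lebesgue_stieltjes_measure f `]a, b]%classic = (f b - f a)%:E.
Proof.
move=> ab; rewrite -(wlength_itv_bnd f false false ab).
rewrite /lebesgue_stieltjes_measure /measure_extension/= measurable_mu_extE//.
exact: is_ocitv.
Qed.

Variables (f : R -> R) (K : R).
Hypothesis K0 : 0 < K.
Hypothesis fK : forall x y, `|f x - f y| <= K * `|x - y|.

Let up x := K * x + f x.
Let dn x := K * x - f x.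

Let fK' x y : x <= y -> `|f y - f x| <= K * (y - x).
Proof. by move=> xy; have := fK y x; rewrite (@ger0_norm _ (y - x)) ?subr_ge0. Qed.

Let up_nd : {homo up : x y / x <= y}.
Proof.
by move=> x y xy; rewrite /up; have := fK' xy; rewrite ler_norml => /andP[h1 h2]; lra.
Qed.

Let dn_nd : {homo dn : x y / x <= y}.
Proof.
by move=> x y xy; rewrite /dn; have := fK' xy; rewrite ler_norml => /andP[h1 h2]; lra.
Qed.

Let up_rc : right_continuous up.
Proof.
apply/right_continuousW => x; apply: cvgD; first by apply: cvgMr; exact: cvg_id.
exact: (lipschitz_continuous fK).
Qed.

Let dn_rc : right_continuous dn.
Proof.
apply/right_continuousW => x; apply: cvgB; first by apply: cvgMr; exact: cvg_id.
exact: (lipschitz_continuous fK).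
Qed.

HB.instance Definition _ := isCumulative.Build R _ R up up_nd up_rc.
HB.instance Definition _ := isCumulative.Build R _ R dn dn_nd dn_rc.

Let nup := lebesgue_stieltjes_measure (up : cumulative R R).
Let num := lebesgue_stieltjes_measure (dn : cumulative R R).

Let nup_ocitv a b : a <= b -> nup `]a, b]%classic = (up b - up a)%:E.
Proof. exact: (lebesgue_stieltjes_ocitv (up : cumulative R R)). Qed.

Let num_ocitv a b : a <= b -> num `]a, b]%classic = (dn b - dn a)%:E.
Proof. exact: (lebesgue_stieltjes_ocitv (dn : cumulative R R)). Qed.

(** The Stieltjes measures of [K x + f x] and [K x - f x] add up to [2 K] times
    Lebesgue measure, hence each of them is dominated by it. *)
Let nup_null A : measurable A -> lam A = 0%E -> nup A = 0%E.
Proof.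
move=> mA A0.
have c0 : 0 <= (2 * K)^-1 by rewrite invr_ge0 mulr_ge0// ltW.
pose m := mscale (NngNum c0) (measure_add nup num).
have mE X : m X = ((2 * K)^-1%:E * (nup X + num X))%E.
  by rewrite -measure_addE.
have h : ((2 * K)^-1%:E * (nup A + num A) = 0)%E.
  rewrite -mE -A0; apply/esym/lebesgue_measure_unique => // _ [[a b] _ <-].
  wlog ab : b / a <= b => [H|].
    have [|ba] := leP a b; first exact: H.
    rewrite (_ : [set` _] = `]a, a]%classic); first exact: (H a).
    by rewrite !set_itv_ge//= bnd_simp -leNgt// ltW.
  rewrite [RHS]mE lebesgue_measure_itv/= lte_fin.
  rewrite nup_ocitv// num_ocitv//= -EFinD -EFinM /up /dn.
  move: ab; rewrite le_eqVlt => /predU1P[->|ab].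
    by rewrite ltxx !subrr addr0 mulr0.
  rewrite ab; congr EFin; field.
  by rewrite gt_eqF.
move/eqP: h; rewrite mule_eq0 eqe invr_eq0 gt_eqF/=; last exact: mulr_gt0.
by rewrite padde_eq0// => /andP[/eqP].
Qed.

Let derivable_ae_itv (N : nat) :
  {ae lam, forall x, x \in `](- N%:R), N%:R[ -> derivable f x 1}.
Proof.
pose D := `](- N%:R : R), N%:R]%classic.
have mD : measurable (D : set (measurableTypeR R)) by exact: measurable_itv.
have NN : - N%:R <= N%:R :> R by rewrite lerNl -subr_ge0 opprK addr_ge0.
have Doo : (nup D < +oo)%E by rewrite nup_ocitv// ltry.
pose nu : {finite_measure set (measurableTypeR R) -> \bar R} := mfrestr mD Doo.
have nulam : nu `<< lam.
  apply/null_content_dominatesP => A mA A0.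
  have := nup_null (measurableI _ _ mA mD).
  apply; apply/eqP; rewrite eq_le measure_ge0 andbT -A0.
  by apply: le_measure; rewrite ?inE//; exact: measurableI.
pose g := Radon_Nikodym_SigmaFinite.f nu lam.
have gint : lam.-integrable setT g := Radon_Nikodym_SigmaFinite.f_integrable nulam.
have gfin x : g x \is a fin_num := Radon_Nikodym_SigmaFinite.f_fin_num nulam x.
have gE : EFin \o (fine \o g) = g by apply/funext => x /=; rewrite fineK.
have fint : lam.-integrable setT (EFin \o (fine \o g)) by rewrite gE.
have floc : locally_integrable setT (fine \o g).
  by apply: open_integrable_locally => //; exact: openT.
have fy y : lam.-integrable `]-oo, y] (EFin \o (fine \o g)).
  by apply: (integrableS measurableT) => //; exact: measurable_itv.
have := @FTC1Ny R (fine \o g) fy floc.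
apply: filterS; first exact: (ae_filter_ringOfSetsType lam).
move=> x [+ _]; rewrite in_itv/= => + /andP[x1 x2].
set F := fun y : R => _ => dF.
have Fup y : - N%:R < y -> y < N%:R -> F y = up y - up (- N%:R).
  move=> y1 y2; rewrite /F /Rintegral (_ : (\int[_]_(t in _) _)%E = nu `]-oo, y]%classic).
    rewrite -[nu _]/(nup (`]-oo, y]%classic `&` D)).
    rewrite (_ : _ `&` D = `](- N%:R), y]%classic) ?nup_ocitv//=; first exact: ltW.
    apply/seteqP; rewrite /D; split => z /=; rewrite !in_itv/=.
      by move=> [-> /andP[-> _]].
    by move=> /andP[-> zy]; rewrite zy (le_trans zy (ltW y2)).
  rewrite (Radon_Nikodym_SigmaFinite.f_integral nulam); last exact: measurable_itv.
  by apply: eq_integral => t _; rewrite /= fineK.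
have dup : derivable up x 1.
  apply: (near_eq_derivable (f := F + cst (up (- N%:R)))); last exact: derivableD.
  near=> y; rewrite /= fctE/= Fup ?subrK//.
    by near: y; exact: lt_nbhsr.
  by near: y; exact: lt_nbhsl.
rewrite (_ : f = up - (fun y => K * y)); last first.
  by apply/funext => y; rewrite /up !fctE; lra.
by apply: derivableB => //; apply: derivableM.
Unshelve. all: by end_near. Qed.

(** Lebesgue's theorem in the Lipschitz case: [K x + f x] is the distribution
    function of a measure dominated by Lebesgue measure, hence an indefinite
    integral. *)
Lemma lipschitz_derivable_ae : {ae lam, forall x, derivable f x 1}.
Proof.
have : {ae lam, forall x, forall N : nat, x \in `](- N%:R), N%:R[ -> derivable f x 1}.
  by apply/ae_foralln => N; exact: derivable_ae_itv.
apply: filterS; first exact: (ae_filter_ringOfSetsType lam).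
move=> x h; apply: (h (Num.trunc `|x|).+1).
by rewrite in_itv/= -ltr_norml truncnS_gt.
Qed.

End lipschitz_1d.

(** * Almost everywhere convergence of difference quotients *)

Section difference_quotients.
Variables (R : realType) (n : nat).
Local Notation V := 'rV[R]_n.
Local Notation L := (lebesgue_rV_type R n).
Local Notation T := (n.-tuple (measurableTypeR R)).
Local Notation mu := (@lebesgue_rV R n).
Local Notation lam := (@lebesgue_measure R).

Lemma measurable_rV_of_tuple_open (U : set V) : open U ->
  measurable (@rV_of_tuple R n @^-1` U).
Proof.
move=> oU; rewrite (open_qball oU) preimage_bigcup bigcup_mkcond.
apply: countable_bigcupT_measurable; first exact: countableP.
move=> p; case: ifP => // _; have [r0|r0] := ltP 0 (ratr p.2 : R).
  rewrite /qball rV_ballE// preimage_tuple_of_rV.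
  by apply: measurable_tuple_box => i; exact: measurable_itv.
rewrite (_ : _ @^-1` _ = set0)// -subset0 => t [/(le_lt_trans r0)].
by rewrite ltxx.
Qed.

(** Measurability for the product sigma-algebra, which Tonelli's theorem
    requires and which is finer information than measurability for the
    completed measure. *)
Lemma continuous_measurable_tuple (f : V -> R) : continuous f ->
  measurable_fun setT ((fun t : T => f (rV_of_tuple t)) : T -> measurableTypeR R).
Proof.
move=> cf; apply: (measurability _ (RGenOInfty.measurableE R)) => _ [_ [a ->] <-].
rewrite setTI -[X in measurable X]/(@rV_of_tuple R n @^-1` (f @^-1` `]a, +oo[%classic)).
apply: measurable_rV_of_tuple_open; apply: open_comp => // x _; exact: cf.
Qed.

(** A Borel set met by every line parallel to the [i]-th axis in a null set is
    null, by Tonelli's theorem for [(s, x) |-> x + s e_i]. *)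
Lemma null_on_lines (i : 'I_n) (S : set T) : measurable S ->
  (forall x : V, lam [set s | S (tuple_of_rV (x + s *: delta_mx ord0 i))] = 0%E) ->
  tuple_lebesgue R n S = 0%E.
Proof.
move=> mS hS.
pose sh (p : measurableTypeR R * T) : T := tuple_shift (fun j => p.1 * (j == i)%:R) p.2.
have msh : measurable_fun setT sh.
  apply/measurable_fun_tnthP => j.
  rewrite (_ : _ \o _ = fun p => tnth p.2 j + p.1 * (j == i)%:R); last first.
    by apply/funext => p /=; rewrite tnth_mktuple.
  apply: measurable_funD; last exact: measurable_funM.
  by apply: (@measurableT_comp _ _ _ _ _ _ (fun t : T => tnth t j)) => //; exact: measurable_tnth.
have mshS : measurable (sh @^-1` S).
  by rewrite -[X in measurable X]setTI; exact: msh.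
(* measured in one order [P] has the measure of [S], in the other it is null by hypothesis *)
pose P : set (measurableTypeR R * T) := (`]0%R, 1%R]%classic `*` setT) `&` (sh @^-1` S).
have mP : measurable P.
  by apply: measurableI => //; apply: measurableX => //; exact: measurable_itv.
have E12 : (lam \x tuple_lebesgue R n)%E P = (lam \x^ tuple_lebesgue R n)%E P.
  apply: (@product_measure_unique _ _ _ _ _ lam (tuple_lebesgue R n)
    [the measure _ _ of (lam \x^ tuple_lebesgue R n)%E]) => //= A B mA mB.
  exact: product_measure2E.
have E2 : (lam \x^ tuple_lebesgue R n)%E P = 0%E.
  apply: integral0_eq => t _ /=; apply/eqP; rewrite eq_le measure_ge0 andbT.
  have := hS (rV_of_tuple t); set X := [set s | _]; move=> <-.
  have e s : tuple_of_rV (rV_of_tuple t + s *: delta_mx ord0 i) = sh (s, t).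
    by apply/eq_from_tnth => j; rewrite !tnth_mktuple !mxE eqxx/=.
  have mX : measurable (X : set (measurableTypeR R)).
    have := measurable_ysection t mshS.
    congr measurable; apply/seteqP; split => s.
      by rewrite /ysection /= inE /= -e.
    by rewrite /ysection /= inE /= -e.
  apply: le_measure; rewrite ?inE//; first exact: measurable_ysection.
  by move=> s; rewrite /ysection /= inE => -[_]; rewrite /X/= e.
have E1 : (lam \x tuple_lebesgue R n)%E P = tuple_lebesgue R n S.
  pose J : set (measurableTypeR R) := `]0%R, 1%R]%classic.
  have mJ : measurable J by exact: measurable_itv.
  transitivity (\int[lam]_s (tuple_lebesgue R n S * (\1_J s)%:E)%E)%E; last first.
    rewrite ge0_integralZl//; last by apply/measurable_EFinP; exact: measurable_indic.
    rewrite integral_indic// setIT -[RHS]mule1; congr (_ * _)%E.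
    have := @lebesgue_measure_itv R `]0%R, 1%R].
    by rewrite /= lte_fin ltr01 -EFinB subr0.
  apply: eq_integral.
  move=> s _ /=; rewrite indicE; have [s1|s1] := boolP (s \in _).
    rewrite mule1 -[RHS](tuple_lebesgue_shift (fun j => s * (j == i)%:R) mS).
    congr (tuple_lebesgue R n _); apply/seteqP; split => t; rewrite /xsection /= inE /=.
      by move=> [].
    by move=> h; split => //; split => //; rewrite inE in s1.
  rewrite mule0 (_ : xsection _ _ = set0) ?measure0// -subset0 => t.
  by rewrite /xsection /= inE => -[[/mem_set h _] _]; rewrite h in s1.
by rewrite -E1 E12.
Qed.

Definition diffq (u : V -> R) (i : 'I_n) (k : nat) (x : V) : R :=
  k.+1%:R * (u (x + k.+1%:R^-1 *: delta_mx ord0 i) - u x).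

(** Cauchy's criterion with all quantifiers countable, which makes the set of
    convergence of a sequence of measurable functions measurable. *)
Lemma cvg_seqP (a : R^nat) : cvgn a <->
  (forall m : nat, exists j : nat, forall k l, `|a (j + k)%N - a (j + l)%N| <= m.+1%:R^-1).
Proof.
split=> [/cvg_ex[l al] m|h].
  have e0 : 0 < m.+1%:R^-1 / 2 :> R by rewrite divr_gt0.
  have /cvgrPdist_le/(_ _ e0)[j _ hj] := al.
  exists j => p q; rewrite (_ : a _ - a _ = (l - a (j + q)%N) - (l - a (j + p)%N)); last by lra.
  apply: (le_trans (ler_normB _ _)); rewrite [leRHS]splitr.
  by apply: lerD; apply: hj; rewrite /= leq_addr.
apply/cauchy_cvgP/cauchy_exP => e e0.
have [m] := @ltr_add_invr R 0 e e0; rewrite add0r => hm.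
have [j hj] := h m.
exists (a j); exists j => // k /= jk; rewrite -ball_normE /ball_/=.
by have := hj 0%N (k - j)%N; rewrite addn0 subnKC// => /le_lt_trans; exact.
Qed.

Lemma measurable_not_cvg d (X : measurableType d) (q : nat -> X -> R) :
  (forall k, measurable_fun setT (q k)) -> measurable [set x | ~ cvgn (q ^~ x)].
Proof.
move=> mq.
rewrite (_ : [set x | _] = \bigcup_m \bigcap_j \bigcup_k \bigcup_l
  [set x | (m.+1%:R^-1 < `|q (j + k)%N x - q (j + l)%N x|)%R]).
  apply: bigcupT_measurable => m; apply: bigcapT_measurable => j.
  apply: bigcupT_measurable => k; apply: bigcupT_measurable => l.
  rewrite -[X in measurable X]setTI.
  apply: (@measurable_fun_ltr _ X R setT (cst m.+1%:R^-1) (fun x => `|q (j + k)%N x - q (j + l)%N x|)) => //.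
  by apply: measurableT_comp => //; exact: measurable_funB.
apply/seteqP; split => x /=.
  move=> /cvg_seqP/existsNP[m] /forallNP h; exists m => // j _.
  have /existsNP[k /existsNP[l /negP]] := h j; rewrite -ltNge => ?.
  by exists k => //; exists l.
move=> [m _ h] /cvg_seqP/(_ m)[j hj]; have [k _ [l _ /=]] := h j I.
by rewrite ltNge hj.
Qed.

Lemma derivable_diffq_cvg (u : V -> R) (i : 'I_n) (x : V) (s : R) :
  derivable (fun s : R => u (x + s *: delta_mx ord0 i)) s 1 ->
  cvgn (fun k => diffq u i k (x + s *: delta_mx ord0 i)).
Proof.
move=> /cvg_ex[l] /cvgr_dnbhsP/(_ (fun k => k.+1%:R^-1)) h; apply/cvg_ex; exists l.
have h0 k : k.+1%:R^-1 != 0 :> R by rewrite invr_neq0.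
have {}h := h (conj h0 (@cvg_harmonic R)).
apply: cvg_trans h; apply: near_eq_cvg; near=> k.
rewrite /diffq invrK -[RHS]/(k.+1%:R * _); congr (_ * (u _ - _)).
by rewrite [_ *: 1]mulr1 scalerDl [X in x + X]addrC addrA.
Unshelve. all: by end_near. Qed.

Definition diffq_lim (u : V -> R) (i : 'I_n) (x : V) : R :=
  if `[< cvgn (diffq u i ^~ x) >] then limn (diffq u i ^~ x) else 0.

Variables (u : V -> R) (K : R).
Hypothesis uK : forall x y, `|u x - u y| <= K * `|x - y|.

Lemma diffq_continuous i k : continuous (diffq u i k).
Proof.
apply: (@lipschitz_continuous _ _ _ (k.+1%:R * (2 * K))) => x y.
rewrite /diffq -mulrBr normrM normr_nat -mulrA ler_wpM2l//.
set e := _ *: _; have := uK (x + e) (y + e); have := uK x y.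
rewrite opprD addrACA subrr addr0 => h1 h2.
rewrite (_ : _ - _ = (u (x + e) - u (y + e)) - (u x - u y)); last by lra.
by apply: (le_trans (ler_normB _ _)); lra.
Qed.

(** The restriction of [u] to a line parallel to the axis is Lipschitz, hence
    differentiable almost everywhere on it. *)
Lemma diffq_cvg_ae i : {ae mu, forall x, cvgn (diffq u i ^~ x)}.
Proof.
apply: outer_null_negligible => /=.
pose S := [set t : T | ~ cvgn (diffq u i ^~ (rV_of_tuple t))].
have mS : measurable S.
  by apply: measurable_not_cvg => k; apply: continuous_measurable_tuple; exact: diffq_continuous.
rewrite (_ : ~` _ = @tuple_of_rV R n @^-1` S); last first.
  by apply/seteqP; split => x; rewrite /S /preimage/= tuple_of_rVK.
rewrite lebesgue_rV_tuple//; apply: (@null_on_lines i) => // x.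
pose f s := u (x + s *: delta_mx ord0 i).
pose K' := `|K| * `|delta_mx ord0 i : V| + 1.
have K'0 : 0 < K' by rewrite ltr_wpDl// mulr_ge0.
have fK' s t : `|f s - f t| <= K' * `|s - t|.
  apply: (le_trans (uK _ _)); rewrite opprD addrACA subrr add0r -scalerBl normrZ.
  rewrite mulrCA mulrC; apply: ler_wpM2r => //.
  by rewrite /K'; have := ler_wpM2r (normr_ge0 (delta_mx ord0 i : V)) (ler_norm K); lra.
have := lipschitz_derivable_ae K'0 fK' => -[N [mN N0 hN]].
apply/eqP; rewrite eq_le; apply/andP; split; last exact: outer_measure_ge0.
rewrite -N0; apply: le_outer_measure => s /= h; apply: hN => /= df; apply: h.
by rewrite tuple_of_rVK; exact: derivable_diffq_cvg.
Qed.

Lemma diffq_bound i k x : `|diffq u i k x| <= K * `|delta_mx ord0 i : V|.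
Proof.
rewrite /diffq normrM normr_nat; apply: (le_trans (ler_wpM2l _ (uK _ _))) => //.
rewrite addrC addKr normrZ gtr0_norm// mulrA [_ * K]mulrC -mulrA.
by rewrite [_ * (_ * `|_|)]mulrA divff// mul1r.
Qed.

(** The bound holds at every point, since the limit is replaced by [0] where it
    does not exist. *)
Lemma diffq_lim_bound i x : `|diffq_lim u i x| <= K * `|delta_mx ord0 i : V|.
Proof.
rewrite /diffq_lim; case: asboolP => [cv|_]; last first.
  by rewrite normr0; apply: le_trans (diffq_bound i 0 x).
rewrite -lim_norm//; apply: limr_le; first exact: is_cvg_norm.
by apply: nearW => k; exact: diffq_bound.
Qed.

Lemma measurable_diffq_lim i : measurable_fun setT (diffq_lim u i : L -> R).
Proof.
have mq k : measurable_fun setT (diffq u i k : L -> R).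
  by apply: continuousT_measurable_rV => //; exact: diffq_continuous.
have mC : measurable_fun setT ((fun x => `[< cvgn (diffq u i ^~ x) >]) : L -> bool).
  apply: (@measurable_fun_bool _ _ _ _ false); rewrite setTI.
  have := @measurable_not_cvg _ L (diffq u i) mq.
  congr measurable; apply/seteqP; split => x /=; first by move/asboolPn/negbTE.
  by move=> /negbT/asboolPn.
apply: (@measurable_fun_cvg _ L R setT
  (fun k x => if `[< cvgn (diffq u i ^~ x) >] then diffq u i k x else 0)).
  by move=> k; apply: measurable_fun_ifT.
move=> x _; rewrite /diffq_lim; case: asboolP => [//|_]; exact: cvg_cst.
Qed.

End difference_quotients.

(** * Smooth bump functions *)

Section smooth_bump_1d.
Variable R : realType.
Implicit Types (p q : {poly R}) (t s : R).

(** [flat p] is [p(1/t) exp(-1/t)] for [t > 0], extended by [0]: these functions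
    form a family stable under derivation. *)
Definition flat p t : R := if 0 < t then p.[t^-1] * expR (- t^-1) else 0.

Lemma flat_neg p t : t <= 0 -> flat p t = 0.
Proof. by move=> t0; rewrite /flat ltNge t0. Qed.

(** Quadratic decay at [0] is what differentiability of [flat p] at the origin
    requires; it follows from one term of the exponential series at [1 / t]. *)
Lemma flat_quadratic p : exists2 C, 0 <= C & forall t, `|flat p t| <= C * t ^+ 2.
Proof.
exists (\sum_(i < size p) `|p`_i| * (i.+2)`!%:R) => [|t].
  by apply: sumr_ge0 => i _; rewrite mulr_ge0.
rewrite /flat; case: ifPn => [t0|_]; last first.
  by rewrite normr0 mulr_ge0 ?sqr_ge0// sumr_ge0// => i _; rewrite mulr_ge0.
rewrite horner_coef mulr_suml mulr_suml; apply: (le_trans (ler_norm_sum _ _ _)).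
apply: ler_sum => i _; rewrite -!mulrA !normrM ler_wpM2l//.
have [s s0 ->] : exists2 s, 0 < s & t = s^-1.
  by exists t^-1; rewrite ?invr_gt0 ?invrK.
rewrite invrK.
rewrite (ger0_norm (exprn_ge0 _ (ltW s0))) (ger0_norm (expR_ge0 _)) expRN.
have h : s ^+ i.+2 / i.+2`!%:R <= expR s.
  by have := expR_ge1Dxn i.+1 (ltW s0); apply: le_trans; rewrite lerDr.
have N0 : 0 < i.+2`!%:R :> R by rewrite ltr0n fact_gt0.
rewrite ler_pdivrMr ?expR_gt0// exprVn -mulrA.
have -> : s ^+ i = i.+2`!%:R * ((s ^+ 2)^-1 * (s ^+ i.+2 / i.+2`!%:R)).
  by rewrite -addn2 exprD; field; rewrite !gt_eqF.
by rewrite !ler_pM2l ?invr_gt0 ?exprn_gt0.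
Qed.

Lemma is_derive_flat p t : is_derive t 1 (flat p) (flat ('X^2 * (p - p^`())) t).
Proof.
have [t0|t0|->] := ltgtP t 0.
- rewrite flat_neg ?(ltW t0)//; apply: (@near_eq_is_derive _ _ _ (cst 0)) => //.
  near=> y; rewrite flat_neg//; apply: ltW; near: y; exact: lt_nbhsl.
- have dV : is_derive t 1 (fun y : R => y^-1) (- t ^- 2 *: 1).
    by apply: is_deriveV; rewrite gt_eqF.
  have d1 : is_derive t 1 (fun y : R => p.[y^-1]) (p^`().[t^-1] * (- t ^- 2 *: 1)).
    exact: (@is_derive1_comp _ (horner p) (fun y => y^-1)).
  have dN : is_derive t 1 (fun y : R => - y^-1) (- (- t ^- 2 *: 1)).
    exact: (@is_deriveN _ _ _ (fun y : R => y^-1)).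
  have d2 : is_derive t 1 (fun y : R => expR (- y^-1)) (expR (- t^-1) * - (- t ^- 2 *: 1)).
    exact: (@is_derive1_comp _ expR (fun y => - y^-1)).
  have := @is_deriveM _ _ _ _ t 1 _ _ d1 d2; set D := _ + _ => h.
  have -> : flat ('X^2 * (p - p^`())) t = D.
    rewrite /flat t0 /D !hornerE/= /GRing.scale/=.
    set a := p.[_]; set b := p^`().[_]; set c := expR _; rewrite exprVn; ring.
  apply: near_eq_is_derive h; near=> y.
  rewrite /flat ifT//; near: y; exact: lt_nbhsr.
- rewrite flat_neg//.
  have [C C0 hC] := flat_quadratic p.
  suff h : (fun h : R => h^-1 *: (flat p (h *: 1 + 0) - flat p 0)) @ 0^' --> (0 : R).
    by apply: DeriveDef; [apply/cvg_ex; exists 0|apply: cvg_lim].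
  apply/cvgrPdist_le => e e0; near=> h.
  have h0 : h != 0 by near: h; exact: nbhs_dnbhs_neq.
  rewrite sub0r normrN addr0 [_ *: 1]mulr1 (@flat_neg _ 0)// subr0 normrZ normfV.
  rewrite mulrC ler_pdivrMr ?normr_gt0//; apply: (le_trans (hC h)).
  rewrite -real_normK ?num_real// expr2 mulrA ler_wpM2r//.
  apply: (@le_trans _ _ (C * (e / (C + 1)))).
    rewrite ler_wpM2l//; near: h; apply: dnbhs0_le; rewrite divr_gt0//; lra.
  by rewrite mulrA ler_pdivrMr ?ltr_wpDl// mulrC ler_wpM2l ?(ltW e0)//; lra.
Unshelve. all: by end_near. Qed.

(** The bump below and all its derivatives are sums of these products, whence
    smoothness without a formula for the derivatives. *)
Inductive bump_family : (R -> R) -> Prop :=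
| bump_familyM p q : bump_family (fun t => flat p (1 + t) * flat q (1 - t))
| bump_familyD f g : bump_family f -> bump_family g -> bump_family (fun t => f t + g t).

Lemma flatN p t : flat (- p) t = - flat p t.
Proof. by rewrite /flat; case: ifP => _; rewrite ?oppr0// hornerN mulNr. Qed.

Lemma bump_family_derive1 f : bump_family f ->
  (forall t, derivable f t 1) /\ bump_family (derive1 f).
Proof.
elim=> [p q|g h _ [dg bg] _ [dh bh]]; last first.
  split=> [t|]; first exact: derivableD.
  rewrite (_ : derive1 _ = fun t => derive1 g t + derive1 h t); first exact: bump_familyD.
  by apply/funext => t; rewrite !derive1E deriveD.
pose D (r : {poly R}) := 'X^2 * (r - r^`()).
have H t : is_derive t 1 (fun t => flat p (1 + t) * flat q (1 - t))
    (flat (D p) (1 + t) * flat q (1 - t) + flat p (1 + t) * flat (- D q) (1 - t)).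
  have d1 : is_derive t 1 (fun t : R => flat p (1 + t)) (flat (D p) (1 + t) * (0 + 1)).
    exact: (@is_derive1_comp _ (flat p) (fun y => 1 + y) _ _ _ (is_derive_flat p _)).
  have d2 : is_derive t 1 (fun t : R => flat q (1 - t)) (flat (D q) (1 - t) * (0 - 1)).
    exact: (@is_derive1_comp _ (flat q) (fun y => 1 - y) _ _ _ (is_derive_flat q _)).
  have H := @is_deriveM _ _ _ _ t 1 _ _ d1 d2; refine (is_derive_eq H _).
  by rewrite flatN /GRing.scale/=; ring.
split=> [t|]; first by case: (H t).
rewrite (_ : derive1 _ = fun t => flat (D p) (1 + t) * flat q (1 - t) + flat p (1 + t) * flat (- D q) (1 - t)).
  by apply: bump_familyD; exact: bump_familyM.
by apply/funext => t; rewrite derive1E; case: (H t).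
Qed.

Definition smooth1 (f : R -> R) := forall k t, derivable (derive1n k f) t 1.

Lemma smooth1_derive1 f : smooth1 f -> smooth1 (derive1 f).
Proof. by move=> sf k t; have := sf k.+1 t; rewrite /derive1n iterSr. Qed.

Lemma smooth1_affine f c a : smooth1 f -> smooth1 (fun t => f ((t - c) * a)).
Proof.
move=> sf k.
have dc s : is_derive s 1 (fun t : R => (t - c) * a) a.
  by apply: is_derive_eq; rewrite /GRing.scale/=; ring.
have H j t : is_derive t 1 (fun t => a ^+ j * derive1n j f ((t - c) * a))
    (a ^+ j.+1 * derive1n j.+1 f ((t - c) * a)).
  have dj : is_derive ((t - c) * a) 1 (derive1n j f) (derive1n j.+1 f ((t - c) * a)).
    by apply: DeriveDef; [exact: sf|rewrite derive1nS derive1E].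
  have Hj := @is_deriveZ _ _ _ _ (a ^+ j) _ _ _ (@is_derive1_comp _ _ _ t _ _ dj (dc t)).
  by refine (is_derive_eq Hj _); rewrite /GRing.scale/= exprSr; ring.
have -> : derive1n k (fun t => f ((t - c) * a)) = fun t => a ^+ k * derive1n k f ((t - c) * a).
  elim: k => [|j IH]; first by apply/funext => t /=; rewrite expr0 mul1r.
  by rewrite derive1nS IH; apply/funext => t; rewrite derive1E; case: (H j t).
by move=> t; case: (H k t).
Qed.

Definition bump1 t := flat 1 (1 + t) * flat 1 (1 - t).

Lemma smooth1_bump1 : smooth1 bump1.
Proof.
move=> k; suff : bump_family (derive1n k bump1) by move=> /bump_family_derive1[].
elim: k => [|k IH]; first exact: bump_familyM.
by rewrite derive1nS; exact: (bump_family_derive1 IH).2.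
Qed.

Lemma flat1_ge0 t : 0 <= flat 1 t.
Proof. by rewrite /flat; case: ifP => // _; rewrite hornerC mul1r expR_ge0. Qed.

Lemma flat1_le1 t : flat 1 t <= 1.
Proof.
rewrite /flat; case: ifP => // t0; rewrite hornerC mul1r -expR0 ler_expR.
by rewrite oppr_le0 invr_ge0 ltW.
Qed.

Lemma bump1_ge0 t : 0 <= bump1 t.
Proof. by rewrite mulr_ge0 ?flat1_ge0. Qed.

Lemma bump1_le1 t : bump1 t <= 1.
Proof. by rewrite -[leRHS](mulr1 1) ler_pM ?flat1_ge0 ?flat1_le1. Qed.

Lemma bump1_eq0 t : 1 <= `|t| -> bump1 t = 0.
Proof.
rewrite /bump1 ler_normr => /orP[] h; first by rewrite (@flat_neg _ (1 - t)) ?mulr0//; lra.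
by rewrite (@flat_neg _ (1 + t)) ?mul0r//; lra.
Qed.

Lemma bump1_lb : exists2 b, 0 < b & forall t, `|t| <= 2^-1 -> b <= bump1 t.
Proof.
exists (expR (-2) * expR (-2)) => [|t]; first by rewrite mulr_gt0 ?expR_gt0.
rewrite ler_norml => /andP[t1 t2].
have h s : 2^-1 <= s -> expR (-2) <= flat 1 s.
  move=> hs; have s0 : 0 < s by lra.
  rewrite /flat s0 hornerC mul1r ler_expR lerN2 -[leRHS]invrK lef_pV2 ?posrE//.
by apply: ler_pM; rewrite ?expR_ge0//; apply: h; lra.
Qed.

End smooth_bump_1d.

Section product_bump.
Variables (R : realType) (n : nat).
Local Notation V := 'rV[R]_n.
Implicit Types (f : 'I_n -> R -> R) (x c : V).

Definition tensor f : V -> R := fun x => \prod_i f i (x ord0 i).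

(** Partial derivatives of a product of functions of one variable are again
    such products, which makes smoothness a one-dimensional matter. *)
Lemma is_derive_tensor f x j : derivable (f j) (x ord0 j) 1 ->
  is_derive x (delta_mx ord0 j) (tensor f)
    (tensor (fun i => if i == j then derive1 (f j) else f i) x).
Proof.
move=> dj; pose C := \prod_(i | i != j) f i (x ord0 i).
have E : (fun h : R => h^-1 *: (tensor f (h *: delta_mx ord0 j + x) - tensor f x)) =
    fun h => (h^-1 *: (f j (h *: 1 + x ord0 j) - f j (x ord0 j))) * C.
  apply/funext => h; rewrite /tensor (bigD1 j)//= [X in _ - X](bigD1 j)//= !mxE !eqxx/=.
  rewrite (eq_bigr (fun i => f i (x ord0 i))) => [|i ij]; last first.
    by rewrite !mxE eqxx (negbTE ij) mulr0 add0r.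
  by rewrite -/C -mulrBl /GRing.scale/= mulrA.
have -> : tensor (fun i => if i == j then derive1 (f j) else f i) x = derive1 (f j) (x ord0 j) * C.
  rewrite /tensor (bigD1 j)//= eqxx; congr (_ * _).
  by apply: eq_bigr => i /negbTE ->.
have cv : (fun h : R => h^-1 *: (tensor f (h *: delta_mx ord0 j + x) - tensor f x)) @ 0^' -->
    derive1 (f j) (x ord0 j) * C.
  rewrite E; apply: cvgMl; rewrite derive1E; exact: dj.
by apply: DeriveDef; [apply/cvg_ex; eexists; exact: cv|exact: cvg_lim cv].
Qed.

Lemma tensor_differentiable f x : (forall i, derivable (f i) (x ord0 i) 1) ->
  differentiable (tensor f) x.
Proof.
move=> df; rewrite /tensor.
elim: (index_enum _) => [|i r IH].
  rewrite (_ : (fun y : V => _) = cst 1); first exact: differentiable_cst.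
  by apply/funext => y; rewrite big_nil.
rewrite (_ : (fun y : V => _) = (f i \o (fun y : V => y ord0 i)) *
    (fun y : V => \prod_(j <- r) f j (y ord0 j))); last first.
  by apply/funext => y; rewrite big_cons.
apply: differentiableM => //; apply: differentiable_comp.
  exact: differentiable_coord.
by apply/derivable1_diffP; exact: df.
Qed.

Lemma smooth_tensor f : (forall i, smooth1 (f i)) -> smooth (tensor f).
Proof.
move=> sf s.
have [g sg ->] : exists2 g, (forall i, smooth1 (g i)) &
    foldr (@partial R n) (tensor f) s = tensor g.
  elim: s => [|j s [g sg IH]] /=; first by exists f.
  exists (fun i => if i == j then derive1 (g j) else g i).
    by move=> i; case: ifP => _; [exact: smooth1_derive1|exact: sg].
  rewrite IH; apply/funext => x; rewrite /partial.
  by have [_ ->] := is_derive_tensor (sg j 0 (x ord0 j)).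
split=> [x|i x]; last by have [] := is_derive_tensor (sg i 0 (x ord0 i)).
by apply: differentiable_continuous; apply: tensor_differentiable => i; exact: (sg i 0).
Qed.

Lemma derive_partial (u : V -> R) x v : differentiable u x ->
  'D_v u x = \sum_i v ord0 i * partial i u x.
Proof.
move=> du; rewrite deriveE// {1}(row_sum_delta v) linear_sum.
by apply: eq_bigr => i _; rewrite linearZ /partial deriveE.
Qed.

Definition bump c (r : R) : V -> R :=
  tensor (fun i t => bump1 ((t - c ord0 i) * r^-1)).

Lemma bump_ge0 c r x : 0 <= bump c r x.
Proof. by apply: prodr_ge0 => i _; exact: bump1_ge0. Qed.

Lemma bump_le1 c r x : bump c r x <= 1.
Proof. by apply: prodr_ile1 => i _; rewrite bump1_ge0 bump1_le1. Qed.

Lemma rV_norm_lt x (r : R) : 0 < r -> `|x| < r <-> forall i, `|x ord0 i| < r.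
Proof.
move=> r0; have := rV_ballP 0 x r0; rewrite -ball_normE /ball_/= sub0r normrN => h.
by split=> [/h k i|k]; [have := k i|apply/h => i]; rewrite ?mxE sub0r normrN.
Qed.

Lemma rV_norm_le x (r : R) : 0 <= r -> `|x| <= r <-> forall i, `|x ord0 i| <= r.
Proof.
move=> r0; split=> [h i|h]; apply/ler_addgt0Pr => e e0.
  have /rV_norm_lt : `|x| < r + e by lra.
  by move=> /(_ ltac:(lra) i)/ltW.
by apply/ltW/rV_norm_lt => [|i]; [lra|have := h i; lra].
Qed.

Lemma bump_eq0 c r x : 0 < r -> r <= `|x - c| -> bump c r x = 0.
Proof.
move=> r0; rewrite leNgt => h; apply/eqP; apply: contraNT h => /prodf_neq0 b0.
apply/rV_norm_lt => // i; rewrite !mxE ltNge; apply: contraNN (b0 i isT) => h.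
by apply/eqP/bump1_eq0; rewrite normrM normfV (gtr0_norm r0) ler_pdivlMr// mul1r.
Qed.

Lemma bump_shift c r x v : bump (c + v) r (x + v) = bump c r x.
Proof. by apply: eq_bigr => i _; rewrite !mxE opprD addrACA subrr addr0. Qed.

Lemma differentiable_bump c r x : differentiable (bump c r) x.
Proof.
apply: tensor_differentiable => i.
exact: (@smooth1_affine R (@bump1 R) (c ord0 i) r^-1 (@smooth1_bump1 R) 0%N (x ord0 i)).
Qed.

(** The closed ball of the sup norm. *)
Definition closed_cube c (r : R) : set V := [set x | `|x - c| <= r].

Lemma compact_closed_cube c r : compact (closed_cube c r).
Proof.
apply: bounded_closed_compact.
  exists (`|c| + r); split; first exact: num_real.
  move=> M hM x /= xc; apply: ltW; apply: le_lt_trans hM.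
  by rewrite -(subrK c x) addrC (le_trans (ler_normD _ _))// lerD2l.
apply: (@closed_comp _ _ (fun x : V => `|x - c|) [set t | t <= r]); last exact: closed_le.
move=> x _; apply: (@lipschitz_continuous _ _ _ 1) => y z.
by rewrite mul1r (le_trans (ler_dist_dist _ _))// opprB addrA subrK.
Qed.

Lemma test_function_bump (Omega : set V) c r : 0 < r -> closed_cube c r `<=` Omega ->
  test_function Omega (bump c r).
Proof.
move=> r0 cO.
have cl : closure [set x | bump c r x != 0] `<=` closed_cube c r.
  rewrite [X in _ `<=` X](_ : _ = closure (closed_cube c r)); last first.
    apply/closure_id; apply: compact_closed; first exact: norm_hausdorff.
    exact: compact_closed_cube.
  apply: closureS => x /=; apply: contraNT; rewrite /closed_cube /= -ltNge => /ltW h.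
  by apply/eqP; exact: bump_eq0.
split.
- by apply: smooth_tensor => i; apply: smooth1_affine; exact: smooth1_bump1.
- apply: subclosed_compact cl; [exact: closed_closure|exact: compact_closed_cube].
- exact: subset_trans cO.
Qed.

End product_bump.

(** * Integrals against bumps and test functions *)

Section integrals.
Variables (R : realType) (n : nat).
Local Notation V := 'rV[R]_n.
Local Notation L := (lebesgue_rV_type R n).
Local Notation mu := (@lebesgue_rV R n).

Lemma measurable_closed_cube (c : V) r : measurable (closed_cube c r : set L).
Proof. by apply: compact_measurable_rV; exact: compact_closed_cube. Qed.

Lemma integrable_bounded_support (c : V) (r C : R) (f : L -> R) :
  measurable_fun setT f -> (forall x, `|f x| <= C) ->
  (forall x, ~ closed_cube c r x -> f x = 0) ->
  mu.-integrable setT (EFin \o f).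
Proof.
move=> mf fC f0; have mK := measurable_closed_cube c r.
have C0 : 0 <= C by apply: le_trans (fC 0).
apply: (@le_integrable _ _ _ mu setT measurableT _ (EFin \o (fun x => C * \1_(closed_cube c r) x))).
- exact/measurable_EFinP.
- move=> x _ /=; rewrite lee_fin [leRHS]ger0_norm ?mulr_ge0//.
  rewrite indicE; have [xK|xK] := boolP (x \in _); first by rewrite mulr1.
  by rewrite mulr0 f0 ?normr0//; rewrite notin_setE in xK.
- rewrite (_ : EFin \o _ = (fun x => C%:E * (\1_(closed_cube c r) x)%:E)%E)//.
  apply: integrableZl => //; apply/integrableP; split.
    by apply/measurable_EFinP; exact: measurable_indic.
  under eq_integral do rewrite gee0_abs ?lee_fin//.
  rewrite integral_indic// setIT; apply: compact_lebesgue_rV; exact: compact_closed_cube.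
Qed.

Lemma RintegralT_support (D S : set V) (f : V -> R) : measurable (D : set L) ->
  S `<=` D -> (forall x, ~ S x -> f x = 0) ->
  (\int[mu]_(x in D) f x = \int[mu]_x f x).
Proof.
move=> mD SD f0; rewrite /Rintegral; congr fine; rewrite integral_mkcond.
apply: eq_integral => x _; rewrite /patch; case: ifPn => //.
by rewrite notin_setE => nD; rewrite f0// => /SD.
Qed.

Lemma Rintegral_shift (h : V) (f : L -> R) : measurable_fun setT f ->
  \int[mu]_x f (x + h) = \int[mu]_x f x.
Proof.
move=> mf; rewrite /Rintegral; congr fine.
by apply: (@integral_shift _ _ h (EFin \o f)); exact/measurable_EFinP.
Qed.

Lemma measurable_bump (c : V) r : measurable_fun setT (bump c r : L -> R).
Proof.
apply: continuousT_measurable_rV => // x.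
by apply: differentiable_continuous; exact: differentiable_bump.
Qed.

Lemma bump_support (c : V) r x : 0 < r -> ~ closed_cube c r x -> bump c r x = 0.
Proof.
by move=> r0 h; apply: bump_eq0 => //; rewrite leNgt; apply/negP => /ltW.
Qed.

Lemma integrable_bump (c : V) r : 0 < r -> mu.-integrable setT (EFin \o bump c r).
Proof.
move=> r0; apply: (@integrable_bounded_support c r 1).
- exact: measurable_bump.
- by move=> x; rewrite ger0_norm ?bump_ge0// bump_le1.
- by move=> x; exact: bump_support.
Qed.

(** By translation invariance the mass of a bump depends on its radius only, so
    the centre is fixed at [0]. *)
Definition bump_mass (r : R) := \int[mu]_x bump 0 r x.

Lemma Rintegral_bump (c : V) r : \int[mu]_x bump c r x = bump_mass r.
Proof.
rewrite -(Rintegral_shift c (measurable_bump c r)); apply: eq_Rintegral => x _.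
by rewrite -[X in bump X _ _]add0r bump_shift.
Qed.

(** The bump is bounded below on the cube of half the radius. Only the order of
    magnitude [r ^+ n] of the mass enters the density estimates. *)
Lemma bump_mass_lb : exists2 b : R, 0 < b & forall r, 0 < r -> (b * r) ^+ n <= bump_mass r.
Proof.
have [b b0 hb] := @bump1_lb R; exists b => // r r0.
pose B := ball (0 : V) (r / 2).
have r20 : 0 < r / 2 by rewrite divr_gt0.
have mB : measurable (B : set L) by exact: measurable_rV_ball.
have := lebesgue_rV_ball (0 : V) r20; rewrite (mulrC 2 (r / 2)) divfK// => muB.
have -> : (b * r) ^+ n = \int[mu]_x (b ^+ n * \1_B x).
  rewrite RintegralZl//; last first.
    apply: (@integrable_bounded_support 0 r 1); first exact: measurable_indic.
      by move=> x; rewrite indicE; case: (_ \in _); rewrite ?normr1 ?normr0.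
    move=> x xr; rewrite indicE memNset// /B -ball_normE /ball_/= sub0r normrN => h.
    by apply: xr; rewrite /closed_cube /= subr0 ltW// (lt_trans h)//; lra.
  by rewrite /Rintegral integral_indic// setIT exprMn; congr (_ * _); exact: (esym (congr1 fine muB)).
apply: le_Rintegral => //.
- apply: (@integrable_bounded_support 0 r (b ^+ n)).
  + by apply: measurable_funM => //; exact: measurable_indic.
  + move=> x; rewrite indicE normrM (ger0_norm (exprn_ge0 _ (ltW b0))).
    by case: (_ \in _); rewrite ?normr1 ?normr0 ?mulr1 ?mulr0// exprn_ge0// ltW.
  + move=> x xr; rewrite indicE memNset ?mulr0// /B -ball_normE /ball_/= sub0r normrN => h.
    by apply: xr; rewrite /closed_cube /= subr0 ltW// (lt_trans h)//; lra.
- exact: integrable_bump.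
- move=> x _; rewrite indicE; have [/set_mem xB|_] := boolP (x \in (B : set V)); last first.
    by rewrite mulr0 bump_ge0.
  rewrite mulr1 /bump /tensor -[X in b ^+ X]card_ord -prodr_const.
  apply: ler_prod => i _; rewrite (ltW b0)/=; apply: hb.
  have /(rV_ballP _ _ r20)/(_ i) := xB; rewrite !mxE sub0r normrN subr0 => h.
  by rewrite normrM normfV (gtr0_norm r0) ler_pdivrMr// mulrC ltW.
Qed.

Lemma bounded_on_compact (K : set V) (f : V -> R) : compact K ->
  {within K, continuous f} -> exists2 C, 0 <= C & forall x, K x -> `|f x| <= C.
Proof.
move=> cK cf; have /compact_bounded[M [_ hM]] := continuous_compact cf cK.
exists (`|M| + 1) => [|x Kx]; first by have := normr_ge0 M; lra.
by apply: hM; [have := ler_norm M; lra|exists x].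
Qed.

Lemma is_derive_line (f : V -> R) (x v : V) (s : R) : derivable f (x + s *: v) v ->
  is_derive s 1 (fun s : R => f (x + s *: v)) ('D_v f (x + s *: v)).
Proof.
have E : (fun h : R => h^-1 *: (f (x + (h *: 1 + s) *: v) - f (x + s *: v))) =
    (fun h : R => h^-1 *: (f (h *: v + (x + s *: v)) - f (x + s *: v))).
  by apply/funext => h; rewrite [h *: 1]mulr1 scalerDl addrCA.
by move=> df; apply: DeriveDef; rewrite /derivable /derive /= E.
Qed.

Section test_functions.
Variables (Omega : set V) (phi : V -> R) (tphi : test_function Omega phi).
Let S := closure [set x | phi x != 0].

Lemma test_function_continuous : continuous phi.
Proof. by have [/(_ [::])[]] := tphi. Qed.

Lemma test_function_derivable i x : derivable phi x (delta_mx ord0 i).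
Proof. by have [/(_ [::])[_ +] _ _] := tphi; apply. Qed.

Lemma partial_test_function_continuous i : continuous (partial i phi).
Proof. by have [/(_ [:: i])[]] := tphi. Qed.

Lemma test_function_out x : ~ S x -> phi x = 0.
Proof.
by move=> nS; apply/eqP/negPn/negP => h; apply: nS; exact: subset_closure.
Qed.

Lemma partial_test_function_out i x : ~ S x -> partial i phi x = 0.
Proof.
move=> nS.
have E : \near x, phi x = (cst 0 : V -> R) x.
  have : nbhs (x : V) (~` S).
    by apply: open_nbhs_nbhs; split => //; apply: closed_openC; exact: closed_closure.
  by apply: filterS => y; exact: test_function_out.
by rewrite /partial (near_eq_derive _ E) derive_cst.
Qed.

Lemma test_function_cube : exists2 M, 0 <= M & S `<=` closed_cube 0 M.
Proof.
have [_ /compact_bounded[M [_ hM]] _] := tphi.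
exists (`|M| + 1) => [|x Sx]; first by have := normr_ge0 M; lra.
by rewrite /closed_cube /= subr0; apply: hM => //; have := ler_norm M; lra.
Qed.

Lemma partial_test_function_bounded i : exists2 B, 0 <= B & forall x, `|partial i phi x| <= B.
Proof.
have [_ cS _] := tphi.
have [B B0 hB] := bounded_on_compact cS (continuous_subspaceT (@partial_test_function_continuous i)).
exists B => // x; have [Sx|nS] := pselect (S x); first exact: hB.
by rewrite partial_test_function_out// normr0.
Qed.

Lemma test_function_bounded : exists2 B, 0 <= B & forall x, `|phi x| <= B.
Proof.
have [_ cS _] := tphi.
have [B B0 hB] := bounded_on_compact cS (continuous_subspaceT test_function_continuous).
exists B => // x; have [Sx|nS] := pselect (S x); first exact: hB.
by rewrite test_function_out// normr0.
Qed.

Lemma test_function_lipschitz i (B : R) (x : V) (h : R) : 0 < h ->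
  (forall x, `|partial i phi x| <= B) ->
  `|phi (x + h *: delta_mx ord0 i) - phi x| <= B * h.
Proof.
move=> h0 hB.
have d s := is_derive_line (@test_function_derivable i (x + s *: delta_mx ord0 i)).
have [|c _] := @MVT R (fun s => phi (x + s *: delta_mx ord0 i)) _ 0 h h0 (fun s _ => d s).
  apply: derivable_within_continuous => s _; by case: (d s).
rewrite scale0r addr0 subr0 => ->.
by rewrite normrM (gtr0_norm h0) ler_wpM2r ?(ltW h0)//; exact: hB.
Qed.

End test_functions.

End integrals.

(** * Weak derivatives of Lipschitz functions *)

Section weak_derivative_lipschitz.
Variables (R : realType) (n : nat).
Local Notation V := 'rV[R]_n.
Local Notation L := (lebesgue_rV_type R n).
Local Notation mu := (@lebesgue_rV R n).

Lemma integral_EFin (D : set V) (f : V -> R) : measurable (D : set L) ->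
  mu.-integrable D (EFin \o f) ->
  (\int[mu]_(x in D) (f x)%:E)%E = (\int[mu]_(x in D) f x)%:E.
Proof.
by move=> mD fi; rewrite /Rintegral fineK//; exact: (integrable_fin_num mD fi).
Qed.

Lemma mfunM (D : set V) (f g : V -> R) : measurable_fun (D : set L) (f : L -> R) ->
  measurable_fun (D : set L) (g : L -> R) -> measurable_fun (D : set L) ((fun x => f x * g x) : L -> R).
Proof. exact: measurable_funM. Qed.

Lemma mfunZ (D : set V) (c : R) (f : V -> R) : measurable_fun (D : set L) (f : L -> R) ->
  measurable_fun (D : set L) ((fun x => c * f x) : L -> R).
Proof. by move=> mf; apply: (@mfunM D (cst c) f) => //; exact: measurable_cst. Qed.

Lemma mfunB (D : set V) (f g : V -> R) : measurable_fun (D : set L) (f : L -> R) ->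
  measurable_fun (D : set L) (g : L -> R) -> measurable_fun (D : set L) ((fun x => f x - g x) : L -> R).
Proof. exact: measurable_funB. Qed.

Lemma integrableB_EFin (D : set V) (f g : V -> R) : measurable (D : set L) ->
  mu.-integrable D (EFin \o f) -> mu.-integrable D (EFin \o g) ->
  mu.-integrable D (EFin \o (fun x => f x - g x)).
Proof. by move=> mD fi gi; exact: (integrableB mD fi gi). Qed.

Lemma dominated_Rintegral (f_ : nat -> V -> R) (f : V -> R) (g : V -> R) :
  (forall k, measurable_fun setT (f_ k : L -> R)) ->
  measurable_fun setT (f : L -> R) ->
  {ae mu, forall x, f_ ^~ x @ \oo --> f x} ->
  mu.-integrable setT (EFin \o g) ->
  (forall k x, `|f_ k x| <= g x) ->
  (fun k => \int[mu]_x f_ k x) @ \oo --> \int[mu]_x f x.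
Proof.
move=> mf_ mf ff gi fg.
have [fi _ h] := @dominated_convergence _ L R mu setT measurableT
  (fun k x => (f_ k x)%:E) (EFin \o f) (EFin \o g)
  (fun k => (measurable_EFinP _ _).2 (mf_ k)) ((measurable_EFinP _ _).2 mf)
  ltac:(by apply: ae_mono ff => x h _; exact: cvg_comp h (fun A => id)) gi
  ltac:(by apply: aeW => x k _; rewrite lee_fin).
apply: fine_cvg; move: h; rewrite fineK//.
exact: integrable_fin_num.
Qed.

Lemma product_dominated (f g : V -> R) (M B : R) : continuous f ->
  (forall x, `|g x| <= B) -> (forall x, ~ closed_cube 0 M x -> g x = 0) ->
  exists2 C, 0 <= C & forall x, `|f x * g x| <= C * \1_(closed_cube (0 : V) M) x.
Proof.
move=> cf gB g0.
have [C C0 hC] := bounded_on_compact (@compact_closed_cube R n 0 M) (continuous_subspaceT cf).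
have B0 : 0 <= B by apply: le_trans (gB 0).
exists (C * B) => [|x]; first exact: mulr_ge0.
have [xM|xM] := pselect (closed_cube 0 M x).
  by rewrite indicE mem_set// mulr1 normrM ler_pM//; exact: hC.
by rewrite g0// mulr0 normr0 mulr_ge0// mulr_ge0.
Qed.

Lemma integrable_indic_cube (M C : R) :
  mu.-integrable setT (EFin \o (fun x : V => C * \1_(closed_cube (0 : V) M) x)).
Proof.
apply: (@integrable_bounded_support _ _ 0 M `|C|).
- apply: measurable_funM; first exact: measurable_cst.
  by apply: measurable_indic; exact: measurable_closed_cube.
- by move=> x; rewrite indicE normrM; case: (_ \in _); rewrite ?normr1 ?mulr1 ?normr0 ?mulr0.
- by move=> x xM; rewrite indicE memNset// mulr0.
Qed.

Lemma integrable_product (f g : V -> R) (M B : R) : continuous f ->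
  measurable_fun setT (g : L -> R) ->
  (forall x, `|g x| <= B) -> (forall x, ~ closed_cube 0 M x -> g x = 0) ->
  mu.-integrable setT (EFin \o (fun x => f x * g x)).
Proof.
move=> cf mg gB g0; have [C C0 hC] := product_dominated cf gB g0.
apply: (@le_integrable _ _ _ mu setT measurableT _
    (EFin \o (fun x => C * \1_(closed_cube (0 : V) M) x))); last exact: integrable_indic_cube.
  apply/measurable_EFinP; apply: mfunM mg; exact: continuousT_measurable_rV.
by move=> x _ /=; rewrite lee_fin (le_trans (hC x))// ler_norm.
Qed.

Variables (u : V -> R) (K : R).
Hypothesis uK : forall x y, `|u x - u y| <= K * `|x - y|.

Let cu : continuous u := lipschitz_continuous uK.

(** Difference quotients can be moved from the test function to [u] by
    translation invariance of the integral, and both sides pass to the limit by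
    dominated convergence. *)
Lemma weak_partial_lipschitz (Omega : set V) i : open Omega ->
  weak_partial Omega i u (diffq_lim u i).
Proof.
move=> oO phi tphi; have [_ _ SO] := tphi.
have mO : measurable (Omega : set L) by exact: open_measurable_rV.
have cphi := test_function_continuous tphi.
have mphi : measurable_fun setT (phi : L -> R) by exact: continuousT_measurable_rV.
have cdphi := @partial_test_function_continuous _ _ _ _ tphi i.
have mdphi : measurable_fun setT (partial i phi : L -> R) by exact: continuousT_measurable_rV.
have mu_ : measurable_fun setT (u : L -> R) by exact: continuousT_measurable_rV.
have [M0 M00 SM] := test_function_cube tphi.
have [B B0 hB] := partial_test_function_bounded tphi i.
have [B' B'0 hB'] := test_function_bounded tphi.
pose e : V := delta_mx ord0 i; pose h (k : nat) : R := k.+1%:R^-1.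
have h0 k : 0 < h k by rewrite invr_gt0.
have h1 k : h k <= 1 by rewrite invf_le1// ler1n.
pose M := M0 + `|e|.
have out0 (x : V) : ~ closed_cube 0 M x -> phi x = 0.
  move=> xM; apply: test_function_out => /SM; rewrite /closed_cube/= => xM0.
  by apply: xM; rewrite /closed_cube/= (le_trans xM0)// lerDl.
have dout0 (x : V) : ~ closed_cube 0 M x -> partial i phi x = 0.
  move=> xM; apply: partial_test_function_out => /SM; rewrite /closed_cube/= => xM0.
  by apply: xM; rewrite /closed_cube/= (le_trans xM0)// lerDl.
have sout0 k (x : V) : ~ closed_cube 0 M x -> phi (x - h k *: e) = 0.
  move=> xM; apply: test_function_out => /SM; rewrite /closed_cube/= subr0 => xM0.
  apply: xM; rewrite /closed_cube/= subr0 -(subrK (h k *: e) x).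
  rewrite (le_trans (ler_normD _ _))// lerD// normrZ gtr0_norm//.
  by rewrite ler_piMl.
have mtr k : measurable_fun setT ((fun x : V => phi (x - h k *: e)) : L -> R).
  apply: continuousT_measurable_rV => // x.
  apply: (@continuous_comp _ _ _ (fun x : V => x - h k *: e) phi); last exact: cphi.
  by apply: (@continuousB _ _ _ id (cst _)); [exact: cvg_id|exact: cst_continuous].
pose p k (x : V) := k.+1%:R * (phi x - phi (x - h k *: e)).
have kh k : k.+1%:R * h k = 1 :> R by rewrite divff.
have pB k x : `|p k x| <= B.
  have := test_function_lipschitz tphi (x - h k *: e) (h0 k) hB.
  rewrite subrK /p normrM normr_nat => /(ler_wpM2l (ler0n R k.+1)) /le_trans; apply.
  by rewrite mulrCA kh mulr1.
have mp k : measurable_fun setT (p k : L -> R).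
  exact: (mfunZ k.+1%:R (mfunB mphi (mtr k))).
have p0 k (x : V) : ~ closed_cube 0 M x -> p k x = 0.
  by move=> xM; rewrite /p out0// sout0// subr0 mulr0.
have cv1 : (fun k => \int[mu]_x (u x * p k x)) @ \oo --> \int[mu]_x (u x * partial i phi x).
  have [C C0 hC] : exists2 C, 0 <= C & forall k x, `|u x * p k x| <= C * \1_(closed_cube (0 : V) M) x.
    have [C C0 hC] := bounded_on_compact (@compact_closed_cube R n 0 M) (continuous_subspaceT cu).
    exists (C * B) => [|k x]; first exact: mulr_ge0.
    have [xM|xM] := pselect (closed_cube 0 M x).
      by rewrite indicE mem_set// mulr1 normrM ler_pM//; exact: hC.
    by rewrite p0// mulr0 normr0 mulr_ge0// mulr_ge0.
  apply: (dominated_Rintegral _ _ _ (integrable_indic_cube M C) hC).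
  - by move=> k; exact: (mfunM mu_ (mp k)).
  - exact: (mfunM mu_ mdphi).
  - apply: aeW => x; apply: cvgM; first exact: cvg_cst.
    have := @test_function_derivable _ _ _ _ tphi i x; rewrite /derivable => dx.
    have {}dx : (fun t : R => t^-1 *: (phi (t *: e + x) - phi x)) @ 0^' --> partial i phi x.
      exact: dx.
    have hn k : - h k != 0 by rewrite oppr_eq0 gt_eqF.
    have hc : (fun k => - h k) @ \oo --> (0 : R).
      by rewrite -oppr0; apply: cvgN; exact: cvg_harmonic.
    have := (cvgr_dnbhsP _ _ _).1 dx _ (conj hn hc); apply: cvg_trans.
    apply: near_eq_cvg; near=> k.
    have -> : p k x = (- h k)^-1 *: (phi (- h k *: e + x) - phi x).
      by rewrite /p /h invrN invrK !scaleNr (addrC (- _) x) -scalerN opprB.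
    by [].
have iup : mu.-integrable setT (EFin \o (fun x => u x * phi x)).
  exact: (integrable_product cu mphi hB' out0).
have E k : \int[mu]_x (u x * p k x) = - \int[mu]_x (diffq u i k x * phi x).
  have ctr : continuous (fun x : V => u (x + h k *: e)).
    move=> x; apply: (@continuous_comp _ _ _ (fun x : V => x + h k *: e) u); last exact: cu.
    by apply: (@continuousD _ _ _ id (cst _)); [exact: cvg_id|exact: cst_continuous].
  have i1 : mu.-integrable setT (EFin \o (fun x => u x * phi (x - h k *: e))).
    exact: (integrable_product cu (mtr k) (fun x => hB' _) (sout0 k)).
  have i2 : mu.-integrable setT (EFin \o (fun x => u (x + h k *: e) * phi x)).
    exact: (integrable_product ctr mphi hB' out0).
  have -> : \int[mu]_x (u x * p k x) =
      k.+1%:R * (\int[mu]_x (u x * phi x) - \int[mu]_x (u x * phi (x - h k *: e))).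
    rewrite -RintegralB// -RintegralZl//; last exact: integrableB_EFin.
    by apply: eq_Rintegral => x _; rewrite /p mulrCA mulrBr.
  have -> : \int[mu]_x (diffq u i k x * phi x) =
      k.+1%:R * (\int[mu]_x (u (x + h k *: e) * phi x) - \int[mu]_x (u x * phi x)).
    rewrite -RintegralB// -RintegralZl//; last exact: integrableB_EFin.
    by apply: eq_Rintegral => x _; rewrite /diffq -mulrA mulrBl.
  rewrite -(Rintegral_shift (h k *: e) (f := fun x => u x * phi (x - h k *: e))); last first.
    exact: (mfunM mu_ (mtr k)).
  under [X in _ - X]eq_Rintegral do rewrite addrK.
  by rewrite -mulrN opprB.
have cv2 : (fun k => \int[mu]_x (diffq u i k x * phi x)) @ \oo -->
    \int[mu]_x (diffq_lim u i x * phi x).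
  have iphi : mu.-integrable setT (EFin \o (fun x => (K * `|e|) * `|phi x|)).
    apply: (@integrable_product (cst (K * `|e|)) (fun x => `|phi x|) M B').
    - exact: cst_continuous.
    - exact: measurableT_comp.
    - by move=> x; rewrite normr_id.
    - by move=> x /out0 ->; rewrite normr0.
  apply: (dominated_Rintegral _ _ _ iphi).
  - move=> k; apply: (mfunM _ mphi); apply: continuousT_measurable_rV => //.
    exact: diffq_continuous uK _ _.
  - exact: (mfunM (measurable_diffq_lim uK _) mphi).
  - apply: ae_mono (diffq_cvg_ae uK i) => x cx; apply: cvgM; last exact: cvg_cst.
    by rewrite /diffq_lim asboolT.
  - by move=> k x; rewrite normrM ler_wpM2r//; exact: diffq_bound.
have cv3 : (fun k => \int[mu]_x (u x * p k x)) @ \oo --> - \int[mu]_x (diffq_lim u i x * phi x).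
  by under eq_fun do rewrite E; exact: cvgN.
have key := cvg_unique (@Rhausdorff R) cv1 cv3.
have ig : mu.-integrable setT (EFin \o (fun x => diffq_lim u i x * phi x)).
  rewrite (_ : (fun x => _) = (fun x => phi x * diffq_lim u i x)); last by apply/funext => x; rewrite mulrC.
  rewrite (_ : (fun x => _) = (fun x => 1 * (phi x * diffq_lim u i x))); last by apply/funext => x; rewrite mul1r.
  apply: (@integrable_product (cst 1) (fun x => phi x * diffq_lim u i x) M (B' * (K * `|e|))).
  - exact: cst_continuous.
  - exact: (mfunM mphi (measurable_diffq_lim uK _)).
  - by move=> x; rewrite normrM ler_pM//; exact: diffq_lim_bound uK _ _.
  - by move=> x /out0 ->; rewrite mul0r.
rewrite integral_EFin//; last first.
  apply: (integrableS measurableT) => //.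
  exact: (integrable_product cu mdphi hB dout0).
rewrite integral_EFin//; last exact: (integrableS measurableT).
rewrite -EFinN; congr EFin.
rewrite (@RintegralT_support _ _ _ _ (fun x => u x * partial i phi x) mO SO); last first.
  by move=> x xS; rewrite (partial_test_function_out _ xS) mulr0.
rewrite (@RintegralT_support _ _ _ _ (fun x => diffq_lim u i x * phi x) mO SO); first exact: key.
by move=> x xS; rewrite (test_function_out xS) mulr0.
Unshelve. all: by end_near. Qed.

End weak_derivative_lipschitz.

(** * Increments of functions with a weak gradient *)

Section mollified_increment.
Variables (R : realType) (n : nat).
Local Notation V := 'rV[R]_n.
Local Notation L := (lebesgue_rV_type R n).
Local Notation mu := (@lebesgue_rV R n).

Lemma integrable_sum_EFin (D : set V) (I : Type) (s : seq I) (f : I -> V -> R) :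
  measurable (D : set L) -> (forall i, mu.-integrable D (EFin \o f i)) ->
  mu.-integrable D (EFin \o (fun x => \sum_(i <- s) f i x)).
Proof.
move=> mD fi; rewrite (_ : EFin \o _ = (fun x => \sum_(i <- s) (f i x)%:E)%E); last first.
  by apply/funext => x /=; rewrite sumEFin.
by apply: integrable_sum => // i _; exact: fi.
Qed.

Lemma Rintegral_sum (D : set V) (I : Type) (s : seq I) (f : I -> V -> R) :
  measurable (D : set L) -> (forall i, mu.-integrable D (EFin \o f i)) ->
  \int[mu]_(x in D) (\sum_(i <- s) f i x) = \sum_(i <- s) \int[mu]_(x in D) f i x.
Proof.
move=> mD fi; elim: s => [|i s IH].
  by rewrite big_nil; under eq_Rintegral do rewrite big_nil; rewrite Rintegral_cst// mul0r.
rewrite big_cons -IH -RintegralD//; last exact: integrable_sum_EFin.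
by apply: eq_Rintegral => x _; rewrite big_cons.
Qed.

Lemma ae_le_Rintegral (D : set V) (f g : V -> R) : measurable (D : set L) ->
  mu.-integrable D (EFin \o f) -> mu.-integrable D (EFin \o g) ->
  {ae mu, forall x, D x -> f x <= g x} ->
  \int[mu]_(x in D) f x <= \int[mu]_(x in D) g x.
Proof.
move=> mD fi gi fg; rewrite -subr_ge0 -RintegralB//.
have mf : measurable_fun (D : set L) (f : L -> R) by move/integrableP : fi => [/measurable_EFinP].
have mg : measurable_fun (D : set L) (g : L -> R) by move/integrableP : gi => [/measurable_EFinP].
have md := mfunB mg mf.
have mn : measurable_fun (D : set L) ((fun x => `|g x - f x|) : L -> R).
  exact: (measurableT_comp (@normr_measurable R setT) md).
have -> : \int[mu]_(x in D) (g x - f x) = \int[mu]_(x in D) `|g x - f x|.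
  rewrite /Rintegral; congr fine.
  apply: (@ae_eq_integral _ L R mu D (fun x => `|g x - f x|%:E) (fun x => (g x - f x)%:E) mD
    ((measurable_EFinP _ _).2 md) ((measurable_EFinP _ _).2 mn)).
  by apply: ae_mono fg => x h Dx; rewrite ger0_norm// subr_ge0 h.
by apply: Rintegral_ge0.
Qed.

Lemma derive_shift (f : V -> R) (h v x : V) :
  'D_v (fun z => f (z - h)) x = 'D_v f (x - h).
Proof.
rewrite /derive /=.
rewrite (_ : (fun t : R => t^-1 *: (f (t *: v + x - h) - f (x - h))) =
  (fun t : R => t^-1 *: (f (t *: v + (x - h)) - f (x - h))))//.
by apply/funext => t; rewrite addrA.
Qed.

Lemma partial_bump_shift i (c h : V) (r : R) x :
  partial i (bump (c + h) r) x = partial i (bump c r) (x - h).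
Proof.
rewrite /partial -derive_shift.
rewrite (_ : bump (c + h) r = fun z => bump c r (z - h))//.
by apply/funext => z; rewrite -{1}(subrK h z) bump_shift.
Qed.

Variables (Omega : set V) (oO : open Omega) (w : V -> R) (G : V -> V).
Hypothesis cw : {within Omega, continuous w}.
Hypothesis HG : forall i, L2loc Omega (fun x => G x ord0 i) /\
  weak_partial Omega i w (fun x => G x ord0 i).

Let mO : measurable (Omega : set L) := open_measurable_rV oO.

Let w0 : V -> R := w \_ Omega.

Let mw0 : measurable_fun setT (w0 : L -> R).
Proof.
exact: ((measurable_restrictT (w : L -> R) mO).1 (continuous_measurable_rV mO cw)).
Qed.

(** Local square integrability implies local integrability through [|a| <= 1 +
    a ^ 2]. *)
Lemma integrable_weak_partial_bump i (c : V) (r : R) : 0 < r ->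
  closed_cube c r `<=` Omega ->
  mu.-integrable Omega (EFin \o (fun x => G x ord0 i * bump c r x)).
Proof.
move=> r0 cO; have [[mG iG] _] := HG i.
have mC := measurable_closed_cube c r.
have cC := @compact_closed_cube R n c r.
have H1 : mu.-integrable (closed_cube c r) (EFin \o (fun x => 1 + G x ord0 i ^+ 2)).
  rewrite (_ : EFin \o _ = ((cst 1%E : V -> \bar R) \+ (EFin \o (fun x => (G x ord0 i ^+ 2)%R)))%E); last first.
    by apply/funext => x.
  apply: integrableD => //; last exact: iG.
  apply/integrableP; split; first exact: measurable_cst.
  rewrite (eq_integral (cst 1%E)); last by move=> x _ /=; rewrite normr1.
  by rewrite integral_cst// mul1e; exact: compact_lebesgue_rV.
have H2 : mu.-integrable (closed_cube c r) (EFin \o (fun x => G x ord0 i * bump c r x)).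
  apply: (@le_integrable _ _ _ mu _ mC _ (EFin \o (fun x => 1 + G x ord0 i ^+ 2))) => //.
    apply/measurable_EFinP; apply: mfunM; last first.
      by apply: measurable_funTS; exact: measurable_bump.
    exact: measurable_funS mG.
  move=> x _ /=; rewrite lee_fin normrM (ger0_norm (bump_ge0 _ _ _)).
  rewrite [leRHS]ger0_norm ?addr_ge0 ?sqr_ge0//.
  have b1 := bump_le1 c r x; have b0 := bump_ge0 c r x.
  rewrite -[G x ord0 i ^+ 2]real_normK ?num_real//.
  have g0 := normr_ge0 (G x ord0 i); nra.
have E : (EFin \o (fun x => G x ord0 i * bump c r x)) =
    (EFin \o (fun x => G x ord0 i * bump c r x)) \_ (closed_cube c r).
  apply/funext => x; rewrite /patch; case: ifPn => //; rewrite notin_setE => nx /=.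
  by rewrite bump_support// mulr0.
rewrite E; apply/integrable_restrict => //.
by rewrite (_ : Omega `&` closed_cube c r = closed_cube c r)//; apply/setIidr.
Qed.

Lemma Rintegral_patch (f : V -> R) :
  \int[mu]_(y in Omega) (w y * f y) = \int[mu]_y (w0 y * f y).
Proof.
rewrite Rintegral_mkcond; apply: eq_Rintegral => y _.
by rewrite /w0 /patch; case: ifP => // _; rewrite mul0r.
Qed.

(** The average of [w] over a bump centred at [x + s v] is a differentiable
    function of [s], with derivative given by the weak gradient through the
    test function property of the bump; the formula is the mean value theorem
    for it. *)
Lemma mollified_mvt (c0 x v : V) (rho r : R) : 0 < r ->
  closed_cube c0 rho `<=` Omega -> `|x - c0| + 2 * `|v| + r <= rho ->
  exists2 s, 0 < s < 1 &
    \int[mu]_(y in Omega) (w y * bump (x + v) r y) - \int[mu]_(y in Omega) (w y * bump x r y) =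
    \int[mu]_(y in Omega) ((\sum_i v ord0 i * G y ord0 i) * bump (x + s *: v) r y).
Proof.
have itv2 (s : R) : s \in `[0, 1] -> -2 < s /\ s < 2.
  by rewrite in_itv/= => /andP[s0 s1]; split; lra.
move=> r0 KO hrho; set Kc := closed_cube c0 rho in KO.
have mK : measurable (Kc : set L) by exact: measurable_closed_cube.
have cK : compact Kc by exact: compact_closed_cube.
have [C C0 hC] := bounded_on_compact cK (continuous_subspaceW KO cw).
have w0C (y : V) : Kc y -> `|w0 y| <= C.
  by move=> Ky; rewrite /w0 /patch mem_set ?hC//; exact: KO.
have sub (s : R) : -2 < s -> s < 2 -> closed_cube (x + s *: v) r `<=` Kc.
  move=> s1 s2 y; rewrite /Kc /closed_cube /= => hy; apply: le_trans hrho.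
  rewrite (le_trans (ler_distD (x + s *: v) _ _))// addrC lerD//.
  rewrite [x + _ - _]addrAC (le_trans (ler_normD _ _))// lerD2l normrZ ler_wpM2r//.
  by rewrite ltW// ltr_norml s1 s2.
have test (s : R) : -2 < s -> s < 2 -> test_function Omega (bump (x + s *: v) r).
  by move=> s1 s2; apply: test_function_bump => //; apply: subset_trans KO; exact: sub.
have test0 : test_function setT (bump x r) by exact: test_function_bump.
pose f (s : R) (y : V) := w0 y * bump (x + s *: v) r y.
pose df (s : R) (y : V) := w0 y * - (\sum_i v ord0 i * partial i (bump (x + s *: v) r) y).
have bumpE (s : R) (y : V) : bump (x + s *: v) r y = bump x r (y + s *: - v).
  by rewrite scalerN -{1}(subrK (s *: v) y) bump_shift.
have dfE (s : R) (y : V) : is_derive s 1 (f ^~ y) (df s y).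
  have db : derivable (bump x r) (y + s *: - v) (- v).
    by apply: diff_derivable; exact: differentiable_bump.
  have H := is_derive_line db.
  have H2 := @is_deriveZ _ _ _ _ (w0 y) _ _ _ H.
  have -> : f ^~ y = w0 y \*: (fun s => bump x r (y + s *: - v)).
    by apply/funext => t; rewrite /f bumpE.
  refine (is_derive_eq H2 _); rewrite /df -[LHS]/(w0 y * 'D_(- v) (bump x r) (y + s *: - v)); congr (_ * _).
  rewrite derive_partial; last exact: differentiable_bump.
  rewrite -sumrN; apply: eq_bigr => i _.
  by rewrite [(- v) _ _]mxE mulNr partial_bump_shift scalerN.
have mf (s : R) : measurable_fun setT (f s : L -> R) by exact: mfunM mw0 (measurable_bump _ _).
have fi (s : R) : s \in `]-2, 2[ -> mu.-integrable setT (EFin \o f s).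
  rewrite in_itv/= => /andP[s1 s2].
  have out y : ~ Kc y -> f s y = 0.
    move=> nK; rewrite /f bump_support ?mulr0// => h; apply: nK; exact: sub h.
  apply: (@integrable_bounded_support _ _ c0 rho C (f s) (mf s)) => // y.
  have [Ky|nK] := pselect (Kc y); last by rewrite out// normr0.
  rewrite /f normrM (ger0_norm (bump_ge0 _ _ _)) -[leRHS]mulr1.
  by rewrite ler_pM ?bump_ge0 ?bump_le1// w0C.
have /choice[B hB] : forall i, exists B, 0 <= B /\ forall y, `|partial i (bump x r) y| <= B.
  by move=> i; have [B B0 hB] := partial_test_function_bounded test0 i; exists B.
pose M := C * \sum_i `|v ord0 i| * B i.
have M0 : 0 <= M.
  by apply: mulr_ge0 => //; apply: sumr_ge0 => i _; rewrite mulr_ge0//; case: (hB i).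
have pout i (s : R) (y : V) : -2 < s -> s < 2 -> ~ Kc y ->
    partial i (bump (x + s *: v) r) y = 0.
  move=> s1 s2 nK; apply: partial_test_function_out => h.
  have {}h : closure (closed_cube (x + s *: v) r) y.
    apply: closureS h => z /=; apply: contraNP => nz; apply/eqP/bump_support => //.
  apply: nK; apply: (sub s s1 s2); move: h; rewrite -(closure_id _).1//.
  by apply: compact_closed; [exact: norm_hausdorff|exact: compact_closed_cube].
have dfB (s : R) (y : V) : s \in `]-2, 2[ -> `|df s y| <= M * \1_Kc y.
  rewrite in_itv/= => /andP[s1 s2]; have [Ky|nK] := pselect (Kc y).
    rewrite indicE mem_set// mulr1 /df normrM normrN ler_pM//; first exact: w0C.
    apply: (le_trans (ler_norm_sum _ _ _)); apply: ler_sum => i _.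
    by rewrite normrM ler_wpM2l// partial_bump_shift; case: (hB i).
  rewrite indicE memNset// mulr0 /df big1 ?oppr0 ?mulr0 ?normr0// => i _.
  by rewrite pout// mulr0.
have Mi : mu.-integrable setT (EFin \o (fun y => M * \1_Kc y)).
  apply: (@integrable_bounded_support _ _ c0 rho M).
  - by apply: mfunZ; exact: measurable_indic.
  - move=> y; rewrite indicE normrM (ger0_norm M0).
    by case: (_ \in _); rewrite ?normr1 ?mulr1 ?normr0 ?mulr0.
  - by move=> y yM; rewrite indicE memNset// mulr0.
pose F (s : R) := \int[mu]_y f s y.
have df1 (s : R) (y : V) : partial1of2 f s y = df s y.
  by rewrite partial1of2E; case: (dfE s y).
have dF (s : R) : s \in `]-2, 2[ -> is_derive s 1 F (\int[mu]_y df s y).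
  move=> sI.
  have fi' (t : R) : (`]-2, 2[%classic : set R) t -> mu.-integrable setT (EFin \o f t).
    by move=> tI; exact: fi.
  have dr (t : R) (y : V) : (`]-2, 2[%classic : set R) t -> setT y -> derivable (f ^~ y) t 1.
    by move=> _ _; case: (dfE t y).
  have Mge (y : V) : 0 <= M * \1_Kc y by rewrite mulr_ge0// indicE.
  have db (t : R) (y : V) : (`]-2, 2[%classic : set R) t -> setT y -> `|partial1of2 f t y| <= M * \1_Kc y.
    by move=> tI _; rewrite df1; exact: dfB.
  have H1 := @derivable_under_integral R _ L mu f setT measurableT s (-2) 2 sI fi' dr _ Mge Mi db.
  have H2 := @differentiation_under_integral R _ L mu f setT measurableT s (-2) 2 sI fi' dr _ Mge Mi db.
  apply: DeriveDef; first exact: H1.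
  rewrite -derive1E H2; apply: eq_Rintegral => y _; exact: df1.
have sub01 (s : R) : s \in `[0, 1] -> s \in `]-2, 2[.
  by move=> /itv2[s1 s2]; rewrite in_itv/= s1 s2.
have l01 : (0 : R) < 1 by exact: ltr01.
have hd (s : R) : s \in `]0, 1[ -> is_derive s 1 F (\int[mu]_y df s y).
  by move=> s01; apply: dF; apply: sub01; exact: subset_itv_oo_cc s01.
have hc : {within `[0, 1], continuous F}.
  by apply: derivable_within_continuous => s s01; case: (dF s (sub01 s s01)).
have [s s01 FE] := @MVT R F (fun s => \int[mu]_y df s y) 0 1 l01 hd hc.
exists s; first by move: s01; rewrite in_itv.
have [s1 s2] := itv2 s (subset_itv_oo_cc s01).
rewrite !Rintegral_patch.
move: FE; rewrite /F /f scale1r scale0r addr0 subr0 mulr1 => ->.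
have mp i : measurable_fun setT (partial i (bump (x + s *: v) r) : L -> R).
  apply: continuousT_measurable_rV => //.
  exact: (@partial_test_function_continuous _ _ _ _ (test s s1 s2) i).
have ip i : mu.-integrable setT (EFin \o (fun y => w0 y * partial i (bump (x + s *: v) r) y)).
  apply: (@integrable_bounded_support _ _ c0 rho (C * B i)).
  - exact: mfunM mw0 (mp i).
  - move=> y; have [B0 hBi] := hB i; have [Ky|nK] := pselect (Kc y).
      by rewrite normrM ler_pM// ?w0C// partial_bump_shift.
    by rewrite pout// mulr0 normr0 mulr_ge0.
  - by move=> y nK; rewrite pout// mulr0.
have iZ (c : R) (D : set V) (h : V -> R) : measurable (D : set L) ->
    mu.-integrable D (EFin \o h) -> mu.-integrable D (EFin \o (fun y => c * h y)).
  by move=> mD hi; exact: (integrableZl mD c hi).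
have -> : \int[mu]_y df s y =
    \sum_i (- v ord0 i) * \int[mu]_y (w0 y * partial i (bump (x + s *: v) r) y).
  transitivity (\int[mu]_y (\sum_i (- v ord0 i) * (w0 y * partial i (bump (x + s *: v) r) y))).
    apply: eq_Rintegral => y _; rewrite /df -sumrN mulr_sumr; apply: eq_bigr => i _.
    by rewrite mulrN mulrCA mulNr.
  rewrite Rintegral_sum//; last by move=> i; exact: iZ.
  by apply: eq_bigr => i _; rewrite RintegralZl.
have iG i : mu.-integrable Omega (EFin \o (fun y => G y ord0 i * bump (x + s *: v) r y)).
  by apply: integrable_weak_partial_bump => //; apply: subset_trans KO; exact: sub.
have -> : \int[mu]_(y in Omega) ((\sum_i v ord0 i * G y ord0 i) * bump (x + s *: v) r y) =
    \sum_i v ord0 i * \int[mu]_(y in Omega) (G y ord0 i * bump (x + s *: v) r y).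
  transitivity (\int[mu]_(y in Omega) (\sum_i v ord0 i * (G y ord0 i * bump (x + s *: v) r y))).
    apply: eq_Rintegral => y _; rewrite mulr_suml; apply: eq_bigr => i _.
    by rewrite mulrA.
  rewrite Rintegral_sum//; last by move=> i; exact: iZ.
  by apply: eq_bigr => i _; rewrite RintegralZl.
apply: eq_bigr => i _; rewrite mulNr -mulrN; congr (_ * _).
rewrite -Rintegral_patch; have [_ /(_ _ (test s s1 s2)) wp] := HG i.
by rewrite /Rintegral wp fineN opprK.
Qed.

Lemma bump_mass_gt0 (r : R) : 0 < r -> 0 < bump_mass n r.
Proof.
move=> r0; have [b b0 hb] := bump_mass_lb R n; apply: lt_le_trans (hb r r0).
by rewrite exprn_gt0// mulr_gt0.
Qed.

Lemma Rintegral_scaled_bump (x : V) (r a : R) : 0 < r -> closed_cube x r `<=` Omega ->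
  \int[mu]_(y in Omega) (a * bump x r y) = a * bump_mass n r.
Proof.
move=> r0 xO; rewrite (RintegralT_support mO xO); last first.
  by move=> y ny; rewrite bump_support// mulr0.
by rewrite RintegralZl ?Rintegral_bump//; exact: integrable_bump.
Qed.

Lemma integrable_mul_bump (x : V) (r : R) : 0 < r -> closed_cube x r `<=` Omega ->
  mu.-integrable Omega (EFin \o (fun y => w y * bump x r y)).
Proof.
move=> r0 xO; have mK := measurable_closed_cube x r.
have [C C0 hC] := bounded_on_compact (@compact_closed_cube R n x r) (continuous_subspaceW xO cw).
have H : mu.-integrable setT (EFin \o (fun y => w0 y * bump x r y)).
  apply: (@integrable_bounded_support _ _ x r C).
  - exact: mfunM mw0 (measurable_bump _ _).
  - move=> y; have [Ky|nK] := pselect (closed_cube x r y); last first.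
      by rewrite bump_support// mulr0 normr0.
    rewrite normrM (ger0_norm (bump_ge0 _ _ _)) -[leRHS]mulr1.
    rewrite ler_pM ?bump_ge0 ?bump_le1//.
    by rewrite /w0 /patch mem_set ?hC//; exact: xO.
  - by move=> y ny; rewrite bump_support// mulr0.
have : mu.-integrable Omega (EFin \o (fun y => w0 y * bump x r y)).
  exact: (integrableS measurableT mO (@subsetT _ _) H).
apply: eq_integrable => //.
by move=> y /set_mem Oy /=; rewrite /w0 /patch mem_set.
Qed.

(** The bump is nonnegative and vanishes off the cube, so only values of [w]
    within [e] of [w x] are averaged. *)
Lemma mollified_near (x : V) (r e : R) : 0 < r -> closed_cube x r `<=` Omega ->
  (forall y, closed_cube x r y -> `|w y - w x| <= e) ->
  (w x - e) * bump_mass n r <= \int[mu]_(y in Omega) (w y * bump x r y) <=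
  (w x + e) * bump_mass n r.
Proof.
move=> r0 xO osc.
have ic (a : R) : mu.-integrable Omega (EFin \o (fun y => a * bump x r y)).
  have := integrableS measurableT mO (@subsetT _ _) (integrable_bump x r0).
  by move=> hi; exact: (integrableZl mO a hi).
have iw := integrable_mul_bump r0 xO.
rewrite -!(Rintegral_scaled_bump _ r0 xO); apply/andP; split.
  apply: le_Rintegral => // y _; have [Ky|nK] := pselect (closed_cube x r y); last first.
    by rewrite bump_support// !mulr0.
  rewrite ler_wpM2r ?bump_ge0//; have := osc y Ky.
  by rewrite ler_distl => /andP[].
apply: le_Rintegral => // y _; have [Ky|nK] := pselect (closed_cube x r y); last first.
  by rewrite bump_support// !mulr0.
rewrite ler_wpM2r ?bump_ge0//; have := osc y Ky.
by rewrite ler_distl => /andP[].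
Qed.

(** Averaging [<G, v>] over a bump of radius [r] that travels from [x] to [x + v]
    bounds the increment of [w], up to the oscillation of [w] at scale [r]; the
    set [Bad] only contributes through its measure near [x]. *)
Lemma increment_estimate (c0 x v : V) (rho r a b e : R) (Bad : set V) : 0 < r ->
  closed_cube c0 rho `<=` Omega -> `|x - c0| + 2 * `|v| + r <= rho ->
  0 <= b -> measurable (Bad : set L) ->
  {ae mu, forall y, closed_cube c0 rho y ->
    \sum_i v ord0 i * G y ord0 i <= a + b * \1_Bad y} ->
  (forall y, closed_cube x r y -> `|w y - w x| <= e) ->
  (forall y, closed_cube (x + v) r y -> `|w y - w (x + v)| <= e) ->
  w (x + v) - w x <= a +
    b * (fine (mu (Bad `&` ball x (2 * (r + `|v|)))) / bump_mass n r) + 2 * e.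
Proof.
move=> r0 KO hrho b0 mBad hG osc1 osc2.
have I0 := bump_mass_gt0 r0.
have sub (s : R) : 0 <= s -> s <= 1 -> closed_cube (x + s *: v) r `<=` closed_cube c0 rho.
  move=> s0 s1 y; rewrite /closed_cube /= => hy; apply: le_trans hrho.
  rewrite (le_trans (ler_distD (x + s *: v) _ _))// addrC lerD//.
  rewrite [x + _ - _]addrAC (le_trans (ler_normD _ _))// lerD2l normrZ ler_wpM2r//.
  by rewrite ger0_norm// (le_trans s1)// ler1n.
have sub1 : closed_cube (x + v) r `<=` Omega.
  by apply: subset_trans KO; rewrite -[v]scale1r; apply: sub.
have sub0 : closed_cube x r `<=` Omega.
  by apply: subset_trans KO; rewrite -[x]addr0 -(scale0r v); apply: sub.
have /andP[_ h0] := mollified_near r0 sub0 osc1.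
have /andP[h1 _] := mollified_near r0 sub1 osc2.
have [s /andP[s0 s1] E] := mollified_mvt r0 KO hrho.
set X := \int[mu]_(y in Omega) (w y * bump (x + v) r y) in h1 E.
set Y := \int[mu]_(y in Omega) (w y * bump x r y) in h0 E.
have subs : closed_cube (x + s *: v) r `<=` closed_cube c0 rho by apply: sub; exact: ltW.
have subO : closed_cube (x + s *: v) r `<=` Omega by apply: subset_trans KO.
pose B' := Bad `&` ball x (2 * (r + `|v|)).
have mB' : measurable (B' : set L) by apply: measurableI => //; exact: measurable_rV_ball.
have rv0 : 0 < 2 * (r + `|v|) by rewrite mulr_gt0// ltr_pwDl.
have iB' : mu.-integrable setT (EFin \o (fun y => \1_B' y : R)).
  apply: (@integrable_bounded_support _ _ x (2 * (r + `|v|)) 1).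
  - exact: measurable_indic.
  - by move=> y; rewrite indicE; case: (_ \in _); rewrite ?normr1 ?normr0.
  - move=> y ny; rewrite indicE memNset// => -[_].
    by rewrite -ball_normE /ball_/= distrC => /ltW.
have ib : mu.-integrable Omega (EFin \o (fun y => a * bump (x + s *: v) r y)).
  have := integrableS measurableT mO (@subsetT _ _) (integrable_bump (x + s *: v) r0).
  by move=> hi; exact: (integrableZl mO a hi).
have iB2 : mu.-integrable Omega (EFin \o (fun y => b * \1_B' y)).
  have := integrableS measurableT mO (@subsetT _ _) iB'.
  by move=> hi; exact: (integrableZl mO b hi).
have up : X - Y <= a * bump_mass n r + b * fine (mu B').
  rewrite E; apply: (@le_trans _ _ (\int[mu]_(y in Omega) (a * bump (x + s *: v) r y + b * \1_B' y))).
    apply: ae_le_Rintegral => //.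
    - have iG i : mu.-integrable Omega (EFin \o (fun y => v ord0 i * (G y ord0 i * bump (x + s *: v) r y))).
        have hi := integrable_weak_partial_bump i r0 subO.
        exact: (integrableZl mO (v ord0 i) hi).
      have := integrable_sum_EFin (index_enum 'I_n) mO iG.
      apply: eq_integrable => // y _ /=; congr EFin.
      by rewrite mulr_suml; apply: eq_bigr => i _; rewrite mulrA.
    - exact: (integrableD mO ib iB2).
    - apply: ae_mono hG => y hy Oy.
      have [Ky|nK] := pselect (closed_cube (x + s *: v) r y); last first.
        by rewrite bump_support// !mulr0 add0r mulr_ge0// indicE.
      apply: (le_trans (ler_wpM2r (bump_ge0 _ _ _) (hy (subs y Ky)))).
      rewrite mulrDl lerD2l -mulrA ler_wpM2l//.
      rewrite !indicE; have [/set_mem By|_] := boolP (y \in Bad); last by rewrite mul0r.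
      rewrite mem_set ?mul1r ?bump_le1//; split => //.
      rewrite -ball_normE /ball_/= distrC.
      have : `|y - x| <= r + `|v|.
        rewrite -(subrK (s *: v) y) -addrA (le_trans _ (lerD Ky (_ : `|s *: v| <= `|v|)))//.
          rewrite (le_trans _ (ler_normD _ _))// opprD addrA.
          by rewrite subrK addrA subrK.
        by rewrite normrZ gtr0_norm// ler_piMl// ltW.
      have vp : 0 < r + `|v| by rewrite ltr_pwDl.
      by move=> /le_lt_trans; apply; lra.
  rewrite RintegralD//; rewrite (Rintegral_scaled_bump _ r0 subO) lerD2l.
  apply: (@le_trans _ _ (b * \int[mu]_(y in Omega) \1_B' y)).
    rewrite RintegralZl//; exact: (integrableS measurableT mO (@subsetT _ _) iB').
  rewrite ler_wpM2l// /Rintegral fine_le//.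
  - exact: (integrable_fin_num mO (integrableS measurableT mO (@subsetT _ _) iB')).
  - rewrite ge0_fin_numE ?measure_ge0//.
    by apply: (@bounded_lebesgue_rV _ _ _ x (2 * (r + `|v|))) => y [].
  - by rewrite integral_indic//; apply: le_outer_measure => y [].
have key : (w (x + v) - w x - 2 * e) * bump_mass n r <= a * bump_mass n r + b * fine (mu B').
  by nra.
have : w (x + v) - w x - 2 * e <= a + b * (fine (mu B') / bump_mass n r).
  rewrite -(ler_pM2r I0) [leRHS]mulrDl; apply: (le_trans key).
  by rewrite lerD2l -!mulrA mulVf ?gt_eqF// mulr1.
by rewrite lerBlDr.
Qed.

End mollified_increment.

Section increments.
Variables (R : realType) (n : nat).
Local Notation V := 'rV[R]_n.
Local Notation L := (lebesgue_rV_type R n).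
Local Notation mu := (@lebesgue_rV R n).

(** Without an exceptional set the bound of the averaged gradient passes to [w]
    itself, by letting the mollification radius tend to zero. *)
Lemma bounded_gradient_increment (Omega : set V) (w : V -> R) (G : V -> V)
    (c0 x v : V) (rho a : R) :
  open Omega -> {within Omega, continuous w} ->
  (forall i, L2loc Omega (fun x => G x ord0 i) /\
    weak_partial Omega i w (fun x => G x ord0 i)) ->
  closed_cube c0 rho `<=` Omega -> `|x - c0| + 2 * `|v| < rho ->
  {ae mu, forall y, closed_cube c0 rho y -> \sum_i v ord0 i * G y ord0 i <= a} ->
  w (x + v) - w x <= a.
Proof.
move=> oO cw HG KO hrho hG; apply/ler_addgt0Pr => e e0.
have cwx y : Omega y -> {for y, continuous w}.
  have : {in Omega, continuous w} by rewrite -continuous_open_subspace.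
  by move=> h Oy; apply: h; exact/mem_set.
have Ox : Omega x.
  by apply: KO; rewrite /closed_cube/=; have := normr_ge0 v; lra.
have Oxv : Omega (x + v).
  apply: KO; rewrite /closed_cube/= addrAC (le_trans (ler_normD _ _))//.
  by have := normr_ge0 v; lra.
have e20 : 0 < e / 2 by lra.
have /cvgrPdist_le/(_ _ e20)/nbhs_ballP[d1 /= d10 h1] := cwx x Ox.
have /cvgrPdist_le/(_ _ e20)/nbhs_ballP[d2 /= d20 h2] := cwx (x + v) Oxv.
(* the room left in the cube for the mollification radius *)
pose d3 := rho - (`|x - c0| + 2 * `|v|).
have d30 : 0 < d3 by rewrite subr_gt0.
pose r := Num.min (d1 / 2) (Num.min (d2 / 2) d3).
have r0 : 0 < r by rewrite !lt_min d30 !divr_gt0.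
have rd1 : r < d1 by rewrite (@le_lt_trans _ _ (d1 / 2)) ?ge_min ?lexx//; lra.
have rd2 : r < d2 by rewrite (@le_lt_trans _ _ (d2 / 2)) ?ge_min ?lexx ?orbT//; lra.
have rd3 : r <= d3 by rewrite !ge_min lexx !orbT.
have H := @increment_estimate R n Omega oO w G cw HG c0 x v rho r a 0 (e / 2) set0
  r0 KO ltac:(by rewrite /d3 in rd3; lra) (lexx 0) measurable0.
apply: (le_trans (H _ _ _)); last by rewrite mul0r addr0 mulrC divfK.
- by apply: ae_mono hG => y hy /hy; rewrite mul0r addr0.
- move=> y hy; rewrite distrC; apply: h1; rewrite -ball_normE /ball_/= distrC.
  exact: le_lt_trans hy rd1.
- move=> y hy; rewrite distrC; apply: h2; rewrite -ball_normE /ball_/= distrC.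
  exact: le_lt_trans hy rd2.
Qed.

(** The increment of a Lipschitz function over [v] is governed by the values of
    its weak gradient outside a set of small density: the mollification radius is
    a small fixed fraction of [t], and the density is then taken small enough for
    the bad set to be negligible at that scale. *)
Lemma increment_asymptotic (eps Lam C : R) : 0 < eps -> 0 <= Lam -> 0 <= C ->
  exists2 eta, 0 < eta & forall (Omega : set V) (w : V -> R) (G : V -> V)
    (x z v : V) (rho t a : R) (Bad : set V),
  open Omega -> {within Omega, continuous w} ->
  (forall i, L2loc Omega (fun x => G x ord0 i) /\
    weak_partial Omega i w (fun x => G x ord0 i)) ->
  closed_cube x rho `<=` Omega -> 0 < t -> 4 * t <= rho -> `|z - x| <= t -> `|v| <= t ->
  measurable (Bad : set L) ->
  (mu (ball x (8 * t) `&` Bad) <= (eta * (8 * t) ^+ n)%:E)%E ->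
  {ae mu, forall y, closed_cube x rho y ->
    \sum_i v ord0 i * G y ord0 i <= a + C * t * \1_Bad y} ->
  (forall y y', closed_cube x rho y -> closed_cube x rho y' ->
    `|w y - w y'| <= Lam * `|y - y'|) ->
  w (z + v) - w z <= a + eps * t.
Proof.
move=> eps0 Lam0 C0; have [b b0 hb] := bump_mass_lb R n.
(* [kap * t] is the mollification radius: the oscillation of [w] there costs at most [eps / 2 * t] *)
pose kap := Num.min 1 (eps / (4 * (Lam + 1))).
have kap0 : 0 < kap by rewrite lt_min ltr01/= divr_gt0// mulr_gt0//; lra.
have kap1 : kap <= 1 by rewrite ge_min lexx.
have Lkap : 2 * Lam * kap <= eps / 2.
  have : kap <= eps / (4 * (Lam + 1)) by rewrite ge_min lexx orbT.
  rewrite ler_pdivlMr; last by rewrite mulr_gt0//; lra.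
  by nra.
(* [Q] compares the volume of the cube of radius [8 * t] with the mass of the bump *)
pose Q := (8 / (b * kap)) ^+ n.
have Q0 : 0 < Q by rewrite exprn_gt0// divr_gt0// mulr_gt0.
exists (eps / (2 * (C + 1) * Q)).
  by rewrite divr_gt0// !mulr_gt0//; lra.
set eta := eps / _.
have Ceta : C * (eta * Q) <= eps / 2.
  have C1 : 0 < 2 * (C + 1) by lra.
  have -> : eta * Q = eps / (2 * (C + 1)) by rewrite /eta invfM mulrA divfK// gt_eqF.
  rewrite mulrA ler_pdivrMr//; nra.
move=> Omega w G x z v rho t a Bad oO cw HG KO t0 trho zx vt mBad dBad hG lip.
pose r := kap * t.
have r0 : 0 < r by rewrite mulr_gt0.
have rt : r <= t by rewrite /r ler_piMl// ltW.
have zc y : closed_cube z r y -> closed_cube x rho y.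
  rewrite /closed_cube /= => h; apply: le_trans trho.
  by rewrite (le_trans (ler_distD z _ _))//; lra.
have zvc y : closed_cube (z + v) r y -> closed_cube x rho y.
  rewrite /closed_cube /= => h; apply: le_trans trho.
  rewrite (le_trans (ler_distD (z + v) _ _))//.
  have : `|z + v - x| <= `|z - x| + `|v| by rewrite addrAC ler_normD.
  by lra.
have Ct0 : 0 <= C * t by rewrite mulr_ge0// ltW.
have o1 y : closed_cube z r y -> `|w y - w z| <= Lam * r.
  move=> hy; apply: (le_trans (lip _ _ (zc _ hy) _)); last by rewrite ler_wpM2l.
  by apply: zc; rewrite /closed_cube/= subrr normr0 ltW.
have o2 y : closed_cube (z + v) r y -> `|w y - w (z + v)| <= Lam * r.
  move=> hy; apply: (le_trans (lip _ _ (zvc _ hy) _)); last by rewrite ler_wpM2l.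
  by apply: zvc; rewrite /closed_cube/= subrr normr0 ltW.
have H := @increment_estimate R n Omega oO w G cw HG x z v rho r a (C * t) (Lam * r) Bad
  r0 KO ltac:(lra) Ct0 mBad hG o1 o2.
apply: (le_trans H).
rewrite -addrA lerD2l (_ : eps * t = eps / 2 * t + eps / 2 * t); last by field.
apply: lerD; last first.
  by rewrite /r !mulrA ler_wpM2r// ltW.
apply: (@le_trans _ _ (C * t * (eta * Q))); last first.
  by rewrite mulrAC ler_wpM2r// ltW.
apply: ler_wpM2l => //.
rewrite ler_pdivrMr ?bump_mass_gt0//.
apply: (@le_trans _ _ (eta * (8 * t) ^+ n)).
  rewrite -lee_fin fineK; last first.
    rewrite ge0_fin_numE ?measure_ge0//.
    by apply: (@bounded_lebesgue_rV _ _ _ z (2 * (r + `|v|))) => y [].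
  apply: le_trans dBad; apply: le_outer_measure => y [By zy]; split => //.
  move: zy; rewrite -!ball_normE /ball_/= => zy.
  rewrite (le_lt_trans (ler_distD z _ _))// distrC.
  by move: zy zx rt vt; lra.
rewrite -[leRHS]mulrA ler_pM2l; last by rewrite /eta divr_gt0// !mulr_gt0//; lra.
apply: (@le_trans _ _ (Q * (b * r) ^+ n)); last by rewrite ler_wpM2l ?(ltW Q0)// hb.
rewrite /Q /r -exprMn (_ : 8 / (b * kap) * (b * (kap * t)) = 8 * t)//.
by field; rewrite !gt_eqF.
Qed.

End increments.

(** * Rademacher's theorem *)

Section rademacher.
Variables (R : realType) (n : nat).
Local Notation V := 'rV[R]_n.
Local Notation L := (lebesgue_rV_type R n).
Local Notation mu := (@lebesgue_rV R n).

Lemma derive_limit (u : V -> R) (x : V) (i : 'I_n) (l : R) :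
  (forall eps, 0 < eps -> exists2 d, 0 < d & forall h : R, 0 < `|h| -> `|h| < d ->
    `|u (x + h *: delta_mx ord0 i) - u x - h * l| <= eps * `|h|) ->
  partial i u x = l.
Proof.
move=> H; rewrite /partial /derive; apply: cvg_lim => //.
apply/cvgrPdist_le => e e0; have [d d0 hd] := H e e0.
apply/nbhs_ballP; exists d => //= h; rewrite -ball_normE /ball_/= sub0r normrN => hd1 h0.
have h0' : 0 < `|h| by rewrite normr_gt0.
have := hd h h0' hd1; rewrite [_ *: _ + x]addrC -[_ *: (_ - _)]/(_ * _).
rewrite -ler_pdivrMr// => /(le_trans _) -> //.
by rewrite -normfV -normrM distrC mulrBl [h * l * _]mulrAC divff ?mul1r// mulrC.
Qed.

(** Subtracting the affine part leaves a function whose differential at [x] is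
    zero. *)
Lemma differentiable_of_affine (u : V -> R) (x : V) (g : 'I_n -> R) :
  (forall eps, 0 < eps -> exists2 d, 0 < d & forall v : V, `|v| < d ->
    `|u (x + v) - u x - \sum_i v ord0 i * g i| <= eps * `|v|) ->
  differentiable u x /\ forall i, partial i u x = g i.
Proof.
move=> H; split; last first.
  move=> i; apply: derive_limit => e e0.
  have e0' : 0 < e / (`|delta_mx ord0 i : V| + 1).
    by rewrite divr_gt0// ltr_wpDl.
  have [d d0 hd] := H _ e0'.
  exists (d / (`|delta_mx ord0 i : V| + 1)); first by rewrite divr_gt0// ltr_wpDl.
  move=> h h0; rewrite ltr_pdivlMr ?ltr_wpDl// => hlt.
  have := hd (h *: delta_mx ord0 i); rewrite normrZ.
  rewrite (bigD1 i)//= !mxE !eqxx mulr1 big1 ?addr0; last first.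
    by move=> j ji; rewrite !mxE eqxx (negbTE ji) mulr0 mul0r.
  move=> /(_ _)/le_trans; apply.
    by rewrite (le_lt_trans _ hlt)// ler_wpM2l// lerDl.
  rewrite mulrCA [leRHS]mulrC ler_wpM2l//.
  by rewrite mulrAC ler_pdivrMr ?ltr_wpDl// ler_wpM2l ?ltW// ltrDl.
pose h (y : V) := u y - \sum_i (y ord0 i - x ord0 i) * g i.
pose s (y : V) := \sum_i (y ord0 i - x ord0 i) * g i.
have ds : differentiable s x.
  rewrite (_ : s = \sum_i (fun y : V => (y ord0 i - x ord0 i) * g i)); last first.
    by apply/funext => y; rewrite fct_sumE.
  apply: differentiable_sum => i.
  apply: differentiableM; last exact: differentiable_cst.
  by apply: differentiableB; [exact: differentiable_coord|exact: differentiable_cst].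
rewrite (_ : u = h + s); last by apply/funext => y; rewrite /h /s/= subrK.
apply: differentiableD => //.
apply/diffP => /=.
apply: (@getPex _ (fun (df : {linear V -> R}) => continuous df /\
  forall y, h y = h (lim (nbhs x)) + df (y - lim (nbhs x))
                  +o_(y \near x) (y - lim (nbhs x)))).
exists [the {linear V -> R} of \0]; split; first by move=> y; exact: cst_continuous.
have E : h = cst (h x) +o_x (fun y => y - x).
  apply/eqaddoP => e e0.
  have [d d0 hd] := H e e0; apply/nbhs_ballP; exists d => //= y.
  rewrite -ball_normE /ball_/= distrC => xy; rewrite !fctE.
  have := hd (y - x) xy; rewrite subrKC.
  rewrite /h [in X in _ -> X](@big1 _ _ _ _ _ _ (fun i => (x ord0 i - x ord0 i) * _)); last first.
    by move=> i _; rewrite subrr mul0r.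
  rewrite (eq_bigr (fun i => (y ord0 i - x ord0 i) * g i)); last by move=> i _; rewrite !mxE.
  by rewrite subr0 [_ - _ - u x]addrAC.
rewrite lim_id//; apply: eqaddoEx => z.
by rewrite [LHS](congr1 (fun f => f z) E) fctE /= addr0.
Qed.

Lemma affine_of_differentiable (u : V -> R) (x : V) : differentiable u x ->
  forall eps, 0 < eps -> exists2 d, 0 < d & forall v : V, `|v| < d ->
    `|u (x + v) - u x - \sum_i v ord0 i * partial i u x| <= eps * `|v|.
Proof.
move=> du eps e0; have /diff_locally := du.
move=> /eqaddoP/(_ _ e0)/nbhs_ballP[d /= d0 hd]; exists d => // v vd.
have := hd v; rewrite -ball_normE /ball_/= sub0r normrN => /(_ vd).
rewrite !fctE -(deriveE _ du) derive_partial// /shift/= [v + x]addrC.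
by rewrite opprD addrA.
Qed.

Lemma measurable_deviation (I : finType) (D : set V) (g : I -> V -> R) (x : V) (eps : R) :
  measurable (D : set L) -> (forall i, measurable_fun (D : set L) (g i : L -> R)) ->
  measurable ([set y | D y /\ exists i, (eps < `|g i y - g i x|)%R] : set L).
Proof.
move=> mD mg.
rewrite (_ : [set y | _] = \bigcup_(i in [set: I]) (D `&` [set y | (eps < `|g i y - g i x|)%R])); last first.
  apply/seteqP; split => [y [Dy [i hi]]|y [i _ [Dy hi]]]; first by exists i.
  by split=> //; exists i.
apply: fin_bigcup_measurable; first exact: finite_finset.
move=> i _.
have m : measurable_fun (D : set L) ((fun y => `|g i y - g i x|) : L -> R).
  apply: measurableT_comp; first exact: normr_measurable.
  by apply: measurable_funB; [exact: mg|exact: measurable_cst].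
have := m mD _ (measurable_itv `]eps, +oo[).
by congr measurable; apply/seteqP; split => y [Dy] /=; rewrite in_itv/= andbT.
Qed.

Lemma lebesgue_union_le (I : Type) (s : seq I) (B : set V) (F : I -> set V) (c : R) :
  (forall i, (mu (B `&` F i) <= c%:E)%E) ->
  (mu (B `&` [set y | exists2 i, List.In i s & F i y]) <= (c *+ size s)%:E)%E.
Proof.
move=> h; elim: s => [|i s ih].
  rewrite (_ : B `&` _ = set0); first by rewrite measure0 mulr0n.
  by apply/seteqP; split => // y [_ [i []]].
apply: (@le_trans _ _ (mu (B `&` F i) + mu (B `&` [set y | exists2 i, List.In i s & F i y]))%E).
  apply: le_trans (outer_measureU2 _ _ _); apply: le_outer_measure.
  by move=> y [By [j [<-|js] Fj]]; [left|right; split => //; exists j].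
by rewrite /= mulrS EFinD; apply: leeD.
Qed.

Lemma approx_continuous_finite (I : finType) (D : set V) (g : I -> V -> R) (x : V) :
  (forall i, approx_continuous_at D (g i) x) ->
  forall eps eta : R, 0 < eps -> 0 < eta -> exists2 d, 0 < d &
    forall r, 0 < r -> r < d ->
      (mu (ball x r `&` [set y | D y /\ exists i, (eps < `|g i y - g i x|)%R])
         <= (eta * r ^+ n)%:E)%E.
Proof.
move=> hg eps eta e0 eta0.
have eta'0 : 0 < eta / (#|I|.+1%:R) by rewrite divr_gt0.
pose d i := s2val (cid2 (hg i eps _ e0 eta'0)).
have d0 i : 0 < d i by rewrite /d; case: cid2.
have dP i r : 0 < r -> r < d i -> (mu (ball x r `&` [set y | D y /\ (eps < `|g i y - g i x|)%R])
         <= (eta / (#|I|.+1%:R) * r ^+ n)%:E)%E.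
  by rewrite /d; case: cid2 => /= e _; apply.
exists (\big[Num.min/1]_(i : I) d i).
  by apply: lt_bigmin => // i _; exact: d0.
move=> r r0 rd.
have rdi i : r < d i by apply: (lt_le_trans rd); exact: bigmin_le.
have Hu := @lebesgue_union_le I (enum I) (ball x r)
  (fun i => [set y | D y /\ (eps < `|g i y - g i x|)%R]) _ (fun i => dP i r r0 (rdi i)).
apply: (le_trans _ (le_trans Hu _)); last first.
  rewrite lee_fin -cardE -[leLHS]mulr_natr.
  have ac (a b c e : R) : a * b * c * e = e * b * (a * c) by ring.
  rewrite ac.
  rewrite ler_piMl// ?mulr_ge0 ?exprn_ge0 ?(ltW r0) ?(ltW eta0)//.
  by rewrite ler_pdivrMr// mul1r ler_nat.
apply: le_outer_measure => y [By [Dy [i hi]]]; split => //; exists i => //.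
have : i \in enum I by rewrite mem_enum.
elim: (enum I) => //= j s ih; rewrite inE => /orP[/eqP->|/ih]; by [left|right].
Qed.

Lemma L2loc_bounded (Omega : set V) (f : V -> R) (C : R) : measurable (Omega : set L) ->
  measurable_fun (Omega : set L) (f : L -> R) -> (forall x, `|f x| <= C) -> L2loc Omega f.
Proof.
move=> mO mf fC; split=> // K cK KO.
have mK := compact_measurable_rV cK.
have mfK : measurable_fun (K : set L) (f : L -> R) by exact: (measurable_funS mO KO mf).
apply: (@measurable_bounded_integrable _ _ _ mu (fun x => f x ^+ 2) K mK).
- exact: compact_lebesgue_rV.
- by apply: (@measurable_funX _ L R K (f : L -> R) 2); exact: mfK.
- exists (C ^+ 2); split; first by rewrite realE sqr_ge0.
  move=> M CM x _ /=; apply: le_trans (ltW CM).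
  by rewrite normrX ler_sqr ?nnegrE//; exact: le_trans (fC x).
Qed.

Lemma W12loc_grad_lipschitz (Omega : set V) (u : V -> R) (K C : R) : open Omega ->
  (forall x y, `|u x - u y| <= K * `|x - y|) ->
  (forall x, `|u x| <= C) ->
  W12loc_grad Omega u (fun x => \row_i diffq_lim u i x).
Proof.
move=> oO uK uB; have mO := open_measurable_rV oO.
have cu : continuous u by exact: (lipschitz_continuous uK).
split; first by apply: L2loc_bounded uB => //; exact: continuousT_measurable_rV.
move=> i; rewrite (_ : (fun x => _) = diffq_lim u i); last by apply/funext => x; rewrite mxE.
split; last exact: (weak_partial_lipschitz uK).
apply: (L2loc_bounded _ _ (@diffq_lim_bound _ _ _ _ uK i)) => //.
exact: (measurable_funS measurableT (@subsetT _ _) (measurable_diffq_lim uK i)).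
Qed.

Lemma diffq_lim_partial (u : V -> R) (i : 'I_n) (x : V) : differentiable u x ->
  diffq_lim u i x = partial i u x.
Proof.
move=> du.
have cv : diffq u i ^~ x @ \oo --> partial i u x.
  apply/cvgrPdist_le => e e0; have E0 : 0 < `|delta_mx ord0 i : V| + 1 by rewrite ltr_wpDl.
  have [d d0 hd] := affine_of_differentiable du (divr_gt0 e0 E0).
  have dE : 0 < d / (`|delta_mx ord0 i : V| + 1) by rewrite divr_gt0.
  near=> k.
  have k0 : 0 < k.+1%:R^-1 :> R by [].
  have kd : k.+1%:R^-1 < d / (`|delta_mx ord0 i : V| + 1).
    by near: k; exact: (near_infty_natSinv_lt (PosNum dE)).
  have := hd (k.+1%:R^-1 *: delta_mx ord0 i); rewrite normrZ gtr0_norm// => H.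
  have lt : k.+1%:R^-1 * `|delta_mx ord0 i : V| < d.
    by move: kd; rewrite ltr_pdivlMr//; apply: le_lt_trans; rewrite ler_wpM2l// lerDl.
  have {H} := H lt.
  rewrite (bigD1 i)//= !mxE !eqxx mulr1 big1 ?addr0; last first.
    by move=> j ji; rewrite !mxE eqxx (negbTE ji) mulr0 mul0r.
  move=> H; rewrite distrC /diffq.
  have -> : k.+1%:R * (u (x + k.+1%:R^-1 *: delta_mx ord0 i) - u x) - partial i u x =
    k.+1%:R * (u (x + k.+1%:R^-1 *: delta_mx ord0 i) - u x - k.+1%:R^-1 * partial i u x).
    by rewrite [RHS]mulrBr mulVKf.
  rewrite normrM gtr0_norm// -ler_pdivlMl//.
  apply: (le_trans H); rewrite mulrCA ler_wpM2l// ?invr_ge0// mulrAC ler_pdivrMr//.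
  by rewrite ler_wpM2l ?(ltW e0)// lerDl.
rewrite /diffq_lim; case: asboolP => [_|[]]; last by apply/cvg_ex; exists (partial i u x).
exact: cvg_lim cv.
Unshelve. all: by end_near. Qed.

(** At a point where all the weak partial derivatives are approximately
    continuous, they are almost constant up to a set of small density, so the
    increment estimate applied to [v] and to [-v] shows that they form the
    differential. *)
Lemma rademacher (u : V -> R) (K : R) : (forall x y, `|u x - u y| <= K * `|x - y|) ->
  {ae mu, forall x, differentiable u x}.
Proof.
move=> uK.
have cu : continuous u by exact: (lipschitz_continuous uK).
have K0 : 0 <= `|K| by [].
have uK' x y : `|u x - u y| <= `|K| * `|x - y|.
  by apply: (le_trans (uK x y)); rewrite ler_wpM2r// ler_norm.
have hG i : {ae mu, forall x, setT x -> approx_continuous_at setT (diffq_lim u i) x}.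
  by apply: ae_approx_continuous => //; exact: (measurable_diffq_lim uK).
apply: ae_mono (ae_countable hG) => x gx.
suff H eps : 0 < eps -> exists2 d, 0 < d & forall v : V, `|v| < d ->
    `|u (x + v) - u x - \sum_i v ord0 i * diffq_lim u i x| <= eps * `|v|.
  by have [] := differentiable_of_affine H.
move=> e0.
(* on the exceptional set the partial derivatives are only known to be bounded by these numbers *)
pose M := \sum_i `|K| * `|delta_mx ord0 i : V|.
have M0 : 0 <= M by apply: sumr_ge0 => i _; rewrite mulr_ge0.
have [eta eta0 hasy] := @increment_asymptotic R n (eps / 2) `|K| (2 * M) ltac:(lra) K0 ltac:(lra).
have e20 : 0 < eps / 2 / n.+1%:R by rewrite !divr_gt0.
have [d d0 hd] := approx_continuous_finite (fun i => gx i I) e20 eta0.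
exists (d / 8) => [|v vd]; first by rewrite divr_gt0.
have [->|vn0] := eqVneq v 0.
  by rewrite addr0 subrr normr0 mulr0 big1 ?subrr ?normr0// => i _; rewrite mxE mul0r.
set t := `|v|; have t0 : 0 < t by rewrite normr_gt0.
set G := fun x => \row_i diffq_lim u i x.
set Bad := [set y | setT y /\ exists i, (eps / 2 / n.+1%:R < `|diffq_lim u i y - diffq_lim u i x|)%R].
have mBad : measurable (Bad : set L).
  by apply: measurable_deviation => // i; exact: (measurable_diffq_lim uK).
have main z (w : V) : `|z - x| <= t -> `|w| = t ->
    u (z + w) - u z <= \sum_i w ord0 i * diffq_lim u i x + eps * t.
  move=> zx wt.
  have := hasy setT u G x z w (4 * t) t
    (\sum_i w ord0 i * diffq_lim u i x + eps / 2 * t) Bad openT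
    (continuous_subspaceT cu) _ (@subsetT _ _) t0 (lexx _) zx _ mBad.
  rewrite wt => /(_ _ (lexx _) _ _ (fun y y' _ _ => uK' y y')) H.
  apply: le_trans (H _ _ _) _.
  - move=> i; rewrite (_ : (fun x => _) = diffq_lim u i); last by apply/funext => y; rewrite mxE.
    split; last by apply: (weak_partial_lipschitz uK); exact: openT.
    apply: (L2loc_bounded _ _ (@diffq_lim_bound _ _ _ _ uK i)) => //.
    exact: (measurable_diffq_lim uK i).
  - apply: hd; first by rewrite mulr_gt0.
    by rewrite -ltr_pdivlMl// mulrC.
  - apply: aeW => y _.
    have wi i : `|w ord0 i| <= t.
      by rewrite -wt; have [h _] := @rV_norm_le _ _ w _ (normr_ge0 w); exact: h.
    have [By|nBy] := pselect (Bad y).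
      rewrite indicE mem_set// mulr1 -addrA -lerBlDl -sumrB.
      apply: (@le_trans _ _ (2 * M * t)); last by rewrite lerDr mulr_ge0 ?(ltW t0)// divr_ge0// ltW.
      rewrite mulr_sumr mulr_suml; apply: ler_sum => i _; rewrite mxE -mulrBr.
      apply: (le_trans (ler_norm _)); rewrite normrM mulrC; apply: ler_pM => //.
      apply: (le_trans (ler_normB _ _)).
      have h z0 := @diffq_lim_bound _ _ _ _ uK' i z0.
      by have := h x; have := h y; lra.
    rewrite indicE memNset// mulr0 addr0 -lerBlDl -sumrB.
    apply: (@le_trans _ _ (\sum_(i < n) (eps / 2 / n.+1%:R * t))).
      apply: ler_sum => i _; rewrite mxE -mulrBr.
      apply: (le_trans (ler_norm _)); rewrite normrM mulrC; apply: ler_pM => //.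
      by rewrite leNgt; apply/negP => h; apply: nBy; split => //; exists i.
    rewrite sumr_const card_ord -mulrnAl ler_wpM2r ?(ltW t0)//.
    rewrite -[leLHS]mulr_natr mulrAC ler_pdivrMr// ler_wpM2l ?ler_nat// ltW//; lra.
  - by lra.
rewrite ler_norml; apply/andP; split; last first.
  by rewrite lerBlDl; apply: main => //; rewrite subrr normr0 ltW.
have := main (x + v) (- v); rewrite addrC addKr normrN => /(_ (lexx _) erefl).
rewrite addrK (eq_bigr (fun i => - (v ord0 i * diffq_lim u i x))); last first.
  by move=> i _; rewrite mxE mulNr.
by rewrite sumrN; lra.
Qed.

End rademacher.

(** * Quadratic forms *)

Section quadratic_form.
Variables (R : realType) (n : nat).
Local Notation V := 'rV[R]_n.
Implicit Types (M : 'M[R]_n) (xi eta v w : V).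

Definition dot v w : R := \sum_i v ord0 i * w ord0 i.

Lemma dotC v w : dot v w = dot w v.
Proof. by apply: eq_bigr => i _; rewrite mulrC. Qed.

Lemma dotDl v v' w : dot (v + v') w = dot v w + dot v' w.
Proof. by rewrite /dot -big_split; apply: eq_bigr => i _; rewrite mxE mulrDl. Qed.

Lemma dotZl a v w : dot (a *: v) w = a * dot v w.
Proof. by rewrite /dot mulr_sumr; apply: eq_bigr => i _; rewrite mxE mulrA. Qed.

Lemma dotNl v w : dot (- v) w = - dot v w.
Proof. by rewrite -scaleN1r dotZl mulN1r. Qed.

Lemma dotDr v w w' : dot v (w + w') = dot v w + dot v w'.
Proof. by rewrite dotC dotDl ![dot _ v]dotC. Qed.

Lemma dotZr a v w : dot v (a *: w) = a * dot v w.
Proof. by rewrite dotC dotZl dotC. Qed.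

Lemma dot_delta v i : dot v (delta_mx ord0 i) = v ord0 i.
Proof.
rewrite /dot (bigD1 i)//= !mxE !eqxx mulr1 big1 ?addr0// => j ji.
by rewrite mxE eqxx (negbTE ji) mulr0.
Qed.

Lemma coord_le_norm v i : `|v ord0 i| <= `|v|.
Proof. by have [h _] := rV_norm_le v (normr_ge0 v); exact: h. Qed.

Lemma dot_le v w : `|dot v w| <= (\sum_i `|v ord0 i|) * `|w|.
Proof.
rewrite mulr_suml; apply: (le_trans (ler_norm_sum _ _ _)).
by apply: ler_sum => i _; rewrite normrM ler_wpM2l// coord_le_norm.
Qed.

Lemma sqr_enorm v : enorm v ^+ 2 = \sum_i v ord0 i ^+ 2.
Proof. by rewrite /enorm sqr_sqrtr// sumr_ge0// => i _; exact: sqr_ge0. Qed.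

Lemma enorm_ge0 v : 0 <= enorm v. Proof. exact: sqrtr_ge0. Qed.

Lemma coord_le_enorm v i : `|v ord0 i| <= enorm v.
Proof.
rewrite -ler_sqr ?nnegrE ?enorm_ge0// sqr_enorm real_normK ?num_real//.
by rewrite (bigD1 i)//= lerDl sumr_ge0// => j _; exact: sqr_ge0.
Qed.

Lemma norm_le_enorm v : `|v| <= enorm v.
Proof. by apply/rV_norm_le; [exact: enorm_ge0|exact: coord_le_enorm]. Qed.

Lemma enorm_le v : enorm v <= n%:R * `|v|.
Proof.
rewrite -ler_sqr ?nnegrE ?enorm_ge0 ?mulr_ge0// sqr_enorm.
apply: (@le_trans _ _ (\sum_(i < n) `|v| ^+ 2)).
  apply: ler_sum => i _; rewrite -[leLHS]real_normK ?num_real//.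
  by rewrite ler_sqr ?nnegrE// coord_le_norm.
rewrite sumr_const card_ord exprMn -[leLHS]mulr_natl ler_wpM2r ?sqr_ge0//.
have nn : (n <= n ^ 2)%N by rewrite -mulnn; case: (posnP n) => [->|/leq_pmulr ->].
by rewrite -natrX ler_nat.
Qed.

Lemma enormZ a v : enorm (a *: v) = `|a| * enorm v.
Proof.
rewrite /enorm -sqrtr_sqr -sqrtrM ?sqr_ge0// mulr_sumr; congr Num.sqrt.
by apply: eq_bigr => i _; rewrite mxE exprMn.
Qed.

Lemma enorm_delta i : enorm (delta_mx ord0 i : V) = 1.
Proof.
rewrite /enorm (bigD1 i)//= !mxE !eqxx expr1n big1 ?addr0 ?sqrtr1// => j ji.
by rewrite mxE eqxx (negbTE ji) expr0n.
Qed.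

Lemma enorm_gt0 v : v != 0 -> 0 < enorm v.
Proof. by move=> v0; apply: lt_le_trans (norm_le_enorm v); rewrite normr_gt0. Qed.

(** Only the symmetric part of the matrix matters for its quadratic form. *)
Definition sym_apply M xi : V := \row_j \sum_i xi ord0 i * ((M i j + M j i) / 2).

Lemma sym_applyC M xi eta : dot eta (sym_apply M xi) = dot xi (sym_apply M eta).
Proof.
rewrite /dot; under eq_bigr do rewrite mxE mulr_sumr.
rewrite exchange_big; apply: eq_bigr => i _ /=; rewrite mxE mulr_sumr.
by apply: eq_bigr => j _; rewrite mulrCA [M j i + _]addrC.
Qed.

Lemma sym_applyD M xi eta : sym_apply M (xi + eta) = sym_apply M xi + sym_apply M eta.
Proof.
apply/rowP => j; rewrite !mxE -big_split; apply: eq_bigr => i _.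
by rewrite mxE mulrDl.
Qed.

Lemma sym_applyZ M a xi : sym_apply M (a *: xi) = a *: sym_apply M xi.
Proof.
apply/rowP => j; rewrite !mxE mulr_sumr; apply: eq_bigr => i _.
by rewrite mxE -[LHS]mulrA.
Qed.

Lemma qformE M xi : qform M xi = dot xi (sym_apply M xi).
Proof.
have H1 : qform M xi = \sum_i \sum_j xi ord0 i * M j i * xi ord0 j.
  rewrite /qform exchange_big; apply: eq_bigr => i _; apply: eq_bigr => j _.
  by rewrite [RHS]mulrAC mulrC mulrA.
have : qform M xi = (qform M xi + \sum_i \sum_j xi ord0 i * M j i * xi ord0 j) / 2.
  by rewrite -H1; field.
move=> ->; rewrite /qform /dot -big_split mulr_suml /=; apply: eq_bigr => i _.
rewrite -big_split mulr_suml mxE mulr_sumr /=; apply: eq_bigr => j _.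
by ring.
Qed.

Lemma qformD M xi eta :
  qform M (xi + eta) = qform M xi + 2 * dot eta (sym_apply M xi) + qform M eta.
Proof.
rewrite !qformE sym_applyD dotDr !dotDl [dot xi (sym_apply M eta)]sym_applyC.
by ring.
Qed.

Lemma qformZ M a xi : qform M (a *: xi) = a ^+ 2 * qform M xi.
Proof. by rewrite !qformE sym_applyZ dotZl dotZr mulrA expr2. Qed.

Lemma qform0 M : qform M 0 = 0.
Proof. by rewrite -(scale0r 0) qformZ expr0n mul0r. Qed.

(** The discriminant of the nonnegative polynomial [s |-> qform M (s *: xi +
    eta)]. *)
Lemma qform_cauchy_schwarz M xi eta : (forall zeta, 0 <= qform M zeta) ->
  dot eta (sym_apply M xi) ^+ 2 <= qform M xi * qform M eta.
Proof.
move=> M0; set b := dot _ _; have hs s : 0 <= qform M xi * s ^+ 2 + 2 * s * b + qform M eta.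
  have := M0 (s *: xi + eta).
  by rewrite qformD qformZ sym_applyZ dotZr -/b; congr (0 <= _); ring.
have [h0|h0] := eqVneq (qform M xi) 0.
  have [->|b0] := eqVneq b 0; first by rewrite h0 expr0n mul0r.
  have := hs (- (qform M eta + 1) / (2 * b)); rewrite h0 mul0r add0r.
  rewrite (_ : 2 * _ * b = - (qform M eta + 1)); last by field.
  by lra.
have {}h0 : 0 < qform M xi by rewrite lt_def h0 M0.
have := hs (- b / qform M xi).
rewrite (_ : _ + _ = qform M eta - b ^+ 2 / qform M xi); last by field; rewrite gt_eqF.
by rewrite subr_ge0 ler_pdivrMr// mulrC.
Qed.

(** Used with [xi] the gradient of an admissible function, whose entries are
    bounded by ellipticity. *)
Lemma qform_perturb M M' (eps C : R) xi : 0 <= eps ->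
  (forall i j, `|M i j - M' i j| <= eps) -> (forall i, `|xi ord0 i| <= C) ->
  qform M xi <= qform M' xi + n%:R ^+ 2 * (eps * C ^+ 2).
Proof.
move=> e0 hM hxi; rewrite -lerBlDl /qform -sumrB.
apply: (@le_trans _ _ (\sum_(i < n) \sum_(j < n) eps * C ^+ 2)); last first.
  by rewrite !sumr_const card_ord -mulrnA -[leLHS]mulr_natl natrM expr2.
apply: ler_sum => i _; rewrite -sumrB; apply: ler_sum => j _.
rewrite -mulrBl -mulrBr; apply: (le_trans (ler_norm _)).
rewrite !normrM mulrAC mulrC expr2 [_ * `|xi ord0 j|]mulrC.
by rewrite ler_pM ?mulr_ge0// ler_pM.
Qed.

End quadratic_form.

(** * Upper bound for the intrinsic distance *)

Section intrinsic_upper.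
Variables (R : realType) (n : nat).
Local Notation V := 'rV[R]_n.
Local Notation L := (lebesgue_rV_type R n).
Local Notation mu := (@lebesgue_rV R n).
Variables (Omega : set V) (A : V -> 'M[R]_n).
Hypothesis oO : open Omega.

Definition elliptic_on (S : set V) (Lam : R) := {ae mu, forall y, S y -> forall xi : V,
  Lam^-1 * enorm xi ^+ 2 <= qform (A y) xi <= Lam * enorm xi ^+ 2}.

Lemma elliptic_on_compact (K : set V) : elliptic_class Omega A -> compact K -> K `<=` Omega ->
  exists2 Lam, 1 <= Lam & elliptic_on K Lam.
Proof.
move=> [_ [lam [clam lam1 hlam]]] cK KO.
have [C C0 hC] := bounded_on_compact cK (continuous_subspaceW KO clam).
exists (C + 1); first by lra.
apply: ae_mono hlam => y hy Ky xi; have /andP[h1 h2] := hy (KO _ Ky) xi.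
have l1 := lam1 _ (KO _ Ky); have lC : lam y <= C + 1.
  by have := hC _ Ky; have := ler_norm (lam y); lra.
apply/andP; split.
  apply: le_trans h1; rewrite ler_wpM2r ?sqr_ge0// lef_pV2 ?posrE//; lra.
by apply: (le_trans h2); rewrite ler_wpM2r ?sqr_ge0.
Qed.

Lemma closed_cube_sub (x : V) : Omega x -> exists2 rho, 0 < rho & closed_cube x rho `<=` Omega.
Proof.
move=> Ox; have /nbhs_ballP[r /= r0 hr] := open_nbhs_nbhs (conj oO Ox).
exists (r / 2); first by lra.
move=> y; rewrite /closed_cube /= => h; apply: hr; rewrite -ball_normE /ball_/= distrC.
by lra.
Qed.

(** As [1 <= Lam], the bound [enorm g ^+ 2 <= Lam] may be weakened to [Lam ^+
    2], which avoids a square root. *)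
Lemma gradient_bound (M : 'M[R]_n) (Lam : R) (g : V) : 1 <= Lam ->
  Lam^-1 * enorm g ^+ 2 <= qform M g -> qform M g <= 1 -> forall i, `|g ord0 i| <= Lam.
Proof.
move=> L1 h1 h2 i; apply: le_trans (coord_le_enorm g i) _.
have L0 : 0 < Lam by lra.
rewrite -ler_sqr ?nnegrE ?enorm_ge0 ?(ltW L0)//.
have : Lam^-1 * enorm g ^+ 2 <= 1 by lra.
rewrite ler_pdivrMl// mulr1 => /le_trans; apply.
by rewrite expr2 ler_peMl// ltW.
Qed.

(** Ellipticity turns admissibility into a bound on the gradient that depends
    on [Lam] only; this uniformity over the competitors [w] lets an estimate of
    their increments bound the intrinsic distance. The larger cube leaves room
    for the mollification along the segment from [y] to [y']. *)
Lemma admissible_increment (w : V -> R) (G : V -> V) (c : V) (rho Lam : R) : 1 <= Lam ->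
  closed_cube c (8 * rho) `<=` Omega -> elliptic_on (closed_cube c (8 * rho)) Lam ->
  {within Omega, continuous w} -> W12loc_grad Omega w G ->
  {ae mu, forall z, Omega z -> qform (A z) (G z) <= 1} ->
  forall y y', closed_cube c rho y -> closed_cube c rho y' ->
    `|w y - w y'| <= n%:R * Lam * `|y - y'|.
Proof.
move=> L1 KO hA cw [_ HG] hG.
have main y y' : closed_cube c rho y -> closed_cube c rho y' ->
    w y' - w y <= n%:R * Lam * `|y - y'|.
  move=> hy hy'; have [->|yy'] := eqVneq y y'; first by rewrite !subrr normr0 mulr0.
  rewrite -[in w y'](subrKC y y').
  have yy0 : 0 < `|y - y'| by rewrite normr_gt0 subr_eq0.
  have yyr : `|y - y'| <= 2 * rho.
    have -> : y - y' = (y - c) - (y' - c) by rewrite opprB addrA subrK.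
    by move: hy hy'; rewrite /closed_cube/= => h h'; apply: (le_trans (ler_normB _ _)); lra.
  apply: (@bounded_gradient_increment R n Omega w G c y (y' - y) (8 * rho)) => //.
    by rewrite [`|y' - y|]distrC; move: hy; rewrite /closed_cube/=; lra.
  apply: ae_mono (ae_and hA hG) => z [h1 h2] zc.
  have Oz := KO _ zc; have /andP[h3 _] := h1 zc (G z); have h4 := gradient_bound L1 h3 (h2 Oz).
  apply: (@le_trans _ _ (\sum_(i < n) `|y - y'| * Lam)).
    apply: ler_sum => i _; apply: (le_trans (ler_norm _)); rewrite normrM ler_pM//.
    by rewrite distrC coord_le_norm.
  by rewrite sumr_const card_ord -[leLHS]mulr_natl mulrCA mulrC.
move=> y y' hy hy'; rewrite ler_norml; apply/andP; split.
  by have := main _ _ hy hy'; lra.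
by rewrite distrC; exact: main.
Qed.

(** Moving from [x] in the direction dual to [xi] is cheap: by the Cauchy-Schwarz
    inequality for the quadratic form of [A x], an admissible gradient has a small
    component along that direction wherever [A] is close to [A x], and the points
    where it is not close form a set of density zero at [x]. *)
Lemma intrinsic_dist_le (x xi : V) (e : R) : elliptic_class Omega A -> Omega x ->
  (forall zeta, 0 <= qform (A x) zeta) ->
  (forall i j, approx_continuous_at Omega (fun y => A y i j) x) -> 0 < e ->
  exists2 d, 0 < d & forall t, 0 < t -> t < d ->
    (intrinsic_dist Omega A x (x + t *: sym_apply (A x) xi)
       <= (t * (Num.sqrt (qform (A x) xi) + e))%:E)%E.
Proof.
move=> hA Ox A0 Aac e0; have [rho1 rho10 KO1] := closed_cube_sub Ox.
have [Lam L1 hLam] := elliptic_on_compact hA (@compact_closed_cube _ _ x rho1) KO1.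
pose rho := rho1 / 8; have rho0 : 0 < rho by rewrite divr_gt0.
have E1 : rho1 = 8 * rho by rewrite /rho mulrC divfK.
rewrite {}E1 in KO1 hLam rho10.
have KO : closed_cube x rho `<=` Omega.
  by move=> y hy; apply: KO1; move: hy; rewrite /closed_cube/=; lra.
set b := sym_apply _ _; set h := qform (A x) xi; have h0 : 0 <= h by exact: A0.
pose B := `|b| + 1; have B0 : 0 < B by rewrite ltr_wpDl.
pose C := n%:R * Lam; have C0 : 0 <= C by rewrite mulr_ge0//; lra.
have eB : 0 < e / 2 / B by rewrite !divr_gt0.
have [eta eta0 hasy] := @increment_asymptotic R n (e / 2 / B) (n%:R * Lam) C eB C0 C0.
(* tolerance on the entries of [A] for which the Cauchy-Schwarz bound loses at most [e / 2] *)
have [eps eps0 heps] : exists2 eps, 0 < eps &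
    h * (1 + n%:R ^+ 2 * (eps * Lam ^+ 2)) <= (Num.sqrt h + e / 2) ^+ 2.
  have D0 : 0 < h * (n%:R ^+ 2 * Lam ^+ 2) + 1.
    by rewrite ltr_wpDl// !mulr_ge0// ?exprn_ge0//; lra.
  exists ((e / 2) ^+ 2 / (h * (n%:R ^+ 2 * Lam ^+ 2) + 1)); first by rewrite divr_gt0// exprn_gt0//; lra.
  set D := h * _ + 1; set q := (e / 2) ^+ 2.
  have q0 : 0 <= q by exact: sqr_ge0.
  rewrite sqrrD sqr_sqrtr// mulrDr mulr1 -addrA lerD2l.
  rewrite (_ : _ * _ = q * ((h * (n%:R ^+ 2 * Lam ^+ 2)) / D)); last by ring.
  apply: (@le_trans _ _ q); last by rewrite lerDr mulrn_wge0// mulr_ge0 ?sqrtr_ge0// divr_ge0// ltW.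
  by rewrite ler_piMr// ler_pdivrMr// mul1r /D lerDl.
have [d d0 hd] := approx_continuous_finite (fun ij : 'I_n * 'I_n => Aac ij.1 ij.2) eps0 eta0.
set Bad := [set y | Omega y /\ exists ij : 'I_n * 'I_n, (eps < `|A y ij.1 ij.2 - A x ij.1 ij.2|)%R].
have mBad : measurable (Bad : set L).
  apply: (@measurable_deviation R n ('I_n * 'I_n)%type Omega (fun ij y => A y ij.1 ij.2)).
    exact: open_measurable_rV.
  by move=> ij; have [mA _] := hA; exact: mA.
exists (Num.min (d / 8 / B) (rho / 4 / B)); first by rewrite lt_min; apply/andP; split; do 2 (apply: divr_gt0 => //).
move=> t t0; rewrite lt_min => /andP[td trho].
apply: ge_ereal_sup => _ [w [cw [G [WG hG]]] <-]; rewrite lee_fin.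
have lipw := admissible_increment L1 KO1 hLam cw WG hG.
have tB0 : 0 < t * B by rewrite mulr_gt0.
have ntb : `|t *: b| <= t * B by rewrite normrZ gtr0_norm// ler_wpM2l ?(ltW t0)// lerDl.
have := hasy Omega w G x (x + t *: b) (- (t *: b)) rho (t * B)
  (t * (Num.sqrt h + e / 2)) Bad oO cw (proj2 WG) KO tB0.
rewrite addrK => H.
have -> : t * (Num.sqrt h + e) = t * (Num.sqrt h + e / 2) + e / 2 / B * (t * B).
  by field; rewrite gt_eqF.
apply: H => //.
- by move: trho; rewrite ltr_pdivlMr//; lra.
- by rewrite addrAC subrr add0r.
- by rewrite normrN.
- apply: hd; first by rewrite mulr_gt0.
  by move: td; rewrite ltr_pdivlMr//; lra.
apply: ae_mono (ae_and hLam hG) => y [h1 h2] hy.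
have Oy := KO _ hy.
have y8 : closed_cube x (8 * rho) y by move: hy; rewrite /closed_cube/=; lra.
have /andP[h3 _] := h1 y8 (G y); have h4 := gradient_bound L1 h3 (h2 Oy).
rewrite -/(dot (- (t *: b)) (G y)) dotNl dotZl.
have [By|nBy] := pselect (Bad y).
  rewrite indicE mem_set// mulr1.
  apply: (@le_trans _ _ (C * (t * B))); last first.
    by rewrite lerDr mulr_ge0 ?(ltW t0)// addr_ge0 ?sqrtr_ge0//; lra.
  rewrite -mulrN mulrCA ler_wpM2l ?(ltW t0)//.
  apply: (le_trans (ler_norm _)); rewrite normrN dotC; apply: (le_trans (dot_le _ _)).
  apply: ler_pM => //; [exact: sumr_ge0| |by rewrite lerDl].
  apply: (@le_trans _ _ (\sum_(i < n) Lam)); first exact: ler_sum.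
  by rewrite sumr_const card_ord -[leLHS]mulr_natl.
rewrite indicE memNset// mulr0 addr0 -mulrN ler_wpM2l ?(ltW t0)//.
apply: (le_trans (ler_norm _)); rewrite normrN.
have s0 : 0 <= Num.sqrt h + e / 2 by rewrite addr_ge0 ?sqrtr_ge0//; lra.
rewrite -ler_sqr ?nnegrE// real_normK ?num_real//; apply: le_trans heps.
rewrite dotC; apply: (le_trans (qform_cauchy_schwarz _ _ A0)); rewrite ler_wpM2l//.
apply: (@le_trans _ _ (qform (A y) (G y) + n%:R ^+ 2 * (eps * Lam ^+ 2))).
  apply: qform_perturb => //; first exact: ltW.
  move=> i j; rewrite distrC leNgt; apply/negP => hij; apply: nBy; split => //.
  by exists (i, j).
by rewrite lerD2r h2.
Qed.

End intrinsic_upper.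

(** * Pyramids and the lower bound for the intrinsic distance *)

Section intrinsic_lower.
Variables (R : realType) (n : nat).
Local Notation V := 'rV[R]_n.
Local Notation L := (lebesgue_rV_type R n).
Local Notation mu := (@lebesgue_rV R n).

Lemma small_form_eq0 (b : V) :
  (forall eps, 0 < eps -> exists2 d, 0 < d & forall v : V, `|v| < d ->
    dot b v <= eps * `|v|) -> b = 0.
Proof.
move=> H; apply/eqP/negPn/negP => b0.
have eb0 : 0 < enorm b ^+ 2 by rewrite exprn_gt0// enorm_gt0.
have nb0 : 0 < `|b| by rewrite normr_gt0.
have [d d0 hd] := H (enorm b ^+ 2 / 2 / `|b|) ltac:(by rewrite !divr_gt0).
have s0 : 0 < d / 2 / `|b| by rewrite !divr_gt0.
have := hd ((d / 2 / `|b|) *: b); rewrite normrZ gtr0_norm// divfK ?gt_eqF//.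
have -> : dot b ((d / 2 / `|b|) *: b) = d / 2 / `|b| * enorm b ^+ 2.
  by rewrite dotZr sqr_enorm /dot; congr (_ * _); apply: eq_bigr => i _; rewrite expr2.
have -> : enorm b ^+ 2 / 2 / `|b| * (d / 2) = d / 2 / `|b| * (enorm b ^+ 2 / 2) by ring.
have := eb0; set E := enorm b ^+ 2 => E0 /(_ ltac:(lra)); rewrite ler_pM2l//; lra.
Qed.

Lemma dot_grad (w : V -> R) (z v : V) : dot (grad w z) v = \sum_i v ord0 i * partial i w z.
Proof. by apply: eq_bigr => i _; rewrite mxE mulrC. Qed.

(** A linear form that dominates the increments of [w] from above dominates the
    differential, hence coincides with it. *)
Lemma grad_touching_above (w : V -> R) (z a : V) (r : R) : differentiable w z -> 0 < r ->
  (forall v : V, `|v| < r -> w (z + v) - w z <= dot a v) -> grad w z = a.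
Proof.
move=> dw r0 ha; apply/eqP; rewrite -subr_eq0; apply/eqP/small_form_eq0 => eps e0.
have [d d0 hd] := affine_of_differentiable dw e0.
exists (Num.min d r) => [|v]; first by rewrite lt_min d0.
rewrite lt_min => /andP[/hd h1 /ha h2]; rewrite dotDl dotNl dot_grad.
by have := ler_norml (w (z + v) - w z - \sum_i v ord0 i * partial i w z) (eps * `|v|);
  rewrite h1 => /esym/andP[]; lra.
Qed.

Lemma grad_min (w : V -> R) (z : V) : differentiable w z ->
  (forall v : V, w z <= w (z + v)) -> grad w z = 0.
Proof.
move=> dw hz; rewrite -[LHS]opprK; apply/eqP; rewrite oppr_eq0; apply/eqP/small_form_eq0 => eps e0.
have [d d0 hd] := affine_of_differentiable dw e0.
exists d => // v /hd h1; rewrite dotNl dot_grad; have := hz v.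
by have := ler_norml (w (z + v) - w z - \sum_i v ord0 i * partial i w z) (eps * `|v|);
  rewrite h1 => /esym/andP[]; lra.
Qed.

Lemma norm_attained (v : V) : v != 0 -> exists i, `|v| = `|v ord0 i|.
Proof.
move=> v0; apply: contrapT => /forallNP H; have : `|v| < `|v| => [|]; last by rewrite ltxx.
apply/rV_norm_lt; rewrite ?normr_gt0// => i.
by rewrite lt_neqAle coord_le_norm andbT; apply/eqP => h; exact: (H i).
Qed.

(** A polyhedral norm, whose unit ball is cut out by the covectors [q] and
    [c * e_i]. *)
Definition pyramid_norm (q : V) (c : R) (v : V) := Num.max `|dot q v| (c * `|v|).

Section pyramid.
Variables (q : V) (c : R).
Hypothesis c0 : 0 < c.
Local Notation N := (pyramid_norm q c).

Let K := \sum_i `|q ord0 i| + c.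

Lemma pyramid_norm_le v : N v <= K * `|v|.
Proof.
rewrite /N ge_max /K mulrDl; apply/andP; split; last by rewrite lerDr mulr_ge0// sumr_ge0.
by apply: (le_trans (dot_le _ _)); rewrite lerDl mulr_ge0// ltW.
Qed.

Lemma pyramid_normD v v' : N (v + v') <= N v + N v'.
Proof.
rewrite /N ge_max; apply/andP; split.
  by rewrite dotDr (le_trans (ler_normD _ _))// lerD// le_max lexx.
apply: (@le_trans _ _ (c * `|v| + c * `|v'|)).
  by rewrite -mulrDr ler_wpM2l ?(ltW c0)// ler_normD.
by rewrite lerD// le_max lexx orbT.
Qed.

Lemma pyramid_norm_ge0 v : 0 <= N v.
Proof. by rewrite /N le_max normr_ge0. Qed.

(** A maximum of finitely many linear forms is attained by one of them, which
    then touches the norm from below at [v]. *)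
Lemma pyramid_norm_support v : exists2 a, N v = dot a v &
  (forall v', dot a v' <= N v') /\
  (exists e : bool, a = (-1) ^+ e *: q \/ exists i, a = (-1) ^+ e *: (c *: delta_mx ord0 i)).
Proof.
have hq v' (e : bool) : dot ((-1) ^+ e *: q) v' <= N v'.
  rewrite /N le_max dotZl; apply/orP; left; apply: (le_trans (ler_norm _)).
  by rewrite normrM normrX normrN1 expr1n mul1r.
have hc v' (e : bool) i : dot ((-1) ^+ e *: (c *: delta_mx ord0 i)) v' <= N v'.
  rewrite /N le_max !dotZl; apply/orP; right; apply: (le_trans (ler_norm _)).
  rewrite normrM normrX normrN1 expr1n mul1r normrM gtr0_norm// ler_wpM2l ?(ltW c0)//.
  by rewrite dotC dot_delta coord_le_norm.
have [h|h] := lerP (c * `|v|) `|dot q v|.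
  exists ((-1) ^+ (dot q v < 0)%R *: q); last by split => [v'|]; [exact: hq|exists (dot q v < 0)%R; left].
  by rewrite /pyramid_norm (max_idPl h) dotZl -normrEsign.
have v0 : v != 0.
  by apply/eqP => v0; move: h; rewrite v0 normr0 mulr0 ltNge normr_ge0.
have [i vi] := norm_attained v0.
exists ((-1) ^+ (v ord0 i < 0)%R *: (c *: delta_mx ord0 i)).
  rewrite /pyramid_norm (max_idPr (ltW h)) !dotZl dotC dot_delta vi [in LHS]normrEsign.
  by rewrite mulrCA.
by split => [v'|]; [exact: hc|exists (v ord0 i < 0)%R; right; exists i].
Qed.

Variables (x : V) (r : R).
Hypothesis r0 : 0 < r.
Definition pyramid (z : V) := Num.max 0 (r - N (z - x)).

Lemma pyramid_lipschitz y y' : `|pyramid y - pyramid y'| <= K * `|y - y'|.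
Proof.
have main z z' : pyramid z - pyramid z' <= K * `|z - z'|.
  rewrite lerBlDl /pyramid ge_max; apply/andP; split.
    rewrite addr_ge0// ?le_max ?lexx// mulr_ge0//.
    by rewrite /K addr_ge0 ?sumr_ge0// ltW.
  have h1 : N (z' - x) <= N (z - x) + K * `|z - z'|.
    rewrite [`|z - z'|]distrC.
    have -> : z' - x = (z - x) + (z' - z) by rewrite [RHS]addrC addrA subrK.
    by apply: (le_trans (pyramid_normD _ _)); rewrite lerD2l pyramid_norm_le.
  have : r - N (z' - x) <= Num.max 0 (r - N (z' - x)) by rewrite le_max lexx orbT.
  by lra.
rewrite ler_norml; apply/andP; split; last exact: main.
by have := main y' y; rewrite distrC; lra.
Qed.

Lemma pyramid_bound z : `|pyramid z| <= r.
Proof.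
rewrite ger0_norm; last by rewrite le_max lexx.
by rewrite ge_max (ltW r0)/= gerBl pyramid_norm_ge0.
Qed.

(** Where the pyramid is positive, the linear form attaining the norm touches
    it from above; where it is zero, it has a minimum. *)
Lemma pyramid_grad z : differentiable pyramid z ->
  grad pyramid z = 0 \/ c * `|z - x| < r /\
  (exists e : bool, grad pyramid z = (-1) ^+ e *: q \/
     exists i, grad pyramid z = (-1) ^+ e *: (c *: delta_mx ord0 i)).
Proof.
move=> dp; have [h|h] := lerP (r - N (z - x)) 0.
  left; apply: grad_min => // v; rewrite {1}/pyramid (max_idPl h).
  by rewrite /pyramid le_max lexx.
right; split.
  have : c * `|z - x| <= N (z - x) by rewrite le_max lexx orbT.
  by lra.
have [a aE [aN ha]] := pyramid_norm_support (z - x).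
suff -> : grad pyramid z = - a.
  case: ha => e [->|[i ->]]; exists (~~ e); [left|right; exists i];
  by rewrite -scaleNr; case: e; rewrite ?expr0 ?expr1 ?opprK.
have S0 : 0 < \sum_i `|a ord0 i| + 1 by rewrite ltr_wpDl// sumr_ge0.
apply: (@grad_touching_above _ _ _ ((r - N (z - x)) / (\sum_i `|a ord0 i| + 1))) => //.
  by rewrite divr_gt0.
move=> v; rewrite ltr_pdivlMr// => vs; rewrite lerBlDr dotNl.
have -> : pyramid z = r - N (z - x) by rewrite /pyramid (max_idPr (ltW h)).
rewrite ge_max; apply/andP; split.
  have := dot_le a v; rewrite mulrC => h1.
  have := ler_norm (dot a v); have := normr_ge0 v; move: vs; rewrite mulrDr mulr1; lra.
have := aN (z + v - x); rewrite addrAC dotDr -aE; lra.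
Qed.

End pyramid.

(** The pyramid of height [c * rho] with apex [x] is an admissible function: it
    is Lipschitz, it vanishes outside the cube, and its gradient takes values
    for which the quadratic form is at most [1]. *)
Lemma intrinsic_dist_ge (Omega : set V) (A : V -> 'M[R]_n) (x q : V) (c rho : R) :
  open Omega -> 0 < c -> 0 < rho -> closed_cube x rho `<=` Omega ->
  {ae mu, forall y, closed_cube x rho y -> qform (A y) q <= 1} ->
  {ae mu, forall y, closed_cube x rho y ->
    forall i, qform (A y) (c *: delta_mx ord0 i) <= 1} ->
  forall y, pyramid_norm q c (y - x) <= c * rho ->
    ((pyramid_norm q c (y - x))%:E <= intrinsic_dist Omega A x y)%E.
Proof.
move=> oO c0 rho0 KO hq he y hy.
have r0 : 0 < c * rho by rewrite mulr_gt0.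
have lipw := pyramid_lipschitz q c0 x (c * rho).
set w := pyramid q c x (c * rho).
have cw : continuous w by exact: (lipschitz_continuous lipw).
apply: ereal_sup_ubound; exists w; last first.
  have -> : w y = c * rho - pyramid_norm q c (y - x).
    by rewrite /w /pyramid; apply/max_idPr; rewrite subr_ge0.
  have -> : w x = c * rho.
    rewrite /w /pyramid subrr (_ : pyramid_norm q c 0 = 0) ?subr0; last first.
      rewrite /pyramid_norm normr0 mulr0 /dot big1 ?normr0 ?maxxx// => i _.
      by rewrite mxE mulr0.
    by apply/max_idPr; exact: ltW.
  by rewrite opprB addrC subrK.
split; first exact: continuous_subspaceT.
exists (fun z => \row_i diffq_lim w i z); split.
  by apply: (W12loc_grad_lipschitz oO lipw); exact: pyramid_bound.
apply: ae_mono (ae_and (ae_and hq he) (rademacher lipw)) => z [[h1 h2] dz] Oz.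
have -> : \row_i diffq_lim w i z = grad w z.
  by apply/rowP => i; rewrite !mxE diffq_lim_partial.
have [->|[zr [e H]]] := pyramid_grad c0 dz; first by rewrite qform0.
have zc : closed_cube x rho z by rewrite /closed_cube/= ltW// -(ltr_pM2l c0).
by case: H => [->|[i ->]]; rewrite qformZ sqrr_sign mul1r; [exact: h1|exact: h2].
Qed.

End intrinsic_lower.

(** * Upper limits, Lipschitz extension and weak upper semicontinuity *)

Section limsup.
Variables (R : realType) (n : nat).
Local Notation V := 'rV[R]_n.
Variables (f : V -> \bar R) (S : set V) (x : V) (l : \bar R).

Lemma limf_esup_within_le : (exists2 d, 0 < d & forall y, `|y - x| < d -> y != x -> S y ->
  (f y <= l)%E) -> (limf_esup f (within S x^') <= l)%E.
Proof.
move=> [d d0 hd]; rewrite limf_esupE.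
apply: (@le_trans _ _ (ereal_sup (f @` [set y | (f y <= l)%E]))).
  apply: ereal_inf_lbound; exists [set y | (f y <= l)%E] => //.
  apply/nbhs_ballP; exists d => //= y; rewrite -ball_normE /ball_/= distrC => xy yx Sy.
  exact: hd.
by apply: ge_ereal_sup => _ [y hy <-].
Qed.

Lemma limf_esup_within_ge : (forall d, 0 < d -> exists y, [/\ `|y - x| < d, y != x, S y &
  (l <= f y)%E]) -> (l <= limf_esup f (within S x^'))%E.
Proof.
move=> H; rewrite limf_esupE; apply: le_ereal_inf_tmp => _ [W FW <-].
have /nbhs_ballP[d /= d0 hd] := FW; have [y [yd yx Sy ly]] := H d d0.
apply: (le_trans ly); apply: ereal_sup_ubound; exists y => //.
by apply: hd => //; rewrite -ball_normE /ball_/= distrC.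
Qed.

Lemma limf_esup_within_lt : (limf_esup f (within S x^') < l)%E ->
  exists2 d, 0 < d & forall y, `|y - x| < d -> y != x -> S y -> (f y < l)%E.
Proof.
rewrite limf_esupE => /ereal_inf_lt[_ [W FW <-]] h.
have /nbhs_ballP[d /= d0 hd] := FW; exists d => // y yd yx Sy.
apply: le_lt_trans h; apply: ereal_sup_ubound; exists y => //.
by apply: hd => //; rewrite -ball_normE /ball_/= distrC.
Qed.

End limsup.

Section lipschitz_extension.
Variables (R : realType) (n : nat).
Local Notation V := 'rV[R]_n.

(** McShane's formula: the infimum over [y] in [Omega] of [u y + K |x - y|]. *)
Lemma lipschitz_extension (Omega : set V) (u : V -> R) (K : R) : 0 <= K ->
  (forall x y, Omega x -> Omega y -> `|u x - u y| <= K * `|x - y|) ->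
  exists w : V -> R, (forall x y, `|w x - w y| <= K * `|x - y|) /\ {in Omega, u =1 w}.
Proof.
move=> K0 uK; have [[y0 Oy0]|nO] := pselect (Omega !=set0); last first.
  exists (cst 0); split; first by move=> x y; rewrite subrr normr0 mulr_ge0.
  by move=> x /set_mem Ox; case: nO; exists x.
pose F x := [set u y + K * `|x - y| | y in Omega].
have lbF x : lbound (F x) (u y0 - K * `|x - y0|).
  move=> _ [y Oy <-]; have := uK _ _ Oy0 Oy; have := ler_norm (u y0 - u y).
  have : `|y0 - y| <= `|x - y0| + `|x - y|.
    by rewrite [`|x - y0|]distrC (le_trans (ler_distD x _ _)).
  by move=> /(ler_wpM2l K0); rewrite mulrDr; lra.
have neF x : F x !=set0 by exists (u y0 + K * `|x - y0|), y0.
have infF x : has_inf (F x) by split => //; exists (u y0 - K * `|x - y0|); exact: lbF.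
have main x y : inf (F x) <= inf (F y) + K * `|x - y|.
  rewrite -lerBlDr; apply: lb_le_inf => // _ [z Oz <-].
  rewrite lerBlDr; apply: (@le_trans _ _ (u z + K * `|x - z|)).
    by apply: ge_inf; [have [] := infF x|exists z].
  rewrite -addrA lerD2l -mulrDr ler_wpM2l// [leRHS]addrC.
  exact: ler_distD.
exists (fun x => inf (F x)); split.
  move=> x y; rewrite ler_norml; have := main x y; have := main y x.
  by rewrite [`|y - x|]distrC => h1 h2; apply/andP; split; lra.
move=> x /set_mem Ox; apply/eqP; rewrite eq_le; apply/andP; split.
  apply: lb_le_inf => // _ [y Oy <-]; have := uK _ _ Ox Oy.
  by have := ler_norm (u x - u y); lra.
by apply: ge_inf; [have [] := infF x|exists x => //; rewrite subrr normr0 mulr0 addr0].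
Qed.

Lemma differentiable_open_eq (Omega : set V) (u w : V -> R) (x : V) : open Omega ->
  Omega x -> {in Omega, u =1 w} -> differentiable w x -> differentiable u x.
Proof.
move=> oO Ox uw dw; suff H : forall eps, 0 < eps -> exists2 d, 0 < d & forall v : V, `|v| < d ->
    `|u (x + v) - u x - \sum_i v ord0 i * partial i w x| <= eps * `|v|.
  by have [] := differentiable_of_affine H.
move=> eps e0; have [d d0 hd] := affine_of_differentiable dw e0.
have /nbhs_ballP[r /= r0 hr] := open_nbhs_nbhs (conj oO Ox).
exists (Num.min d r); first by rewrite lt_min d0.
move=> v; rewrite lt_min => /andP[vd vr].
have Ov : Omega (x + v).
  by apply: hr; rewrite -ball_normE /ball_/= opprD addrA subrr sub0r normrN.
by rewrite !uw ?mem_set//; exact: hd.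
Qed.

End lipschitz_extension.

Section weak_usc.
Variables (R : realType) (n : nat).
Local Notation V := 'rV[R]_n.
Local Notation mu := (@lebesgue_rV R n).

Lemma lebesgue_rV_set1 (x : V) : (0 < n)%N -> mu [set x] = 0%E.
Proof.
move=> n0; apply/eqP; rewrite eq_le measure_ge0 andbT; apply/lee_addgt0Pr => e e0.
rewrite add0e; pose r := Num.min 1 e / 2.
have r0 : 0 < r by rewrite divr_gt0// lt_min ltr01.
have rE : 2 * r = Num.min 1 e by rewrite mulrC divfK.
apply: (@le_trans _ _ (mu (ball x r))).
  by apply: le_outer_measure => _ ->; exact: ballxx.
rewrite lebesgue_rV_ball// rE lee_fin; apply: (@le_trans _ _ (Num.min 1 e)); last first.
  by rewrite ge_min lexx orbT.
rewrite -[leRHS]expr1 ler_wiXn2l ?le_min ?ler01 ?(ltW e0) ?ge_min ?lexx//.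
Qed.

(** The upper limit is taken over the points different from [x] outside a null
    set, which are almost all points. *)
Lemma weak_usc_near (Omega : set V) (f : V -> R) (x : V) (l : R) : (0 < n)%N ->
  weak_usc_at Omega f x -> f x < l ->
  exists2 d, 0 < d & {ae mu, forall y, `|y - x| < d -> Omega y -> f y <= l}.
Proof.
move=> n0 [E [NE hE]] fl.
have [|d d0 hd] := @limf_esup_within_lt R n (fun y => (f y)%:E) (Omega `\` E) x l%:E.
  by apply: (le_lt_trans hE); rewrite lte_fin.
exists d => //.
have N1 : mu.-negligible [set x].
  by apply: outer_null_negligible; exact: lebesgue_rV_set1.
apply: negligibleS (negligibleU NE N1) => y /= H.
apply: contrapT => /not_orP[nE nx]; apply: H => yd Oy.
rewrite -lee_fin ltW//; apply: hd => //; by apply/eqP.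
Qed.

End weak_usc.

(** * The pointwise Lipschitz constant *)

Section pointwise_lipschitz.
Variables (R : realType) (n : nat).
Local Notation V := 'rV[R]_n.
Local Notation mu := (@lebesgue_rV R n).

Lemma rational_approx (a : V) (e : R) : 0 < e ->
  exists p : 'rV[rat]_n, forall i, `|ratr (p ord0 i) - a ord0 i| < e.
Proof.
move=> e0.
have H i : exists r : rat, `|ratr r - a ord0 i| < e.
  have [r] := @rat_in_itvoo R (a ord0 i - e) (a ord0 i + e) ltac:(lra).
  by rewrite in_itv/= => /andP[h1 h2]; exists r; rewrite ltr_norml; apply/andP; split; lra.
have [f hf] := choice H; exists (\row_i f i) => i; rewrite mxE; exact: hf.
Qed.

Lemma continuous_qform (M : 'M[R]_n) : continuous (qform M).
Proof.
move=> x; apply: differentiable_continuous.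
rewrite (_ : qform M = \sum_i \sum_j (fun xi : V => xi ord0 i * M i j * xi ord0 j)); last first.
  by apply/funext => xi; rewrite fct_sumE; apply: eq_bigr => i _; rewrite fct_sumE.
apply: differentiable_sum => i; apply: differentiable_sum => j.
apply: differentiableM; last exact: differentiable_coord.
by apply: differentiableM; [exact: differentiable_coord|exact: differentiable_cst].
Qed.

Lemma ratio_le (a b k : R) (D : \bar R) : 0 <= a -> 0 < b -> (b%:E <= D)%E -> a <= k * b ->
  (a%:E / D <= k%:E)%E.
Proof.
move=> a0 b0; have k0 : a <= k * b -> 0 <= k.
  by move=> h; rewrite -(pmulr_lge0 _ b0) (le_trans a0).
case: D => [r| |]; rewrite ?lee_fin ?leeNy_eq// => br ak.
  have r0 : 0 < r by lra.
  rewrite inver gt_eqF// -EFinM lee_fin ler_pdivrMr//; apply: (le_trans ak).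
  by rewrite ler_wpM2l// k0.
by rewrite mulr0 k0.
Qed.

Lemma ratio_ge (a b k : R) (D : \bar R) : 0 <= a -> 0 < b -> (0 < D)%E -> (D <= b%:E)%E -> k * b <= a ->
  (k%:E <= a%:E / D)%E.
Proof.
move=> a0 b0; case: D => [r| |]; rewrite ?leye_eq// ?lee_fin ?lte_fin => r0 rb ka.
rewrite inver gt_eqF// -EFinM lee_fin ler_pdivlMr//.
have [k0|k0] := lerP 0 k; last by apply: (le_trans _ a0); rewrite mulr_le0_ge0// ltW.
by apply: le_trans ka; rewrite ler_wpM2l.
Qed.

Variables (Omega : set V) (A : V -> 'M[R]_n) (x : V).
Hypotheses (n0 : (0 < n)%N) (oO : open Omega) (hA : elliptic_class Omega A) (Ox : Omega x).

Hypothesis wusc : forall p : 'rV[rat]_n, enorm (map_mx ratr p : V) != 0 ->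
  weak_usc_at Omega (fun y => qform (A y) ((enorm (map_mx ratr p : V))^-1 *: map_mx ratr p)) x.

(** The constant [c] is obtained from ellipticity before the direction [p] is
    chosen; this order matters, since [p] will have to approximate a given
    vector with an accuracy proportional to [c]. *)
Lemma intrinsic_dist_ge_rational : exists2 c, 0 < c &
  forall p : 'rV[rat]_n, qform (A x) (map_mx ratr p) < 1 -> exists2 d, 0 < d &
    forall y, `|y - x| < d ->
      ((pyramid_norm (map_mx ratr p) c (y - x))%:E <= intrinsic_dist Omega A x y)%E.
Proof.
have [rho1 rho10 KO1] := closed_cube_sub oO Ox.
have [Lam L1 hLam] := elliptic_on_compact hA (@compact_closed_cube _ _ x rho1) KO1.
have L0 : 0 < Lam by lra.
exists Lam^-1; rewrite ?invr_gt0// => p Hp; set q : V := map_mx ratr p.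
have [d1 d10 hd1] : exists2 d, 0 < d &
    {ae mu, forall y, `|y - x| < d -> Omega y -> qform (A y) q <= 1}.
  have [q0|q0] := eqVneq (enorm q) 0.
    have {}q0 : q = 0 by apply/eqP; rewrite -normr_le0 -q0 norm_le_enorm.
    by exists 1 => //; apply: aeW => y _ _; rewrite q0 qform0.
  have eq0 : 0 < enorm q ^+ 2 by rewrite exprn_gt0// lt_def q0 enorm_ge0.
  have qE y : qform (A y) q = enorm q ^+ 2 * qform (A y) ((enorm q)^-1 *: q).
    by rewrite qformZ mulrA -exprMn divff// expr1n mul1r.
  have [|d d0 hd] := @weak_usc_near R n Omega _ x (enorm q ^- 2) n0 (wusc q0).
    by rewrite -(ltr_pM2l eq0) divff ?gt_eqF// -qE.
  exists d => //; apply: ae_mono hd => y hy yd Oy.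
  by rewrite qE -ler_pdivlMl// mulr1 hy.
pose rho := Num.min (d1 / 2) rho1.
have rho0 : 0 < rho by rewrite lt_min rho10 divr_gt0.
have rhod : rho < d1 by rewrite gt_min; apply/orP; left; lra.
have cc y : closed_cube x rho y -> closed_cube x rho1 y.
  by rewrite /closed_cube/= => hy; apply: (le_trans hy); rewrite ge_min lexx orbT.
have KO : closed_cube x rho `<=` Omega by move=> y /cc; exact: KO1.
have c0 : 0 < Lam^-1 by rewrite invr_gt0.
pose S := \sum_i `|q ord0 i| + Lam^-1.
have S0 : 0 < S by rewrite ltr_wpDl// sumr_ge0.
exists (Lam^-1 * rho / S); first by rewrite divr_gt0// mulr_gt0.
move=> y yx; apply: (intrinsic_dist_ge oO c0 rho0 KO).
- by apply: ae_mono hd1 => z hz zc; apply: hz; [exact: le_lt_trans zc rhod|exact: KO].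
- apply: ae_mono hLam => z hz zc i; have /andP[_ h] := hz (cc _ zc) (delta_mx ord0 i).
  rewrite qformZ exprVn -ler_pdivlMl ?invr_gt0 ?exprn_gt0// invrK mulr1.
  by apply: (le_trans h); rewrite enorm_delta expr1n mulr1 expr2 ler_peMl// ltW.
- apply: (le_trans (pyramid_norm_le _ c0 _)); rewrite -/S mulrC -ler_pdivlMr//.
  exact: ltW.
Qed.

Variable u : V -> R.
Hypothesis du : differentiable u x.
Hypothesis A0 : forall zeta, 0 <= qform (A x) zeta.
Let g := grad u x.
Let h := Num.sqrt (qform (A x) g).

Let h0 : 0 <= h. Proof. exact: sqrtr_ge0. Qed.
Let hh : qform (A x) g = h ^+ 2. Proof. by rewrite sqr_sqrtr. Qed.

Let u_affine (eps : R) : 0 < eps -> exists2 d, 0 < d & forall v : V, `|v| < d ->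
  `|u (x + v) - u x - dot g v| <= eps * `|v|.
Proof.
move=> e0; have [d d0 hd] := affine_of_differentiable du e0.
by exists d => // v /hd; rewrite dot_grad.
Qed.

(** The ratio is bounded with the pyramid norm of a rational [q] close to [s^-1
    *: g]: its first part controls the linear part of the increment of [u], its
    second part absorbs both the approximation error and the remainder. *)
Lemma Lip_le : (Lip Omega A u x <= h%:E)%E.
Proof.
apply/lee_addgt0Pr => e e0; rewrite -EFinD.
have [c c0 hc] := intrinsic_dist_ge_rational.
pose s := h + e / 2; have s0 : 0 < s by rewrite ltr_wpDl// divr_gt0.
pose eta := c * e / 8; have eta0 : 0 < eta by rewrite divr_gt0// mulr_gt0.
have [d1 d10 hd1] := u_affine eta0.
have [d2 d20 hd2] : exists2 d, 0 < d & forall xi : V, `|xi - s^-1 *: g| < d -> qform (A x) xi < 1.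
  have h1 : 0 < 1 - qform (A x) (s^-1 *: g).
    rewrite subr_gt0 qformZ hh -exprMn mulrC expr_lt1 ?ltr_pdivrMr ?mul1r ?divr_ge0 ?(ltW s0)//.
    by rewrite /s; lra.
  have /cvgrPdist_lt/(_ _ h1)/nbhs_ballP[d /= d0 hd] := @continuous_qform (A x) (s^-1 *: g).
  exists d => // xi hxi; have := hd xi; rewrite -ball_normE /ball_/= distrC => /(_ hxi).
  by rewrite distrC => /ltr_normlW; lra.
pose dl := Num.min (d2 / 2) (eta / (n%:R * s + 1)).
have ns0 : 0 < n%:R * s + 1 by rewrite ltr_wpDl// mulr_ge0// ltW.
have dl0 : 0 < dl by rewrite lt_min; apply/andP; split; apply: divr_gt0.
have [p hp] := rational_approx (s^-1 *: g) dl0.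
set q : V := map_mx ratr p.
have qi i : `|(q - s^-1 *: g) ord0 i| < dl by have := hp i; rewrite /q !mxE.
have [d3 d30 hd3] : exists2 d, 0 < d & forall y, `|y - x| < d ->
      ((pyramid_norm q c (y - x))%:E <= intrinsic_dist Omega A x y)%E.
  apply: hc; apply: hd2; apply: (@lt_le_trans _ _ (d2 / 2 + d2 / 2)); last by lra.
  apply: (@le_lt_trans _ _ dl); last first.
    by apply: (@le_lt_trans _ _ (d2 / 2)); [rewrite ge_min lexx|lra].
  apply/rV_norm_le; first exact: ltW.
  by move=> i; apply: ltW; exact: qi.
apply: limf_esup_within_le; exists (Num.min d1 d3); first by rewrite lt_min d10.
move=> y; rewrite lt_min => /andP[y1 y3] yx _.
have v0 : 0 < `|y - x| by rewrite normr_gt0 subr_eq0.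
have := hd1 (y - x) y1; rewrite subrKC => hu.
have cN : c * `|y - x| <= pyramid_norm q c (y - x) by rewrite le_max lexx orbT.
have qN : `|dot q (y - x)| <= pyramid_norm q c (y - x) by rewrite le_max lexx.
have N0 : 0 < pyramid_norm q c (y - x) by apply: lt_le_trans cN; rewrite mulr_gt0.
apply: (ratio_le _ N0 (hd3 y y3)); first exact: normr_ge0.
(* [g] is [s *: q] up to an error controlled by the term [c * `|y - x|] of the pyramid norm *)
have gq : `|dot g (y - x)| <= s * `|dot q (y - x)| + eta * `|y - x|.
  have -> : dot g (y - x) = s * dot q (y - x) + s * dot (s^-1 *: g - q) (y - x).
    by rewrite -mulrDr -dotDl subrKC dotZl mulVKf// gt_eqF.
  apply: (le_trans (ler_normD _ _)); rewrite !normrM gtr0_norm// lerD2l.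
  apply: (le_trans (ler_wpM2l (ltW s0) (dot_le _ _))); rewrite mulrA ler_wpM2r//.
  apply: (@le_trans _ _ (s * (n%:R * dl))).
    rewrite ler_wpM2l ?(ltW s0)//; apply: (@le_trans _ _ (\sum_(i < n) dl)).
      by apply: ler_sum => i _; rewrite -(opprB q) mxE normrN ltW// qi.
    by rewrite sumr_const card_ord -[leLHS]mulr_natl.
  have : dl <= eta / (n%:R * s + 1) by rewrite ge_min lexx orbT.
  rewrite ler_pdivlMr// mulrA [s * _]mulrC mulrDr mulr1 [dl * _]mulrC => H.
  by apply: le_trans H; rewrite lerDl ltW.
have : `|u y - u x| <= `|dot g (y - x)| + eta * `|y - x|.
  have -> : u y - u x = dot g (y - x) + (u y - u x - dot g (y - x)) by rewrite subrKC.
  by apply: (le_trans (ler_normD _ _)); rewrite lerD2l.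
have sq : s * `|dot q (y - x)| <= s * pyramid_norm q c (y - x) by rewrite ler_wpM2l// ltW.
have ec : 2 * (eta * `|y - x|) <= e / 4 * pyramid_norm q c (y - x).
  rewrite /eta (_ : 2 * _ = e / 4 * (c * `|y - x|)); last by field.
  by rewrite ler_wpM2l// ltW// divr_gt0.
have : h + e = s + e / 2 by rewrite /s; lra.
move=> ->; move: gq sq ec N0; move: (pyramid_norm q c (y - x)) => NN.
move: (s * `|dot q _|) (eta * `|_|) => X Y gq sq ec N0 hu'; rewrite mulrDl.
have : e / 4 * NN <= e / 2 * NN by rewrite ler_wpM2r ?(ltW N0)//; lra.
by lra.
Qed.

Hypothesis Aac : forall i j, approx_continuous_at Omega (fun y => A y i j) x.

(** Points [x + t *: sym_apply (A x) g] with [t] tending to zero realise the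
    constant. When [h] vanishes this direction may degenerate, and the bound is
    the nonnegativity of the ratio. *)
Lemma Lip_ge : (h%:E <= Lip Omega A u x)%E.
Proof.
have [c c0 hc] := intrinsic_dist_ge_rational.
have [d0 d00 hd0] : exists2 d, 0 < d & forall y, `|y - x| < d -> y != x ->
    (0 < intrinsic_dist Omega A x y)%E.
  have [|d dgt0 hd] := hc 0; first by rewrite map_mx0 qform0.
  exists d => // y yd yx; apply: lt_le_trans (hd y yd); rewrite lte_fin.
  rewrite /pyramid_norm lt_max; apply/orP; right.
  by rewrite mulr_gt0// normr_gt0 subr_eq0.
have [r r0 hr] := closed_cube_sub oO Ox.
apply/lee_subgt0Pr => e e0; rewrite -EFinB.
apply: limf_esup_within_ge => d dgt0.
have near_t (v : V) (rr : R) : v != 0 -> 0 < rr -> exists t, [/\ 0 < t, t < rr,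
    `|t *: v| < Num.min (Num.min d d0) r, x + t *: v != x & Omega (x + t *: v)].
  move=> v0 rr0; set m := Num.min (Num.min d d0) r.
  have m0 : 0 < m by rewrite !lt_min dgt0 d00.
  have nv : 0 < `|v| by rewrite normr_gt0.
  have [t /andP[t0]] : exists t, 0 < t < Num.min rr (m / `|v|).
    have M0 : 0 < Num.min rr (m / `|v|) by rewrite lt_min rr0 divr_gt0.
    by exists (Num.min rr (m / `|v|) / 2); apply/andP; split; lra.
  rewrite lt_min => /andP[trr]; rewrite ltr_pdivlMr// => tm.
  have ntv : `|t *: v| < m by rewrite normrZ gtr0_norm.
  exists t; split => //; first by rewrite addrC -subr_eq0 addrK scaler_eq0 negb_or v0 gt_eqF.
  apply: hr; rewrite /closed_cube/= addrAC subrr add0r ltW// (lt_le_trans ntv)//.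
  by rewrite ge_min lexx orbT.
have [hz|hz] := eqVneq h 0.
  have v0 : (const_mx 1 : V) != 0.
    apply/eqP => /rowP/(_ (Ordinal n0)); rewrite !mxE => /eqP; by rewrite oner_eq0.
  have [t [t0 _ tm tx tO]] := near_t _ 1 v0 ltr01.
  move: tm; rewrite !lt_min => /andP[/andP[td td0] _].
  exists (x + t *: const_mx 1); split => //; first by rewrite addrAC subrr add0r.
  apply: (@le_trans _ _ 0%E); first by rewrite lee_fin; lra.
  apply: mule_ge0 => //; rewrite inve_ge0 ltW// hd0//.
  by rewrite addrAC subrr add0r.
have hgt0 : 0 < h by rewrite lt_def hz h0.
set b := sym_apply (A x) g.
have gb : dot g b = h ^+ 2 by rewrite -qformE.
have b0 : b != 0.
  apply/eqP => b0; move: gb; rewrite b0 -(scale0r (0 : V)) dotZr mul0r => /esym/eqP.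
  by rewrite expf_eq0/= (negbTE hz).
have nb : 0 < `|b| by rewrite normr_gt0.
have e20 : 0 < e / 2 by rewrite divr_gt0.
have [d1 d10 hd1] := intrinsic_dist_le oO g hA Ox A0 Aac e20.
have eta0 : 0 < h * (e / 2) / `|b| by rewrite divr_gt0// mulr_gt0.
have [d2 d20 hd2] := u_affine eta0.
have [t [t0]] := near_t b (Num.min d1 (d2 / `|b|)) b0 ltac:(by rewrite lt_min d10 divr_gt0).
rewrite lt_min => /andP[td1]; rewrite ltr_pdivlMr// => td2 tm tx tO.
move: tm; rewrite !lt_min => /andP[/andP[td td0] _].
have xx : x + t *: b - x = t *: b by rewrite addrAC subrr add0r.
exists (x + t *: b); split => //; first by rewrite xx.
have tb0 : 0 < t * (h + e / 2) by rewrite mulr_gt0// addr_gt0.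
apply: (ratio_ge (normr_ge0 _) tb0) => //.
- by apply: hd0 => //; rewrite xx.
- exact: hd1.
have := hd2 (t *: b); rewrite normrZ gtr0_norm// => /(_ td2).
rewrite dotZr gb (_ : _ * (t * `|b|) = t * (h * (e / 2))); last by field; rewrite gt_eqF.
move: (u _ - u x) => D hD.
have hD' : t * h ^+ 2 <= `|D| + t * (h * (e / 2)).
  have -> : t * h ^+ 2 = D - (D - t * h ^+ 2) by rewrite subKr.
  by apply: (le_trans (ler_norm _)); apply: (le_trans (ler_normB _ _)); rewrite lerD2l.
apply: (@le_trans _ _ (t * h ^+ 2 - t * (h * (e / 2)))); last by lra.
rewrite mulrCA -mulrBr ler_wpM2l ?(ltW t0)//.
by have := sqr_ge0 e; nra.
Qed.

End pointwise_lipschitz.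

Theorem theorem2p2 (R : realType) (n : nat) (n_ge2 : (2 <= n)%N)
    (Omega : set 'rV[R]_n) (domOmega : domain Omega)
    (A : 'rV[R]_n -> 'M[R]_n) (AwuscOmega : elliptic_class_wusc Omega A)
    (u : 'rV[R]_n -> R) (lipu : euclidean_lipschitz Omega u) :
  {ae @lebesgue_rV R n, forall x, Omega x ->
    differentiable u x /\
    ((Lip Omega A u x) ^+ 2)%E = (qform (A x) (grad u x))%:E}.
Proof.
have [oO _] := domOmega; have [hA wusc] := AwuscOmega.
have [mA [lam [_ lam1 hlam]]] := hA.
have n0 : (0 < n)%N by exact: leq_trans n_ge2.
have mO := open_measurable_rV oO.
have [w [lipw uw]] : exists w : 'rV[R]_n -> R,
    (exists K, forall x y, `|w x - w y| <= K * `|x - y|) /\ {in Omega, u =1 w}.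
  have [K hK] := lipu; have [||w [hw uw]] := @lipschitz_extension R n Omega u (`|K| * n%:R).
  - by rewrite mulr_ge0.
  - move=> x y Ox Oy; apply: (le_trans (hK x y Ox Oy)).
    rewrite -mulrA; apply: (@le_trans _ _ (`|K| * enorm (x - y))).
      by rewrite ler_wpM2r ?enorm_ge0// ler_norm.
    by rewrite ler_wpM2l// enorm_le.
  by exists w; split => //; exists (`|K| * n%:R).
have [K hK] := lipw.
have ac : {ae @lebesgue_rV R n, forall x, forall ij : 'I_n * 'I_n,
    Omega x -> approx_continuous_at Omega (fun y => A y ij.1 ij.2) x}.
  by apply: ae_countable => ij; exact: ae_approx_continuous.
have us : {ae @lebesgue_rV R n, forall x, forall p : 'rV[rat]_n,
    enorm (map_mx ratr p : 'rV[R]_n) != 0 -> Omega x -> weak_usc_at Omega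
      (fun y => qform (A y) ((enorm (map_mx ratr p : 'rV[R]_n))^-1 *: map_mx ratr p)) x}.
  apply: ae_countable => p; have [p0|p0] := eqVneq (enorm (map_mx ratr p : 'rV[R]_n)) 0.
    exact: aeW.
  have := wusc ((enorm (map_mx ratr p : 'rV[R]_n))^-1 *: map_mx ratr p) _.
  rewrite enormZ gtr0_norm ?invr_gt0 ?lt_def ?p0 ?enorm_ge0// mulVf// => /(_ erefl).
  by apply: ae_mono => x hx _ Ox; exact: hx.
apply: ae_mono (ae_and (ae_and hlam (rademacher hK)) (ae_and ac us)) => x.
move=> [[hl dw] [acx usx]] Ox.
have du := differentiable_open_eq oO Ox uw dw; split => //.
have A0 xi : 0 <= qform (A x) xi.
  have /andP[h _] := hl Ox xi; apply: le_trans h.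
  by rewrite mulr_ge0 ?sqr_ge0// invr_ge0 (le_trans ler01)// lam1.
have wx p (p0 : enorm (map_mx ratr p : 'rV[R]_n) != 0) := usx p p0 Ox.
have -> : Lip Omega A u x = (Num.sqrt (qform (A x) (grad u x)))%:E.
  apply/eqP; rewrite eq_le Lip_le//= Lip_ge// => i j.
  exact: (acx (i, j)).
by rewrite -EFin_expe sqr_sqrtr.
Qed.
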